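(* Let $k$ be a field and let $A$ be a graded coherent regular graded $k$-algebra of global dimension $d\ge 0$. Then: (1) $A$ satisfies the condition $\chi$, i.e. $\dim_k\operatorname{Ext}^i_A(k,M)<\infty$ for all $i\ge 0$ and every finitely presented graded right $A$-module $M$; (2) the algebra $A$ may be recovered from its noncommutative scheme $\operatorname{proj}A:=(\operatorname{qgr}A,\mathcal A,s)$ as $$A\cong\Gamma_{\ge 0}(\operatorname{proj}A);$$ (3) the category $\operatorname{qgr}A$ is $\operatorname{Ext}$-finite and has cohomological dimension $d-1$.
   Context: A graded algebra is an $\mathbb N$-graded associative $k$-algebra $A=A_0\oplus A_1\oplus\cdots$ which is connected ($A_0=k$) and finitely generated. All modules are $\mathbb Z$-graded and all elements and maps of modules are homogeneous. A graded algebra $A$ is called regular if it has finite global dimension $d$ and satisfies the Gorenstein property: $\operatorname{Ext}^i_A(k_A,A_A)=0$ for $i\neq d$ and $\operatorname{Ext}^d_A(k_A,A_A)\cong k[l]$ for some $l\in\mathbb Z$, where $[l]$ denotes a shift of grading. $A$ is graded coherent if every finitely generated homogeneous right ideal of $A$ is finitely presented; equivalently, the finitely presented graded right $A$-modules form an abelian category. Here $\operatorname{Ext}^i_A(k,M)$ denotes the total graded Ext space (the direct sum over all degree shifts). For a graded coherent algebra $A$: $\operatorname{cmod}A$ is the abelian category of finitely presented graded right $A$-modules; $\operatorname{tors}A$ is its Serre subcategory of finite-dimensional modules; $\operatorname{qgr}A=\operatorname{cmod}A/\operatorname{tors}A$; $\mathcal A$ is the image of $A_A$ in $\operatorname{qgr}A$;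 $s$ is the autoequivalence of $\operatorname{qgr}A$ induced by the shift of grading $M\mapsto M[1]$, $M[1]_i=M_{i+1}$. For a triple $X=(\mathcal C,\mathcal A,s)$ consisting of a $k$-linear abelian category $\mathcal C$, an object $\mathcal A$ and an autoequivalence $s$, $\Gamma_{\ge0}(X)=\bigoplus_{i\ge 0}\operatorname{Hom}_{\mathcal C}(\mathcal A,s^i(\mathcal A))$ is the graded algebra with multiplication $a\cdot b:=s^j(a)\circ b$ for $a:\mathcal A\to s^i(\mathcal A)$, $b:\mathcal A\to s^j(\mathcal A)$. A $k$-linear abelian category is $\operatorname{Ext}$-finite if all spaces $\operatorname{Ext}^i(X,Y)$ are finite-dimensional over $k$; its cohomological dimension is the largest $i$ such that $\operatorname{Ext}^i(X,Y)\ne0$ for some objects $X,Y$.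
   Formalization: Part (2) is stated only for d ≥ 1: for d = 0 one has A = k, every finitely presented module is finite-dimensional, so qgr A = 0 and Γ≥0(proj A) = 0, not k. In (3) for d = 0, cohomological dimension −1 means that all Ext vanish. *)

(* Defs.v *)
From HB Require Import structures.
From Stdlib Require Import Setoid Morphisms.
From Stdlib Require Import Relation_Operators.
From mathcomp Require Import all_boot all_order all_algebra.
From mathcomp Require Import boolp.

Set Implicit Arguments.
Unset Strict Implicit.
Unset Printing Implicit Defensive.
Import GRing.Theory.
Local Open Scope ring_scope.

(* k-linear categories: hom-sets are setoids, [heq] being equality of          *)
(* morphisms.                                                                  *)

Record klcat (k : fieldType) := KLCat {
  ob :> Type;
  hom : ob -> ob -> Type;
  heq : forall X Y, hom X Y -> hom X Y -> Prop;
  idm : forall X, hom X X;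
  comp : forall X Y Z, hom Y Z -> hom X Y -> hom X Z;
  hzero : forall X Y, hom X Y;
  hadd : forall X Y, hom X Y -> hom X Y -> hom X Y;
  hscale : forall X Y, k -> hom X Y -> hom X Y;
  heq_refl : forall X Y (f : hom X Y), heq f f;
  heq_sym : forall X Y (f g : hom X Y), heq f g -> heq g f;
  heq_trans : forall X Y (f g h : hom X Y), heq f g -> heq g h -> heq f h;
  comp_heq : forall X Y Z (g g' : hom Y Z) (f f' : hom X Y),
    heq g g' -> heq f f' -> heq (comp g f) (comp g' f');
  hadd_heq : forall X Y (f f' g g' : hom X Y),
    heq f f' -> heq g g' -> heq (hadd f g) (hadd f' g');
  hscale_heq : forall X Y c (f f' : hom X Y),
    heq f f' -> heq (hscale c f) (hscale c f');
  compA : forall X Y Z T (h : hom Z T) (g : hom Y Z) (f : hom X Y),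
    heq (comp h (comp g f)) (comp (comp h g) f);
  comp1m : forall X Y (f : hom X Y), heq (comp (idm Y) f) f;
  compm1 : forall X Y (f : hom X Y), heq (comp f (idm X)) f;
  haddA : forall X Y (f g h : hom X Y),
    heq (hadd f (hadd g h)) (hadd (hadd f g) h);
  haddC : forall X Y (f g : hom X Y), heq (hadd f g) (hadd g f);
  hadd0 : forall X Y (f : hom X Y), heq (hadd (hzero X Y) f) f;
  haddN : forall X Y (f : hom X Y), heq (hadd f (hscale (- 1) f)) (hzero X Y);
  hscaleA : forall X Y a b (f : hom X Y),
    heq (hscale a (hscale b f)) (hscale (a * b) f);
  hscale1 : forall X Y (f : hom X Y), heq (hscale 1 f) f;
  hscaleDr : forall X Y a (f g : hom X Y),
    heq (hscale a (hadd f g)) (hadd (hscale a f) (hscale a g));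
  hscaleDl : forall X Y a b (f : hom X Y),
    heq (hscale (a + b) f) (hadd (hscale a f) (hscale b f));
  compDl : forall X Y Z (g g' : hom Y Z) (f : hom X Y),
    heq (comp (hadd g g') f) (hadd (comp g f) (comp g' f));
  compDr : forall X Y Z (g : hom Y Z) (f f' : hom X Y),
    heq (comp g (hadd f f')) (hadd (comp g f) (comp g f'));
  compZl : forall X Y Z a (g : hom Y Z) (f : hom X Y),
    heq (comp (hscale a g) f) (hscale a (comp g f));
  compZr : forall X Y Z a (g : hom Y Z) (f : hom X Y),
    heq (comp g (hscale a f)) (hscale a (comp g f))
}.

Arguments hom {k} C X Y : rename.
Arguments heq {k C X Y} : rename.
Arguments idm {k C} X : rename.
Arguments comp {k C X Y Z} : rename.
Arguments hzero {k C} X Y : rename.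
Arguments hadd {k C X Y} : rename.
Arguments hscale {k C X Y} : rename.

Declare Scope kl_scope.
Delimit Scope kl_scope with KL.
Notation "f == g" := (heq f g) : kl_scope.
Notation "g \o f" := (comp g f) : kl_scope.
Notation "f + g" := (hadd f g) : kl_scope.
Notation "c *: f" := (hscale c f) : kl_scope.
Notation "1" := (idm _) : kl_scope.
Notation "0" := (hzero _ _) : kl_scope.

#[global] Instance heq_Equivalence k (C : klcat k) X Y :
  Equivalence (@heq k C X Y).
Proof.
split; [exact: heq_refl | exact: heq_sym | exact: heq_trans].
Qed.

#[global] Hint Resolve heq_refl : core.

#[global] Instance comp_Proper k (C : klcat k) X Y Z :
  Proper (heq ==> heq ==> heq) (@comp k C X Y Z).
Proof. by move=> g g' Hg f f' Hf; exact: comp_heq. Qed.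

#[global] Instance hadd_Proper k (C : klcat k) X Y :
  Proper (heq ==> heq ==> heq) (@hadd k C X Y).
Proof. by move=> g g' Hg f f' Hf; exact: hadd_heq. Qed.

#[global] Instance hscale_Proper k (C : klcat k) X Y c :
  Proper (heq ==> heq) (@hscale k C X Y c).
Proof. by move=> f f' Hf; exact: hscale_heq. Qed.

Record functor (k : fieldType) (C D : klcat k) := Functor {
  fob :> C -> D;
  fhom : forall X Y, hom C X Y -> hom D (fob X) (fob Y);
  fhom_heq : forall X Y (f g : hom C X Y), heq f g -> heq (fhom f) (fhom g);
  fhom1 : forall X, heq (fhom (idm X)) (idm (fob X));
  fhomM : forall X Y Z (g : hom C Y Z) (f : hom C X Y),
    heq (fhom (comp g f)) (comp (fhom g) (fhom f));
  fhomD : forall X Y (f g : hom C X Y),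
    heq (fhom (hadd f g)) (hadd (fhom f) (fhom g));
  fhomZ : forall X Y c (f : hom C X Y),
    heq (fhom (hscale c f)) (hscale c (fhom f))
}.

Arguments fhom {k C D} F {X Y} : rename.

#[global] Instance fhom_Proper k (C D : klcat k) (F : functor C D) X Y :
  Proper (heq ==> heq) (@fhom k C D F X Y).
Proof. by move=> f f' Hf; exact: fhom_heq. Qed.

Section Categories.
Variables (k : fieldType) (C : klcat k).
Local Open Scope kl_scope.

Lemma fhom0 (F : functor C C) X Y : fhom F (hzero X Y) == 0.
Proof. rewrite -(haddN (hzero X Y)) fhomD fhomZ; exact: haddN. Qed.

(* a and its inverse b : a natural isomorphism from F o G to the identity.     *)
Definition natiso_id (F G : functor C C)
    (a : forall X, hom C (F (G X)) X) (b : forall X, hom C X (F (G X))) : Prop :=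
  [/\ forall X Y (f : hom C X Y), a Y \o fhom F (fhom G f) == f \o a X,
      forall X, a X \o b X == 1 & forall X, b X \o a X == 1].

Definition quasi_inverse (F G : functor C C) : Prop :=
  (exists a b, @natiso_id F G a b) /\ (exists a b, @natiso_id G F a b).

Definition autoequivalence (F : functor C C) : Prop :=
  exists G, quasi_inverse F G.

Definition is_kernel K M N (f : hom C M N) (i : hom C K M) : Prop :=
  f \o i == 0 /\
  forall T (g : hom C T M), f \o g == 0 ->
    exists u, i \o u == g /\ forall v, i \o v == g -> v == u.

Definition is_cokernel M N Q (f : hom C M N) (p : hom C N Q) : Prop :=
  p \o f == 0 /\
  forall T (g : hom C N T), g \o f == 0 ->
    exists u, u \o p == g /\ forall v, v \o p == g -> v == u.

Definition epi X Y (e : hom C X Y) : Prop :=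
  forall Z (f g : hom C Y Z), f \o e == g \o e -> f == g.

Definition projective P : Prop :=
  forall X Y (e : hom C X Y) (f : hom C P Y), epi e ->
    exists g : hom C P X, e \o g == f.

(* 0 -> Y -> mid -> X -> 0 *)
Record ses (Y X : C) := Ses {
  mid : C;
  inj : hom C Y mid;
  prj : hom C mid X;
  ses_ker : is_kernel prj inj;
  ses_coker : is_cokernel inj prj
}.

(* There is a projective resolution of length at most n. *)
Fixpoint pdim_le (n : nat) (X : C) : Prop :=
  match n with
  | 0%N => projective X
  | m.+1 => exists (K : C) (s : ses K X), projective (mid s) /\ pdim_le m K
  end.

Definition gldim_eq (d : nat) : Prop :=
  (forall X : C, pdim_le d X) /\
  forall n : nat, (forall X : C, pdim_le n X) -> (d <= n)%N.

Definition is_biprod X1 X2 S (i1 : hom C X1 S) (i2 : hom C X2 S)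
    (p1 : hom C S X1) (p2 : hom C S X2) : Prop :=
  [/\ p1 \o i1 == 1, p2 \o i2 == 1, p1 \o i2 == 0, p2 \o i1 == 0
    & (i1 \o p1) + (i2 \o p2) == 1].

(* yext n X Y is the class of (n+1)-fold extensions of X by Y, i.e. of exact   *)
(* sequences 0 -> Y -> E_n -> ... -> E_0 -> X -> 0, cut into short exact       *)
(* sequences at the images of the differentials.                               *)
Fixpoint yext (n : nat) (X Y : C) : Type :=
  match n with
  | 0%N => ses Y X
  | m.+1 => {Z : C & (ses Y Z * yext m X Z)%type}
  end.

Definition ses_mor Y X Y' X' (s : ses Y X) (s' : ses Y' X')
    (g : hom C Y Y') (f : hom C X X') : Prop :=
  exists e : hom C (mid s) (mid s'),
    e \o inj s == inj s' \o g /\ prj s' \o e == f \o prj s.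

(* There is a morphism of exact sequences E -> E' with end components          *)
(* f : X -> X' and g : Y -> Y'. In Ext this means g_* E = f^* E'.              *)
Fixpoint yext_mor (n : nat) (X Y X' Y' : C) :
    yext n X Y -> yext n X' Y' -> hom C X X' -> hom C Y Y' -> Prop :=
  match n with
  | 0%N => fun s s' f g => ses_mor s s' g f
  | m.+1 => fun E E' f g =>
      exists h : hom C (projT1 E) (projT1 E'),
        ses_mor (projT2 E).1 (projT2 E').1 g h /\
        yext_mor (projT2 E).2 (projT2 E').2 f h
  end.

Definition yext_eq n X Y : yext n X Y -> yext n X Y -> Prop :=
  clos_refl_sym_trans _ (fun E E' => yext_mor E E' 1 1).

(* c E is the push-out of E along c : Y -> Y. *)
Definition yext_scale n X Y (c : k) (E G : yext n X Y) : Prop :=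
  yext_mor E G 1 (c *: 1).

(* Baer sum: G is the push-out along the codiagonal of the pull-back D along   *)
(* the diagonal of an extension S of X (+) X by Y (+) Y which is the direct    *)
(* sum of E and F (S receives E and F over the coprojections).                 *)
Definition yext_add n X Y (E F G : yext n X Y) : Prop :=
  exists (XX : C) (i1 i2 : hom C X XX) (p1 p2 : hom C XX X)
         (YY : C) (j1 j2 : hom C Y YY) (q1 q2 : hom C YY Y)
         (S : yext n XX YY) (D : yext n X YY),
    [/\ is_biprod i1 i2 p1 p2, is_biprod j1 j2 q1 q2,
        yext_mor E S i1 j1 /\ yext_mor F S i2 j2,
        yext_mor D S (i1 + i2) 1
      & yext_mor D G 1 (q1 + q2)].

Definition Ext_car (n : nat) (X Y : C) : Type :=
  match n with 0%N => hom C X Y | m.+1 => yext m X Y end.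

Definition Ext_eq n X Y : Ext_car n X Y -> Ext_car n X Y -> Prop :=
  match n with 0%N => fun f g => f == g | m.+1 => @yext_eq m X Y end.

Definition Ext_add n X Y :
    Ext_car n X Y -> Ext_car n X Y -> Ext_car n X Y -> Prop :=
  match n with
  | 0%N => fun f g h => f + g == h
  | m.+1 => @yext_add m X Y
  end.

Definition Ext_scale n X Y : k -> Ext_car n X Y -> Ext_car n X Y -> Prop :=
  match n with
  | 0%N => fun c f g => c *: f == g
  | m.+1 => @yext_scale m X Y
  end.

(* The Yoneda group Ext^n(X, Y) = Ext_car n X Y / Ext_eq is isomorphic to k^m  *)
(* as a k-vector space. Sums and multiples of extensions exist in any abelian  *)
(* category and are unique up to Ext_eq; they are given by the relations       *)
(* Ext_add and Ext_scale.                                                      *)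
Definition Ext_dim (n : nat) (X Y : C) (m : nat) : Prop :=
  exists phi : Ext_car n X Y -> 'rV[k]_m,
    [/\ forall E F, phi E = phi F <-> Ext_eq E F,
        forall v, exists E, phi E = v,
        forall E F G, Ext_add E F G -> phi G = (phi E + phi F)%R
      & forall c E G, Ext_scale c E G -> phi G = (c *: phi E)%R].

Definition Ext_finite : Prop :=
  forall n X Y, exists m, Ext_dim n X Y m.

(* The cohomological dimension is an integer so as to allow -1, the value for  *)
(* the zero category, where no Ext^i is nonzero.                               *)
Definition cohdim_eq (m : int) : Prop :=
  (forall (i : nat) X Y, m < i%:Z -> Ext_dim i X Y 0) /\
  (m = - 1 \/ exists (i : nat) X Y, i%:Z = m /\ ~ Ext_dim i X Y 0).

End Categories.

Section FullSub.
Variables (k : fieldType) (C : klcat k) (P : C -> Prop).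

Definition full_sub : klcat k :=
  @KLCat k {X : C | P X} (fun X Y => hom C (sval X) (sval Y))
    (fun X Y => @heq k C (sval X) (sval Y)) (fun X => idm (sval X))
    (fun X Y Z => @comp k C (sval X) (sval Y) (sval Z))
    (fun X Y => hzero (sval X) (sval Y))
    (fun X Y => @hadd k C (sval X) (sval Y))
    (fun X Y => @hscale k C (sval X) (sval Y))
    (fun X Y => @heq_refl k C (sval X) (sval Y))
    (fun X Y => @heq_sym k C (sval X) (sval Y))
    (fun X Y => @heq_trans k C (sval X) (sval Y))
    (fun X Y Z => @comp_heq k C (sval X) (sval Y) (sval Z))
    (fun X Y => @hadd_heq k C (sval X) (sval Y))
    (fun X Y => @hscale_heq k C (sval X) (sval Y))
    (fun X Y Z T => @compA k C (sval X) (sval Y) (sval Z) (sval T))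
    (fun X Y => @comp1m k C (sval X) (sval Y))
    (fun X Y => @compm1 k C (sval X) (sval Y))
    (fun X Y => @haddA k C (sval X) (sval Y))
    (fun X Y => @haddC k C (sval X) (sval Y))
    (fun X Y => @hadd0 k C (sval X) (sval Y))
    (fun X Y => @haddN k C (sval X) (sval Y))
    (fun X Y => @hscaleA k C (sval X) (sval Y))
    (fun X Y => @hscale1 k C (sval X) (sval Y))
    (fun X Y => @hscaleDr k C (sval X) (sval Y))
    (fun X Y => @hscaleDl k C (sval X) (sval Y))
    (fun X Y Z => @compDl k C (sval X) (sval Y) (sval Z))
    (fun X Y Z => @compDr k C (sval X) (sval Y) (sval Z))
    (fun X Y Z => @compZl k C (sval X) (sval Y) (sval Z))
    (fun X Y Z => @compZr k C (sval X) (sval Y) (sval Z)).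

Variables (F : functor C C) (FP : forall X, P X -> P (F X)).

Definition full_sub_functor : functor full_sub full_sub :=
  @Functor k full_sub full_sub
    (fun X => exist P (F (sval X)) (FP (svalP X)))
    (fun X Y => @fhom k C C F (sval X) (sval Y))
    (fun X Y => @fhom_heq k C C F (sval X) (sval Y))
    (fun X => @fhom1 k C C F (sval X))
    (fun X Y Z => @fhomM k C C F (sval X) (sval Y) (sval Z))
    (fun X Y => @fhomD k C C F (sval X) (sval Y))
    (fun X Y => @fhomZ k C C F (sval X) (sval Y)).

End FullSub.

Lemma full_sub_quasi_inverse k (C : klcat k) (P : C -> Prop) (F G : functor C C)
    (FP : forall X, P X -> P (F X)) (GP : forall X, P X -> P (G X)) :
  quasi_inverse F G ->
  quasi_inverse (full_sub_functor FP) (full_sub_functor GP).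
Proof.
case=> [[a [b [n1 n2 n3]]] [c [d [m1 m2 m3]]]]; split.
  exists (fun X => a (sval X)), (fun X => b (sval X)).
  by split=> [X Y f|X|X]; [exact: n1|exact: n2|exact: n3].
exists (fun X => c (sval X)), (fun X => d (sval X)).
by split=> [X Y f|X|X]; [exact: m1|exact: m2|exact: m3].
Qed.

(* The localization of C at a class W of morphisms, by generators and          *)
(* relations: the universal k-linear category receiving a k-linear functor     *)
(* from C which inverts W. Same objects; morphisms are k-linear combinations   *)
(* of composites of morphisms of C and formal inverses of elements of W.       *)

Section Localization.
Variables (k : fieldType) (C : klcat k) (W : forall X Y : C, hom C X Y -> Prop).

Inductive lword : C -> C -> Type :=
| LHom X Y (f : hom C X Y) : lword X Y
| LInv X Y (s : hom C X Y) (Ws : W s) : lword Y X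
| LComp X Y Z (v : lword Y Z) (w : lword X Y) : lword X Z
| LAdd X Y (v w : lword X Y) : lword X Y
| LScale X Y (c : k) (w : lword X Y) : lword X Y.

Inductive lword_eq : forall X Y : C, lword X Y -> lword X Y -> Prop :=
| lw_refl X Y (w : lword X Y) : lword_eq w w
| lw_sym X Y (v w : lword X Y) : lword_eq v w -> lword_eq w v
| lw_trans X Y (u v w : lword X Y) :
    lword_eq u v -> lword_eq v w -> lword_eq u w
| lw_comp X Y Z (v v' : lword Y Z) (w w' : lword X Y) :
    lword_eq v v' -> lword_eq w w' -> lword_eq (LComp v w) (LComp v' w')
| lw_add X Y (v v' w w' : lword X Y) :
    lword_eq v v' -> lword_eq w w' -> lword_eq (LAdd v w) (LAdd v' w')
| lw_scale X Y c (w w' : lword X Y) :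
    lword_eq w w' -> lword_eq (LScale c w) (LScale c w')
| lw_hom X Y (f g : hom C X Y) : heq f g -> lword_eq (LHom f) (LHom g)
| lw_homM X Y Z (g : hom C Y Z) (f : hom C X Y) :
    lword_eq (LHom (comp g f)) (LComp (LHom g) (LHom f))
| lw_homD X Y (f g : hom C X Y) :
    lword_eq (LHom (hadd f g)) (LAdd (LHom f) (LHom g))
| lw_homZ X Y c (f : hom C X Y) :
    lword_eq (LHom (hscale c f)) (LScale c (LHom f))
| lw_invl X Y (s : hom C X Y) (Ws : W s) :
    lword_eq (LComp (LInv Ws) (LHom s)) (LHom (idm X))
| lw_invr X Y (s : hom C X Y) (Ws : W s) :
    lword_eq (LComp (LHom s) (LInv Ws)) (LHom (idm Y))
| lw_compA X Y Z T (u : lword Z T) (v : lword Y Z) (w : lword X Y) :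
    lword_eq (LComp u (LComp v w)) (LComp (LComp u v) w)
| lw_comp1m X Y (w : lword X Y) : lword_eq (LComp (LHom (idm Y)) w) w
| lw_compm1 X Y (w : lword X Y) : lword_eq (LComp w (LHom (idm X))) w
| lw_addA X Y (u v w : lword X Y) :
    lword_eq (LAdd u (LAdd v w)) (LAdd (LAdd u v) w)
| lw_addC X Y (v w : lword X Y) : lword_eq (LAdd v w) (LAdd w v)
| lw_add0 X Y (w : lword X Y) : lword_eq (LAdd (LHom (hzero X Y)) w) w
| lw_addN X Y (w : lword X Y) :
    lword_eq (LAdd w (LScale (- 1) w)) (LHom (hzero X Y))
| lw_scaleA X Y a b (w : lword X Y) :
    lword_eq (LScale a (LScale b w)) (LScale (a * b) w)
| lw_scale1 X Y (w : lword X Y) : lword_eq (LScale 1 w) w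
| lw_scaleDr X Y a (v w : lword X Y) :
    lword_eq (LScale a (LAdd v w)) (LAdd (LScale a v) (LScale a w))
| lw_scaleDl X Y a b (w : lword X Y) :
    lword_eq (LScale (a + b) w) (LAdd (LScale a w) (LScale b w))
| lw_compDl X Y Z (v v' : lword Y Z) (w : lword X Y) :
    lword_eq (LComp (LAdd v v') w) (LAdd (LComp v w) (LComp v' w))
| lw_compDr X Y Z (v : lword Y Z) (w w' : lword X Y) :
    lword_eq (LComp v (LAdd w w')) (LAdd (LComp v w) (LComp v w'))
| lw_compZl X Y Z a (v : lword Y Z) (w : lword X Y) :
    lword_eq (LComp (LScale a v) w) (LScale a (LComp v w))
| lw_compZr X Y Z a (v : lword Y Z) (w : lword X Y) :
    lword_eq (LComp v (LScale a w)) (LScale a (LComp v w)).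

Definition localization : klcat k :=
  @KLCat k C lword lword_eq (fun X => LHom (idm X)) LComp
    (fun X Y => LHom (hzero X Y)) LAdd LScale
    lw_refl lw_sym lw_trans lw_comp lw_add lw_scale
    lw_compA lw_comp1m lw_compm1 lw_addA lw_addC lw_add0 lw_addN
    lw_scaleA lw_scale1 lw_scaleDr lw_scaleDl
    lw_compDl lw_compDr lw_compZl lw_compZr.

Section LiftFunctor.
Variables (F : functor C C)
  (FW : forall X Y (s : hom C X Y), W s -> W (fhom F s)).

Fixpoint lword_map X Y (w : lword X Y) : lword (F X) (F Y) :=
  match w in lword X Y return lword (F X) (F Y) with
  | LHom _ _ f => LHom (fhom F f)
  | LInv _ _ _ Ws => LInv (FW Ws)
  | LComp _ _ _ v w => LComp (lword_map v) (lword_map w)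
  | LAdd _ _ v w => LAdd (lword_map v) (lword_map w)
  | LScale _ _ c w => LScale c (lword_map w)
  end.

Lemma lword_map_heq X Y (v w : lword X Y) :
  lword_eq v w -> lword_eq (lword_map v) (lword_map w).
Proof.
elim=> {X Y v w} /=; try by move=> *; constructor.
- by move=> X Y u v w _ uv _ vw; exact: lw_trans uv vw.
- by move=> X Y f g fg; apply/lw_hom/fhom_heq.
- move=> X Y Z g f; apply: lw_trans (lw_homM _ _).
  exact/lw_hom/fhomM.
- move=> X Y f g; apply: lw_trans (lw_homD _ _).
  exact/lw_hom/fhomD.
- move=> X Y c f; apply: lw_trans (lw_homZ _ _).
  exact/lw_hom/fhomZ.
- move=> X Y s Ws; apply: lw_trans (lw_invl _) _.
  exact/lw_sym/lw_hom/fhom1.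
- move=> X Y s Ws; apply: lw_trans (lw_invr _) _.
  exact/lw_sym/lw_hom/fhom1.
- move=> X Y w; apply: lw_trans (lw_comp1m _).
  by apply: lw_comp (lw_refl _); apply/lw_hom/fhom1.
- move=> X Y w; apply: lw_trans (lw_compm1 _).
  by apply: lw_comp; [exact: lw_refl|apply/lw_hom/fhom1].
- move=> X Y w; apply: lw_trans (lw_add0 _).
  by apply: lw_add (lw_refl _); apply/lw_hom/fhom0.
- move=> X Y w; apply: lw_trans (lw_addN _) _.
  exact/lw_sym/lw_hom/fhom0.
Qed.

Definition localization_functor : functor localization localization :=
  @Functor k localization localization F lword_map lword_map_heq
    (fun X => lw_hom (fhom1 F X)) (fun _ _ _ _ _ => lw_refl _)
    (fun _ _ _ _ => lw_refl _) (fun _ _ _ _ => lw_refl _).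

End LiftFunctor.
End Localization.

(* The quotient of an abelian category C by a Serre subcategory T is the       *)
(* localization of C at the morphisms whose kernel and cokernel lie in T.      *)
(* These morphisms admit a calculus of fractions, so the localization as a     *)
(* plain category is already k-linear, and agrees with the k-linear one.       *)
Definition serre_iso (k : fieldType) (C : klcat k) (T : C -> Prop)
    (X Y : C) (f : hom C X Y) : Prop :=
  (exists (K : C) (i : hom C K X), is_kernel f i /\ T K) /\
  (exists (Q : C) (p : hom C Y Q), is_cokernel f p /\ T Q).

Definition serre_quotient (k : fieldType) (C : klcat k) (T : C -> Prop) :=
  localization (@serre_iso k C T).

Section QuasiInverse.
Variables (k : fieldType) (C : klcat k).
Local Open Scope kl_scope.

Lemma quasi_inverse_sym (F G : functor C C) :
  quasi_inverse F G -> quasi_inverse G F.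
Proof. by case. Qed.

Lemma quasi_inverse_faithful (F G : functor C C) : quasi_inverse F G ->
  forall X Y (f g : hom C X Y), fhom F f == fhom F g -> f == g.
Proof.
move=> [_ [a [b [nat ab _]]]] X Y f g fg.
have e : (f \o a X) == (g \o a X).
  by rewrite -(nat _ _ f) -(nat _ _ g) fg.
transitivity (f \o a X \o b X); first by rewrite -compA ab compm1.
by rewrite e -compA ab compm1.
Qed.

Lemma quasi_inverse_full (F G : functor C C) : quasi_inverse F G ->
  forall X Y (h : hom C (F X) (F Y)), exists u : hom C X Y, fhom F u == h.
Proof.
move=> FG X Y h.
have [_ [a [b [nat ab ba]]]] := FG.
exists (a Y \o fhom G h \o b X).
apply: (quasi_inverse_faithful (quasi_inverse_sym FG)).
set u := comp _ _.
have e : (a Y \o fhom G (fhom F u)) == (a Y \o fhom G h).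
  rewrite nat /u -compA ba; exact: compm1.
transitivity (b Y \o (a Y \o fhom G (fhom F u))).
  by rewrite compA ba comp1m.
by rewrite e compA ba comp1m.
Qed.

Lemma quasi_inverse_kernel (F G : functor C C) : quasi_inverse F G ->
  forall K M N (f : hom C M N) (i : hom C K M),
    is_kernel f i -> is_kernel (fhom F f) (fhom F i).
Proof.
move=> FG K M N f i [fi Ki].
have [[a [b [nat ab ba]]] _] := FG.
split=> [|T g fg]; first by rewrite -fhomM fi fhom0.
have [u Hu] := quasi_inverse_full FG (g \o a T).
have fu : (f \o u) == 0.
  apply: (quasi_inverse_faithful FG).
  rewrite fhomM Hu compA fg fhom0.
  rewrite -(haddN (hzero _ _)) compDl compZl; exact: haddN.
have [v [iv uv]] := Ki _ _ fu.
exists (fhom F v \o b T); split.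
  by rewrite compA -fhomM iv Hu -compA ab compm1.
move=> w iw.
have [w' Hw'] := quasi_inverse_full FG (w \o a T).
have : w' == v.
  apply: uv; apply: (quasi_inverse_faithful FG).
  by rewrite fhomM Hw' Hu compA iw.
by move=> <-; rewrite Hw' -compA ab compm1.
Qed.

Lemma quasi_inverse_cokernel (F G : functor C C) : quasi_inverse F G ->
  forall M N Q (f : hom C M N) (p : hom C N Q),
    is_cokernel f p -> is_cokernel (fhom F f) (fhom F p).
Proof.
move=> FG M N Q f p [pf Qp].
have [[a [b [nat ab ba]]] _] := FG.
split=> [|T g gf]; first by rewrite -fhomM pf fhom0.
have [u Hu] := quasi_inverse_full FG (b T \o g).
have uf : (u \o f) == 0.
  apply: (quasi_inverse_faithful FG).
  rewrite fhomM Hu -compA gf fhom0.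
  rewrite -(haddN (hzero _ _)) compDr compZr; exact: haddN.
have [v [vp uv]] := Qp _ _ uf.
exists (a T \o fhom F v); split.
  by rewrite -compA -fhomM vp Hu compA ab comp1m.
move=> w wp.
have [w' Hw'] := quasi_inverse_full FG (b T \o w).
have : w' == v.
  apply: uv; apply: (quasi_inverse_faithful FG).
  by rewrite fhomM Hw' Hu -compA wp.
by move=> <-; rewrite Hw' compA ab comp1m.
Qed.

Lemma quasi_inverse_serre_iso (T : C -> Prop) (F G : functor C C) :
  quasi_inverse F G -> (forall X, T X -> T (F X)) ->
  forall X Y (s : hom C X Y), serre_iso T s -> serre_iso T (fhom F s).
Proof.
move=> FG FT X Y s [[K [i [Ki TK]]] [Q [p [Qp TQ]]]]; split.
  exists (F K), (fhom F i); split; [exact: quasi_inverse_kernel FG _ _ _ _ _ Ki|exact: FT].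
exists (F Q), (fhom F p); split; [exact: quasi_inverse_cokernel FG _ _ _ _ _ Qp|exact: FT].
Qed.

Lemma localization_natiso W (F G : functor C C)
    (FW : forall X Y (s : hom C X Y), W X Y s -> W _ _ (fhom F s))
    (GW : forall X Y (s : hom C X Y), W X Y s -> W _ _ (fhom G s)) a b :
  natiso_id (F := F) (G := G) a b ->
  natiso_id (F := localization_functor FW) (G := localization_functor GW)
    (fun X => LHom W (a X)) (fun X => LHom W (b X)).
Proof.
case=> nat ab ba; split=> [X Y w|X|X] /=; last 2 first.
- by apply: lw_trans (lw_sym (lw_homM _ _ _)) _; apply/lw_hom/ab.
- by apply: lw_trans (lw_sym (lw_homM _ _ _)) _; apply/lw_hom/ba.
change (@heq k (localization W) X Y) with (@lword_eq k C W X Y).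
elim: w => {X Y} /=.
- move=> X Y f; apply: lw_trans (lw_sym (lw_homM _ _ _)) _.
  by apply: lw_trans (lw_homM _ _ _); apply/lw_hom/nat.
- move=> X Y s Ws.
  set u := LInv _; set Z := LInv Ws.
  have us : lword_eq (LComp (LHom W (fhom F (fhom G s))) u) (LHom W (idm _)).
    exact: lw_invr.
  have e : lword_eq (LComp (LHom W (a Y)) (LHom W (fhom F (fhom G s))))
                    (LComp (LHom W s) (LHom W (a X))).
    apply: lw_trans (lw_sym (lw_homM _ _ _)) _.
    by apply: lw_trans (lw_homM _ _ _); apply/lw_hom/nat.
  have zs : lword_eq (LComp Z (LHom W s)) (LHom W (idm _)) by exact: lw_invl.
  apply: lw_trans (lw_sym (lw_comp1m _)) _.
  apply: lw_trans (lw_comp (lw_sym zs) (lw_refl _)) _.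
  apply: lw_trans (lw_sym (lw_compA _ _ _)) _.
  apply: lw_comp (lw_refl _) _.
  apply: lw_trans (lw_compA _ _ _) _.
  apply: lw_trans (lw_comp (lw_sym e) (lw_refl _)) _.
  apply: lw_trans (lw_sym (lw_compA _ _ _)) _.
  apply: lw_trans (lw_comp (lw_refl _) us) _.
  exact: lw_compm1.
- move=> X Y Z v Hv w Hw.
  apply: lw_trans (lw_compA _ _ _) _.
  apply: lw_trans (lw_comp Hv (lw_refl _)) _.
  apply: lw_trans (lw_sym (lw_compA _ _ _)) _.
  apply: lw_trans (lw_comp (lw_refl _) Hw) _.
  exact: lw_compA.
- move=> X Y v Hv w Hw.
  apply: lw_trans (lw_compDr _ _ _) _.
  apply: lw_trans (lw_add Hv Hw) _.
  exact/lw_sym/lw_compDl.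
- move=> X Y c w Hw.
  apply: lw_trans (lw_compZr _ _ _) _.
  apply: lw_trans (lw_scale _ Hw) _.
  exact/lw_sym/lw_compZl.
Qed.

Lemma localization_quasi_inverse W (F G : functor C C)
    (FW : forall X Y (s : hom C X Y), W X Y s -> W _ _ (fhom F s))
    (GW : forall X Y (s : hom C X Y), W X Y s -> W _ _ (fhom G s)) :
  quasi_inverse F G ->
  quasi_inverse (localization_functor FW) (localization_functor GW).
Proof.
case=> [[a [b ab]] [c [d cd]]]; split.
  by exists (fun X => LHom W (a X)), (fun X => LHom W (b X));
     exact: localization_natiso.
by exists (fun X => LHom W (c X)), (fun X => LHom W (d X));
   exact: localization_natiso.
Qed.

End QuasiInverse.

(* V is the direct sum of the subgroups G i. In the second clause repeated     *)
(* indices in s are harmless.                                                  *)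
Definition direct_sum (I : eqType) (V : zmodType) (G : I -> V -> Prop) : Prop :=
  [/\ forall i, G i 0 /\ (forall x y, G i x -> G i y -> G i (x - y)),
      forall x, exists (s : seq I) (c : I -> V),
        (forall i, G i (c i)) /\ x = \sum_(i <- s) c i
    & forall (s : seq I) (c : I -> V), uniq s -> (forall i, G i (c i)) ->
        \sum_(i <- s) c i = 0 -> forall i, i \in s -> c i = 0].

Record gralg (k : fieldType) := GrAlg {
  galg :> algType k;
  agr : nat -> galg -> Prop;
  agr_direct : direct_sum agr;
  agrZ : forall i (c : k) a, agr i a -> agr i (c *: a);
  agrM : forall i j a b, agr i a -> agr j b -> agr (i + j)%N (a * b);
  agr_conn : forall a, agr 0%N a <-> exists c : k, a = c%:A;
  agr_fg : exists s : seq galg, forall S : galg -> Prop,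
    (forall x, x \in s -> S x) -> S 1 ->
    (forall c x y, S x -> S y -> S (c *: x + y)) ->
    (forall x y, S x -> S y -> S (x * y)) -> forall x, S x
}.

Arguments agr {k} A i a : rename.

(* A right A-module is a left module over the opposite algebra A^c.            *)
Record grmod (k : fieldType) (A : gralg k) := MkGrMod {
  gmod :> lmodType A^c;
  mgr : int -> gmod -> Prop;
  mgr_direct : direct_sum mgr;
  mgr_act : forall n i (a : A) m, mgr n m -> agr A i a ->
    mgr (n + i%:Z) ((a : A^c) *: m)
}.

Arguments mgr {k A} M n m : rename.

Definition ract (k : fieldType) (A : gralg k) (M : lmodType A^c) (m : M) (a : A) : M :=
  (a : A^c) *: m.
Notation "m *^ a" := (ract m a) (at level 40, left associativity).

Record grhom (k : fieldType) (A : gralg k) (M N : grmod A) := GrHom {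
  gfun :> {linear M -> N};
  gfunP : forall n m, mgr M n m -> mgr N n (gfun m)
}.

Section GradedModules.
Variables (k : fieldType) (A : gralg k).
Implicit Types (M N : grmod A).

Lemma agr1 : agr A 0 1.
Proof. by apply/agr_conn; exists 1; rewrite scale1r. Qed.

Lemma mgr0 M n : mgr M n 0.
Proof. by have [H _ _] := mgr_direct M; have [] := H n. Qed.

Lemma mgrB M n x y : mgr M n x -> mgr M n y -> mgr M n (x - y).
Proof. by have [H _ _] := mgr_direct M; have [_] := H n; apply. Qed.

Lemma mgrD M n x y : mgr M n x -> mgr M n y -> mgr M n (x + y).
Proof.
move=> Hx Hy; rewrite -(opprK y); apply: mgrB => //.
by rewrite -sub0r; apply: mgrB => //; exact: mgr0.
Qed.

Lemma mgrZ M n (c : k) m : mgr M n m -> mgr M n (m *^ (c%:A : A)).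
Proof.
move=> Hm; rewrite -[n]addr0 -[0](_ : 0%N%:Z = 0) //.
by apply: mgr_act => //; apply/agr_conn; exists c.
Qed.

Lemma ractDa (M : lmodType A^c) (m : M) (a b : A) : m *^ (a + b) = m *^ a + m *^ b.
Proof. by rewrite /ract -scalerDl. Qed.

Lemma ractM (M : lmodType A^c) (m : M) (a b : A) : m *^ (a * b) = m *^ a *^ b.
Proof. by rewrite /ract scalerA. Qed.

Lemma ractD (M : lmodType A^c) (m n : M) (a : A) : (m + n) *^ a = m *^ a + n *^ a.
Proof. exact: scalerDr. Qed.

Definition scale_map M (N : lmodType A^c) (c : k) (f : M -> N) (m : M) : N :=
  f m *^ (c%:A : A).

Lemma scale_map_linear M (N : lmodType A^c) (c : k) (f : {linear M -> N}) :
  linear (scale_map c f).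
Proof.
move=> a x y; rewrite /scale_map; rewrite linearP. rewrite ractD; congr (_ + _).
rewrite /ract !scalerA; congr (_ *: _).
change ((a : A) * c%:A = c%:A * (a : A)).
by rewrite -scalerAr -scalerAl mulr1 mul1r.
Qed.

HB.instance Definition _ M (N : lmodType A^c) (c : k) (f : {linear M -> N}) :=
  GRing.isLinear.Build _ _ _ _ (scale_map c f) (scale_map_linear c f).

Definition gid M : grhom M M := @GrHom k A M M idfun (fun _ _ Hm => Hm).

Definition gcomp M N P (g : grhom N P) (f : grhom M N) : grhom M P :=
  @GrHom k A M P (g \o f) (fun n m Hm => gfunP g (gfunP f Hm)).

Definition gzero M N : grhom M N :=
  @GrHom k A M N \0 (fun n m Hm => mgr0 N n).

Definition gadd M N (f g : grhom M N) : grhom M N :=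
  @GrHom k A M N (f \+ g) (fun n m Hm => mgrD (gfunP f Hm) (gfunP g Hm)).

Definition gscale M N c (f : grhom M N) : grhom M N :=
  @GrHom k A M N (scale_map c f) (fun n m Hm => mgrZ c (gfunP f Hm)).

(* The category of graded right A-modules and maps of degree 0.                *)
Definition GrMod : klcat k.
Proof.
refine (@KLCat k (grmod A) (@grhom k A) (fun M N f g => f =1 g) gid gcomp gzero
  gadd gscale _ _ _ _ _ _ _ _ _ _ _ _ _ _ _ _ _ _ _ _ _).
- by [].
- by move=> M N f g fg x.
- by move=> M N f g h fg gh x; rewrite fg gh.
- by move=> M N P g g' f f' gg ff x; rewrite /= /scale_map ff gg.
- by move=> M N f f' g g' ff gg x; rewrite /= /scale_map ff gg.
- by move=> M N c f f' ff x; rewrite /= /scale_map ff.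
- by [].
- by [].
- by [].
- by move=> M N f g h x; rewrite /= /scale_map addrA.
- by move=> M N f g x; rewrite /= /scale_map addrC.
- by move=> M N f x; rewrite /= /scale_map add0r.
- by move=> M N f x; rewrite /= /scale_map /ract scaleN1r scaleN1r subrr.
- move=> M N a b f x; rewrite /= /scale_map -ractM; congr (_ *^ _).
  by rewrite -scalerAl mul1r scalerA mulrC.
- by move=> M N f x; rewrite /= /scale_map /ract !scale1r.
- by move=> M N a f g x; rewrite /= /scale_map ractD.
- by move=> M N a b f x; rewrite /= /scale_map scalerDl ractDa.
- by [].
- by move=> M N P g f f' x; rewrite /= /scale_map linearD.
- by [].
- by move=> M N P a g f x; rewrite /= /scale_map /ract linearZ.
Defined.

Section Shift.
Variables (M : grmod A) (l : int).

Lemma shift_direct : direct_sum (fun n : int => mgr M (n + l)).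
Proof.
have [H1 H2 H3] := mgr_direct M; split=> [i|x|s c us Hc sc i si].
- exact: H1.
- have [s [c [Hc ->]]] := H2 x.
  exists [seq i - l | i <- s], (fun i => c (i + l)); split=> [i|]; first exact: Hc.
  by rewrite big_map; apply: eq_bigr => i _; rewrite subrK.
- pose c' i := c (i - l).
  have Hc' j : mgr M j (c' j) by have := Hc (j - l); rewrite subrK.
  have := H3 [seq i + l | i <- s] c' _ Hc' _ (i + l).
  rewrite /c' addrK; apply.
  + by rewrite map_inj_uniq //; exact: addIr.
  + by rewrite big_map -[RHS]sc; apply: eq_bigr => j _; rewrite addrK.
  + exact: map_f.
Qed.

Lemma shift_act n i (a : A) m : mgr M (n + l) m -> agr A i a ->
  mgr M (n + i%:Z + l) ((a : A^c) *: m).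
Proof. by move=> Hm Ha; rewrite addrAC; exact: mgr_act. Qed.

(* M[l] has degree n component M_(n + l). *)
Definition shift_mod : grmod A := MkGrMod shift_direct shift_act.

End Shift.

Definition shift_hom (l : int) M N (f : grhom M N) :
    grhom (shift_mod M l) (shift_mod N l) :=
  @GrHom k A (shift_mod M l) (shift_mod N l) (gfun f)
    (fun n m Hm => gfunP f (n := n + l) Hm).

End GradedModules.

Section GradedModuleCategories.
Variables (k : fieldType) (A : gralg k).
Local Notation GM := (GrMod A).

Definition shift (l : int) : functor GM GM.
Proof.
by refine (@Functor k GM GM (fun M => shift_mod M l) (@shift_hom k A l)
  _ _ _ _ _).
Defined.

Lemma shiftK_subproof (l : int) (M : grmod A) n m :
  mgr (shift_mod (shift_mod M (- l)) l) n m -> mgr M n m.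
Proof. by rewrite /= addrK. Qed.

Lemma shiftVK_subproof (l : int) (M : grmod A) n m :
  mgr M n m -> mgr (shift_mod (shift_mod M (- l)) l) n m.
Proof. by rewrite /= addrK. Qed.

Lemma shift_natiso (l l' : int) : l' = - l ->
  exists a b, natiso_id (F := shift l) (G := shift l') a b.
Proof.
move->.
exists (fun M => @GrHom k A (shift_mod (shift_mod M (- l)) l) M
  idfun (@shiftK_subproof l M)).
exists (fun M => @GrHom k A M (shift_mod (shift_mod M (- l)) l)
  idfun (@shiftVK_subproof l M)).
by split.
Qed.

Lemma shift_quasi_inverse l : quasi_inverse (shift l) (shift (- l)).
Proof. by split; apply: shift_natiso; rewrite ?opprK. Qed.

(* The grading of A indexed by int, with A_n = 0 for n < 0.                    *)
Definition agrz (n : int) (a : A) : Prop :=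
  match n with Posz m => agr A m a | Negz _ => a = 0 end.

Lemma agr0 i : agr A i 0.
Proof. by have [H _ _] := agr_direct A; have [] := H i. Qed.

Lemma agrB i x y : agr A i x -> agr A i y -> agr A i (x - y).
Proof. by have [H _ _] := agr_direct A; have [_] := H i; apply. Qed.

Lemma agrD i x y : agr A i x -> agr A i y -> agr A i (x + y).
Proof.
move=> Hx Hy; rewrite -(opprK y); apply: agrB => //.
by rewrite -sub0r; apply: agrB => //; exact: agr0.
Qed.

Lemma agrz_direct : direct_sum (V := (A^c)^o) agrz.
Proof.
have [H1 H2 H3] := agr_direct A; split=> [[i|i]|x|s c us Hc sc i si].
- exact: H1.
- by split=> //= x y -> ->; rewrite subrr.
- have [s [c [Hc ->]]] := H2 x.
  exists [seq Posz i | i <- s], (fun i => if i is Posz j then c j else 0).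
  by split=> [[i|i]|] //=; rewrite big_map.
- pose pos (i : int) := if i is Posz _ then true else false.
  have Hpos j : Posz j \in s -> c (Posz j) = 0.
    move=> js.
    have := H3 [seq absz i | i <- s & pos i] (fun j => c (Posz j)) _
      (fun j => Hc (Posz j)) _ j; apply.
    + rewrite map_inj_in_uniq ?filter_uniq //.
      by move=> [x|x] [y|y]; rewrite !mem_filter //= => _ _ ->.
    + rewrite big_map big_filter -[RHS]sc [RHS](bigID pos) /=.
      rewrite [X in _ = _ + X]big1 ?addr0; last first.
        by move=> [i'|i'] //= _; exact: (Hc (Negz i')).
      by apply: eq_bigr => -[].
    + by apply/mapP; exists (Posz j) => //; rewrite mem_filter js.
  by case: i si => [j|j] si; [exact: Hpos|exact: (Hc (Negz j))].
Qed.

Lemma agrz_act n i (a : A) (m : (A^c)^o) : agrz n m -> agr A i a ->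
  agrz (n + i%:Z) ((a : A^c) *: m).
Proof.
rewrite [_ *: _](_ : _ = (m : A) * a) //; case: n => [n|n] /= Hm Ha.
  exact: agrM.
rewrite Hm mul0r; case: (_ + _) => [j|j] //=; exact: agr0.
Qed.

(* A_A *)
Definition regmod : grmod A := MkGrMod agrz_direct agrz_act.

Definition span (M : grmod A) (n : nat) (g : 'I_n -> M) (m : M) : Prop :=
  exists a : 'I_n -> A, m = \sum_(i < n) g i *^ a i.

(* The submodule S of M is finitely presented: it has a finite family of       *)
(* homogeneous generators whose module of relations is generated by finitely   *)
(* many homogeneous relations (the relation r_j has degree t_j).               *)
Definition fin_pres_sub (M : grmod A) (S : M -> Prop) : Prop :=
  exists (n : nat) (e : 'I_n -> int) (g : 'I_n -> M),
    [/\ forall i, mgr M (e i) (g i),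
        forall m, S m <-> span g m
      & exists (p : nat) (t : 'I_p -> int) (r : 'I_p -> 'I_n -> A),
          (forall j i, agrz (t j - e i) (r j i)) /\
          forall a : 'I_n -> A, \sum_(i < n) g i *^ a i = 0 <->
            exists b : 'I_p -> A, forall i, a i = \sum_(j < p) r j i * b j].

Definition fin_pres (M : grmod A) : Prop := fin_pres_sub (fun _ : M => True).

(* span x is an arbitrary finitely generated homogeneous right ideal of A.     *)
Definition coherent : Prop :=
  forall (n : nat) (e : 'I_n -> int) (x : 'I_n -> regmod),
    (forall i, mgr regmod (e i) (x i)) -> fin_pres_sub (span x).

Definition fin_dim (M : grmod A) : Prop :=
  exists (n : nat) (v : 'I_n -> M), forall m, exists c : 'I_n -> k,
    m = \sum_(i < n) v i *^ ((c i)%:A : A).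

Lemma fin_pres_shift l M : fin_pres M -> fin_pres (shift_mod M l).
Proof.
case=> n [e [g [He Hg [p [t [r [Hr Hrel]]]]]]].
exists n, (fun i => e i - l), g; split=> [i|m|]; first by rewrite /= subrK.
  exact: Hg.
exists p, (fun j => t j - l), r; split=> // j i.
by have -> : t j - l - (e i - l) = t j - e i by rewrite opprB addrA subrK.
Qed.

Lemma fin_dim_shift l M : fin_dim M -> fin_dim (shift_mod M l).
Proof. by []. Qed.

Lemma fin_pres_regmod : fin_pres regmod.
Proof.
exists 1%N, (fun=> 0), (fun=> (1 : A)); split=> [i|m|].
- exact: agr1.
- split=> // _; exists (fun=> m); rewrite big_ord1.
  by rewrite -[LHS](mul1r (m : A)).
- exists 0%N, (fun=> 0), (fun _ _ => 0); split=> [[]//|a].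
  split=> [|[b ab]].
    rewrite big_ord1 => a0; exists (fun=> 0) => i; rewrite big_ord0.
    by rewrite (ord1 i) -[LHS](mul1r (a ord0 : A)).
  rewrite big1 // => i _; rewrite ab big_ord0; exact: scale0r.
Qed.

(* The augmentation A -> A_0 = k, needed to make k a module.                   *)
Inductive Aplus : A -> Prop :=
| Aplus0 : Aplus 0
| AplusD i x y : agr A i.+1 x -> Aplus y -> Aplus (x + y).

Lemma Aplus_hom i x : agr A i.+1 x -> Aplus x.
Proof. by move=> Hx; rewrite -[x]addr0; exact: AplusD Hx Aplus0. Qed.

Lemma Aplus_add x y : Aplus x -> Aplus y -> Aplus (x + y).
Proof.
by elim=> [|i u v Hu _ IH] Hy; rewrite ?add0r // -addrA; exact: AplusD Hu (IH Hy).
Qed.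

Lemma Aplus_scale c x : Aplus x -> Aplus (c *: x).
Proof.
elim=> [|i u v Hu _ IH]; rewrite ?scaler0; first exact: Aplus0.
by rewrite scalerDr; exact: (AplusD (agrZ c Hu) IH).
Qed.

Lemma Aplus_mulr x a : Aplus x -> Aplus (x * a).
Proof.
elim=> [|i u v Hu _ IH]; first by rewrite mul0r; exact: Aplus0.
rewrite mulrDl; apply: Aplus_add => // {v IH}.
have [_ H2 _] := agr_direct A; have [s [c [Hc ->]]] := H2 a.
rewrite mulr_sumr; elim/big_rec: _ => [|j y _ IH]; first exact: Aplus0.
exact: (AplusD (i := (i + j)%N) (agrM Hu (Hc j)) IH).
Qed.

Lemma Aplus_sum x : Aplus x -> exists (n : nat) (c : nat -> A),
  [/\ forall i, agr A i (c i), c 0%N = 0 & x = \sum_(i <- iota 0 n) c i].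
Proof.
elim=> [|i u v Hu _ [n [c [Hc c0 ->]]]].
  by exists 0%N, (fun=> 0); split=> // [i|]; [exact: agr0|rewrite big_nil].
pose c1 j := if (j < n)%N then c j else 0.
exists (maxn n i.+2), (fun j => c1 j + (if j == i.+1 then u else 0)); split.
- move=> j; apply: agrD; first by rewrite /c1; case: ifP => // _; exact: agr0.
  by case: eqP => [->|_] //; exact: agr0.
- by rewrite /= addr0 /c1 c0; case: ifP.
- rewrite big_split /= [u + _]addrC; congr (_ + _); last first.
    rewrite (bigD1_seq i.+1) ?iota_uniq ?mem_iota ?leq_max ?ltnSn ?orbT //=.
    by rewrite eqxx big1 ?addr0 // => j /negbTE ->.
  have -> : iota 0 (maxn n i.+2) = iota 0 n ++ iota n (maxn n i.+2 - n).
    by rewrite -[n in iota n _]add0n -iotaD subnKC // leq_maxl.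
  rewrite big_cat /= [X in _ = _ + X]big_seq [X in _ = _ + X]big1 ?addr0; last first.
    by move=> j; rewrite mem_iota /c1 => /andP[nj _]; rewrite ltnNge nj.
  rewrite big_seq [RHS]big_seq; apply: eq_bigr => j.
  by rewrite mem_iota /c1 => /andP[_ ->].
Qed.

Lemma Aplus_scalar (c : k) : Aplus (c%:A) -> c = 0.
Proof.
move=> /Aplus_sum[n [d [Hd d0 e]]]; have [_ _ H3] := agr_direct A.
pose d' i := if i is 0%N then - c%:A else d i.
have : d' 0%N = 0.
  apply: (H3 (iota 0 (maxn n 1)) d'); first exact: iota_uniq.
  - case=> [|i] /=; last exact: Hd.
    by apply/agr_conn; exists (- c); rewrite scaleNr.
  - case: n e => [|n] e.
      by rewrite big_nil in e; rewrite /= big_cons big_nil addr0 /d' e oppr0.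
    rewrite (maxn_idPl _) //= big_cons /= e /= big_cons d0 add0r.
    rewrite addrC; apply/eqP; rewrite subr_eq0; apply/eqP.
    rewrite big_seq [RHS]big_seq; apply: eq_bigr => -[|j] //.
    by rewrite mem_iota.
  - by rewrite mem_iota leq_max orbT.
move/eqP; rewrite /d' oppr_eq0 scaler_eq0 oner_eq0 orbF.
by move/eqP.
Qed.

Lemma aug_ex (a : A) : exists c : k, Aplus (a - c%:A).
Proof.
have [_ H2 _] := agr_direct A; have [s [d [Hd ->]]] := H2 a.
elim: s => [|i s [c IH]].
  by exists 0; rewrite big_nil scale0r subr0; exact: Aplus0.
rewrite big_cons; case: i (Hd i) => [|i] Hi.
  have /agr_conn [b ->] := Hi.
  by exists (b + c); rewrite scalerDl opprD addrACA subrr add0r.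
by exists c; rewrite -addrA; exact: AplusD Hi IH.
Qed.

Definition aug (a : A) : k := sval (cid (aug_ex a)).

Lemma augP a : Aplus (a - (aug a)%:A).
Proof. exact: svalP (cid (aug_ex a)). Qed.

Lemma aug_eq a c : Aplus (a - c%:A) -> aug a = c.
Proof.
move=> Hc; apply/eqP; rewrite -subr_eq0; apply/eqP/Aplus_scalar.
rewrite scalerBl -[_ - _](_ : (a - c%:A) + (-1) *: (a - (aug a)%:A) = _).
  by apply: Aplus_add => //; apply: Aplus_scale; exact: augP.
by rewrite scaleN1r opprB addrC addrA subrK.
Qed.

Lemma augD a b : aug (a + b) = aug a + aug b.
Proof.
apply: aug_eq; rewrite scalerDl opprD addrACA; apply: Aplus_add; exact: augP.
Qed.

Lemma augM a b : aug (a * b) = aug a * aug b.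
Proof.
apply: aug_eq.
have -> : a * b - (aug a * aug b)%:A =
    (a - (aug a)%:A) * b + aug a *: (b - (aug b)%:A).
  by rewrite mulrBl -scalerAl mul1r scalerBr scalerA addrA subrK.
apply: Aplus_add; first by apply: Aplus_mulr; exact: augP.
by apply: Aplus_scale; exact: augP.
Qed.

Lemma aug1 : aug 1 = 1.
Proof. by apply: aug_eq; rewrite scale1r subrr; exact: Aplus0. Qed.

Lemma aug_pos i a : agr A i.+1 a -> aug a = 0.
Proof.
by move=> Ha; apply: aug_eq; rewrite scale0r subr0; exact: Aplus_hom Ha.
Qed.

Definition residue : Type := k.
HB.instance Definition _ := GRing.Zmodule.on residue.

Definition residue_act (a : A^c) (x : residue) : residue := aug a * (x : k).

Lemma residue_actA (a b : A^c) (x : residue) :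
  residue_act a (residue_act b x) = residue_act (a * b) x.
Proof.
rewrite /residue_act [aug (a * b)](_ : _ = aug ((b : A) * (a : A))) //.
by rewrite augM mulrA [aug a * _]mulrC.
Qed.

Lemma residue_act1 : left_id 1 residue_act.
Proof. by move=> x; rewrite /residue_act [aug 1]aug1 mul1r. Qed.

Lemma residue_actDr : right_distributive residue_act +%R.
Proof. by move=> a x y; exact: mulrDr. Qed.

Lemma residue_actDl v : {morph residue_act^~ v : a b / a + b}.
Proof. by move=> a b; rewrite /residue_act [aug _]augD; exact: mulrDl. Qed.

HB.instance Definition _ := GRing.Zmodule_isLmodule.Build A^c residue
  residue_actA residue_act1 residue_actDr residue_actDl.

Definition residue_gr (n : int) (x : residue) : Prop := n = 0 \/ x = 0.

Lemma residue_direct : direct_sum residue_gr.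
Proof.
split=> [i|x|s c us Hc sc i si].
- split=> [|x y [->|->] [Hi|->]]; rewrite ?subrr; try by [left|right].
- exists [:: 0], (fun i => if i == 0 then x else 0); split.
    by move=> i; case: eqP; [left|right].
  by rewrite big_cons big_nil eqxx addr0.
- have [i0|//] := Hc i; rewrite -[RHS]sc (bigD1_seq i) //= big1 ?addr0 // => j.
  by rewrite i0 => /eqP j0; have [] := Hc j.
Qed.

Lemma residue_gr_act n i (a : A) (m : residue) : residue_gr n m -> agr A i a ->
  residue_gr (n + i%:Z) ((a : A^c) *: m).
Proof.
case=> [->|->]; last by right; rewrite scaler0.
case: i => [|i] Ha; first by left.
right; rewrite [_ *: _](_ : _ = aug a * (m : k)) // (aug_pos Ha); exact: mul0r.
Qed.

(* k_A, concentrated in degree 0 *)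
Definition resmod : grmod A := MkGrMod residue_direct residue_gr_act.

(* The total space Ext^i_A(k, M) is the graded space with component            *)
(* Ext^i(k, M[l]) in degree l, Ext being taken in the category of graded       *)
(* modules.                                                                    *)
Definition extA_dim (i : nat) (M : grmod A) (l : int) (m : nat) : Prop :=
  Ext_dim (C := GM) i resmod (shift l M) m.

Definition extA_fin_dim (i : nat) (M : grmod A) : Prop :=
  (forall l, exists m, extA_dim i M l m) /\
  exists s : seq int, forall l, l \notin s -> extA_dim i M l 0.

Definition gorenstein (d : nat) : Prop :=
  (forall i, i <> d -> forall l, extA_dim i regmod l 0) /\
  exists l : int, forall n, extA_dim d regmod n (n + l == 0).

Definition regular (d : nat) : Prop := gldim_eq GM d /\ gorenstein d.

Definition chi : Prop :=
  forall i M, fin_pres M -> extA_fin_dim i M.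

Definition cmod : klcat k := full_sub (C := GM) fin_pres.

Definition tors (M : cmod) : Prop := fin_dim (sval M).

Definition qgr : klcat k := serre_quotient (C := cmod) tors.

Definition cmod_shift (l : int) : functor cmod cmod :=
  full_sub_functor (F := shift l) (@fin_pres_shift l).

Lemma cmod_shift_quasi_inverse l :
  quasi_inverse (cmod_shift l) (cmod_shift (- l)).
Proof. exact/full_sub_quasi_inverse/shift_quasi_inverse. Qed.

Lemma cmod_shift_serre_iso l X Y (s : hom cmod X Y) :
  serre_iso tors s -> serre_iso tors (fhom (cmod_shift l) s).
Proof.
by apply: quasi_inverse_serre_iso (cmod_shift_quasi_inverse l) _ _ _ s => M.
Qed.

Definition qgr_shift (l : int) : functor qgr qgr :=
  localization_functor (@cmod_shift_serre_iso l).

Lemma qgr_shift_autoequivalence l : autoequivalence (qgr_shift l).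
Proof.
exists (qgr_shift (- l)); apply: localization_quasi_inverse.
exact: cmod_shift_quasi_inverse.
Qed.

End GradedModuleCategories.

(* (C, A, s); Gamma does not use that C is abelian, and this is not recorded.  *)
Record triple (k : fieldType) := Triple {
  tcat : klcat k;
  tobj : tcat;
  tshift : functor tcat tcat;
  tshift_equiv : autoequivalence tshift
}.

Definition proj (k : fieldType) (A : gralg k) : triple k :=
  @Triple k (qgr A) (exist _ (regmod A) (fin_pres_regmod A))
    (qgr_shift A 1) (qgr_shift_autoequivalence A 1).

Section Gamma.
Variables (k : fieldType) (X : triple k).
Local Notation C := (tcat X).
Local Notation s := (tshift X).

Fixpoint spow (n : nat) (Y : C) : C :=
  if n is m.+1 then spow m (s Y) else Y.

Fixpoint spow_hom (n : nat) (Y Z : C) (f : hom C Y Z) :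
    hom C (spow n Y) (spow n Z) :=
  match n return hom C (spow n Y) (spow n Z) with
  | 0%N => f
  | m.+1 => spow_hom m (fhom s f)
  end.

(* The canonical identification of s^j (s^i Y) with s^(i + j) Y. Both sides    *)
(* are equal for each i, and this map is the identity.                         *)
Fixpoint spow_add (i j : nat) (Y : C) :
    hom C (spow j (spow i Y)) (spow (i + j)%N Y) :=
  match i return hom C (spow j (spow i Y)) (spow (i + j)%N Y) with
  | 0%N => idm (spow j Y)
  | i'.+1 => spow_add i' j (s Y)
  end.

Definition Gamma (i : nat) : Type := hom C (tobj X) (spow i (tobj X)).

Definition Gamma_mul i j (a : Gamma i) (b : Gamma j) : Gamma (i + j)%N :=
  comp (spow_add i j (tobj X)) (comp (spow_hom j a) b).

(* Isomorphism of graded algebras from A to the direct sum of the Gamma i,     *)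
(* given by its components phi i : A_i -> Gamma i.                             *)
Definition iso_Gamma (A : gralg k) : Prop :=
  exists phi : forall i : nat, A -> Gamma i,
    [/\ forall i (c : k) a b, agr A i a -> agr A i b ->
          heq (phi i (c *: a + b)) (hadd (hscale c (phi i a)) (phi i b)),
        forall i a b, agr A i a -> agr A i b -> heq (phi i a) (phi i b) -> a = b,
        forall i (f : Gamma i), exists a, agr A i a /\ heq (phi i a) f,
        forall i j a b, agr A i a -> agr A j b ->
          heq (phi (i + j)%N (a * b)) (Gamma_mul (phi i a) (phi j b))
      & heq (phi 0%N 1) (idm (tobj X))].

End Gamma.

(* Main.v *)
(* Above a resolution 0 -> K -> P_n -> ... -> P_0 -> X -> 0, Ext^(n+1)(X, Y) is  *)
(* Hom(K, Y) modulo the maps that extend to P_n.                               *)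
(*                                                                             *)
(* chi: Ext^i(k, M) vanishes for i > d, and a cover 0 -> K -> P -> M -> 0 by a  *)
(* free module of finite rank gives descending induction on i, as Ext^i(k, P)  *)
(* is known from the Gorenstein property.                                      *)
(*                                                                             *)
(* A morphism X -> Y of qgr A is an honest map X_{>=m} -> Y for m >> 0, and      *)
(* Ext^n(X, Y) in qgr A is Ext^n(X_{>=m}, Y) in cmod A for m >> 0: the quotient *)
(* X_{>=m} / X_{>=m'} is an iterated extension of modules k[-j] with j >= m,   *)
(* and Ext^i(k[-j], Y) = Ext^i(k, Y[j]) vanishes for large j by chi.           *)
(*                                                                             *)
(* Ext^d in qgr A is zero: by chi, Hom(k, X_{>=m}[l]) = 0 for all l if m >> 0,  *)
(* so in a minimal resolution P_i -> K_i of X_{>=m} = K_0 one gets by shifting  *)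
(* Ext^(d-1)(k, K_(d-1)[l]) = 0. Now K_d is free and Ext^d(k, K_d) embeds in   *)
(* Ext^d(k, P_(d-1)), although K_d -> P_(d-1) has entries in A_+ and so acts   *)
(* by zero there; hence K_d = 0. Conversely Ext^(d-1)(A_{>=1}, A[l]) maps onto  *)
(* Ext^d(k, A[l]), which is not zero for some l.                               *)
(*                                                                             *)
(* Gamma: Ext^i(k, A[j]) = 0 for i <= 1 and j >= 0, so every map A -> A[i] in  *)
(* qgr A comes from a unique map of modules, that is, from an element of A_i.  *)

From HB Require Import structures.
From Stdlib Require Import Setoid Morphisms Relation_Operators.
From Pilot Require Import Defs.
From mathcomp Require Import all_boot all_order all_algebra.
From mathcomp Require Import boolp zify.
(* Again, since [hom] is also a name of mathcomp's vector library. *)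
Import Pilot.Defs.

Set Implicit Arguments.
Unset Strict Implicit.
Unset Printing Implicit Defensive.
Import Order.TTheory GRing.Theory Num.Theory.
Local Open Scope ring_scope.

(** * Extensions and projective resolutions *)

Section KlinearCategories.
Variables (k : fieldType) (C : klcat k).
Local Open Scope kl_scope.
Local Notation "f - g" := (hadd f (hscale (-1)%R g)) : kl_scope.

Lemma hadd0r X Y (f : hom C X Y) : f + 0 == f.
Proof. rewrite haddC; exact: hadd0. Qed.

Lemma comp0l X Y Z (f : hom C X Y) : hzero Y Z \o f == 0.
Proof. rewrite -(haddN (hzero Y Z)) compDl compZl; exact: haddN. Qed.

Lemma comp0r X Y Z (f : hom C Y Z) : f \o hzero X Y == 0.
Proof. rewrite -(haddN (hzero X Y)) compDr compZr; exact: haddN. Qed.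

Lemma compBl X Y Z (g g' : hom C Y Z) (f : hom C X Y) :
  (g - g') \o f == (g \o f) - (g' \o f).
Proof. rewrite compDl compZl; reflexivity. Qed.

Lemma compBr X Y Z (g : hom C Y Z) (f f' : hom C X Y) :
  g \o (f - f') == (g \o f) - (g \o f').
Proof. rewrite compDr compZr; reflexivity. Qed.

Lemma hsubK X Y (f g : hom C X Y) : g + (f - g) == f.
Proof. by rewrite haddC -haddA (haddC _ g) haddN hadd0r. Qed.

Lemma hsub_eq0 X Y (f g : hom C X Y) : f - g == 0 <-> f == g.
Proof.
split=> [e|->]; last exact: haddN.
by rewrite -(hsubK f g) e hadd0r.
Qed.

Lemma hscale0 (X Y : C) c : c *: hzero X Y == 0.
Proof.
transitivity (hzero Y Y \o (c *: hzero X Y)); last exact: comp0l.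
by rewrite compZr comp0l.
Qed.

Lemma epi_eq0 X Y Z (e : hom C X Y) (f : hom C Y Z) :
  epi e -> f \o e == 0 -> f == 0.
Proof. by move=> He fe; apply: He; rewrite fe comp0l. Qed.

Section Ses.
Variables (Y X : C) (s : ses Y X).

Lemma ses_comp0 : prj s \o inj s == 0.
Proof. by case: (ses_ker s). Qed.

Lemma ses_mono T (f g : hom C T Y) : inj s \o f == inj s \o g -> f == g.
Proof.
move=> e; have [_ H] := ses_ker s.
have [|u [_ Hu]] := H T (inj s \o g); first by rewrite compA ses_comp0 comp0l.
by rewrite (Hu _ e) (Hu g).
Qed.

Lemma ses_mono0 T (f : hom C T Y) : inj s \o f == 0 -> f == 0.
Proof. by move=> e; apply: ses_mono; rewrite e comp0r. Qed.

Lemma ses_epi : epi (prj s).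
Proof.
move=> T f g e; have [_ H] := ses_coker s.
have [|u [_ Hu]] := H T (g \o prj s); first by rewrite -compA ses_comp0 comp0r.
by rewrite (Hu _ e) (Hu g).
Qed.

Lemma ses_kerP T (g : hom C T (mid s)) : prj s \o g == 0 ->
  exists u, inj s \o u == g.
Proof. by move=> e; have [_ H] := ses_ker s; have [u [Hu _]] := H _ _ e; exists u. Qed.

Lemma ses_cokerP T (g : hom C (mid s) T) : g \o inj s == 0 ->
  exists u, u \o prj s == g.
Proof. by move=> e; have [_ H] := ses_coker s; have [u [Hu _]] := H _ _ e; exists u. Qed.

Lemma ses_section_retraction (u : hom C X (mid s)) :
  prj s \o u == 1 -> exists r, r \o inj s == 1.
Proof.
move=> pu.
have [|r Hr] := @ses_kerP _ (1 - (u \o prj s)).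
  by rewrite compBr compm1 compA pu comp1m haddN.
exists r; apply: ses_mono.
rewrite compA Hr compBl comp1m -compA ses_comp0 comp0r compm1 hscale0; exact: hadd0r.
Qed.

End Ses.

Arguments ses_epi {Y X} s [Z f g].

Section SesMor.

Lemma ses_mor_heq Y X Y' X' (s : ses Y X) (s' : ses Y' X')
    (g g' : hom C Y Y') (f f' : hom C X X') :
  g == g' -> f == f' -> ses_mor s s' g f -> ses_mor s s' g' f'.
Proof. by move=> gg ff [e [e1 e2]]; exists e; rewrite -gg -ff. Qed.

Lemma ses_mor_comp Y X Y' X' Y'' X'' (s : ses Y X) (s' : ses Y' X') (s'' : ses Y'' X'')
    (g : hom C Y Y') (f : hom C X X') (g' : hom C Y' Y'') (f' : hom C X' X'') :
  ses_mor s s' g f -> ses_mor s' s'' g' f' -> ses_mor s s'' (g' \o g) (f' \o f).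
Proof.
move=> [e [e1 e2]] [e' [e1' e2']]; exists (e' \o e); split.
  by rewrite -compA e1 compA e1' compA.
by rewrite compA e2' -compA e2 compA.
Qed.

Lemma ses_mor1 (Y X : C) (s : ses Y X) : ses_mor s s 1 1.
Proof. by exists 1; rewrite !comp1m !compm1. Qed.

Lemma ses_morD Y X Y' X' (s : ses Y X) (s' : ses Y' X')
    (g g' : hom C Y Y') (f f' : hom C X X') :
  ses_mor s s' g f -> ses_mor s s' g' f' -> ses_mor s s' (g + g') (f + f').
Proof.
move=> [e [e1 e2]] [e' [e1' e2']]; exists (e + e').
by rewrite !compDl !compDr e1 e2 e1' e2'.
Qed.

Lemma ses_mor_adjust Y X Y' X' (s : ses Y X) (s' : ses Y' X')
    (g : hom C Y Y') (f : hom C X X') (t : hom C (mid s) Y') :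
  ses_mor s s' g f -> ses_mor s s' (g + (t \o inj s)) f.
Proof.
move=> [e [e1 e2]]; exists (e + (inj s' \o t)); split.
  by rewrite compDl compDr e1 compA.
by rewrite compDr e2 compA ses_comp0 comp0l hadd0r.
Qed.

Lemma ses_mor_kernel Y X Y' X' (s : ses Y X) (s' : ses Y' X')
    (e : hom C (mid s) (mid s')) (f : hom C X X') :
  prj s' \o e == f \o prj s ->
  exists g, e \o inj s == inj s' \o g /\ ses_mor s s' g f.
Proof.
move=> e2; have [|g Hg] := @ses_kerP _ _ s' _ (e \o inj s).
  by rewrite compA e2 -compA ses_comp0 comp0r.
by exists g; split; [|exists e]; rewrite ?Hg.
Qed.

Lemma ses_lift Y X Y' X' (s : ses Y X) (s' : ses Y' X') (f : hom C X X') :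
  projective (mid s) -> exists g, ses_mor s s' g f.
Proof.
move=> P; have [e He] := P _ _ (prj s') (f \o prj s) (ses_epi s').
by have [g [_ Hg]] := ses_mor_kernel He; exists g.
Qed.

End SesMor.

Fixpoint yext_all (Q : C -> Prop) n X Y : yext n X Y -> Prop :=
  match n with
  | 0%N => fun s => Q (mid s)
  | m.+1 => fun E => Q (mid (projT2 E).1) /\ yext_all Q (projT2 E).2
  end.

Definition yhead n X Y : yext n X Y -> C :=
  match n with
  | 0%N => fun s => mid s
  | m.+1 => fun E => mid (projT2 E).1
  end.

Definition yinj n X Y : forall E : yext n X Y, hom C Y (yhead E) :=
  match n with
  | 0%N => fun s => inj s
  | m.+1 => fun E => inj (projT2 E).1
  end.

Lemma yext_all_head (Q : C -> Prop) n X Y (E : yext n X Y) :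
  yext_all Q E -> Q (yhead E).
Proof. by case: n E => [|n] E //= []. Qed.

Lemma yext_all_imp (Q Q' : C -> Prop) n (X Y : C) (E : yext n X Y) :
  (forall Z, Q Z -> Q' Z) -> yext_all Q E -> yext_all Q' E.
Proof.
move=> QQ; elim: n Y E => [|n IH] Y E /=; first exact: QQ.
by case=> /QQ H /IH.
Qed.

Lemma yext_mor_heq n X Y X' Y' (E : yext n X Y) (E' : yext n X' Y')
    (f f' : hom C X X') (g g' : hom C Y Y') :
  f == f' -> g == g' -> yext_mor E E' f g -> yext_mor E E' f' g'.
Proof.
move=> ff; elim: n Y Y' E E' g g' => [|n IH] Y Y' E E' g g' gg /=.
  exact: ses_mor_heq.
case=> h [H1 H2]; exists h; split; first by apply: ses_mor_heq H1.
exact: (IH _ _ _ _ h).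
Qed.

Lemma yext_mor_comp n X Y X' Y' X'' Y'' (E : yext n X Y) (E' : yext n X' Y')
    (E'' : yext n X'' Y'') (f : hom C X X') (g : hom C Y Y')
    (f' : hom C X' X'') (g' : hom C Y' Y'') :
  yext_mor E E' f g -> yext_mor E' E'' f' g' ->
  yext_mor E E'' (f' \o f) (g' \o g).
Proof.
elim: n Y Y' Y'' E E' E'' g g' => [|n IH] Y Y' Y'' E E' E'' g g' /=.
  exact: ses_mor_comp.
move=> [h [H1 H2]] [h' [H1' H2']]; exists (h' \o h); split.
  exact: ses_mor_comp H1 H1'.
exact: IH H2 H2'.
Qed.

Lemma yext_mor1 n (X Y : C) (E : yext n X Y) : yext_mor E E 1 1.
Proof.
elim: n Y E => [|n IH] Y E /=; first exact: ses_mor1.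
by exists 1; split; [exact: ses_mor1|exact: IH].
Qed.

Lemma yext_morD n X Y X' Y' (E : yext n X Y) (E' : yext n X' Y')
    (f f' : hom C X X') (g g' : hom C Y Y') :
  yext_mor E E' f g -> yext_mor E E' f' g' ->
  yext_mor E E' (f + f') (g + g').
Proof.
elim: n Y Y' E E' g g' => [|n IH] Y Y' E E' g g' /=; first exact: ses_morD.
move=> [h [H1 H2]] [h' [H1' H2']]; exists (h + h'); split.
  exact: ses_morD H1 H1'.
exact: IH H2 H2'.
Qed.

Lemma yext_mor_adjust n X Y X' Y' (E : yext n X Y) (E' : yext n X' Y')
    (f : hom C X X') (g : hom C Y Y') (t : hom C (yhead E) Y') :
  yext_mor E E' f g -> yext_mor E E' f (g + (t \o yinj E)).
Proof.
case: n E E' t => [|n] E E' t /=; first exact: ses_mor_adjust.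
by move=> [h [H1 H2]]; exists h; split=> //; exact: ses_mor_adjust.
Qed.

Lemma yext_lift n X Y X' Y' (E : yext n X Y) (E' : yext n X' Y') (f : hom C X X') :
  yext_all (@projective k C) E -> exists g, yext_mor E E' f g.
Proof.
elim: n Y Y' E E' => [|n IH] Y Y' E E' /=; first exact: ses_lift.
move=> [P /IH H]; have [h Hh] := H _ (projT2 E').2.
by have [g Hg] := ses_lift (projT2 E').1 h P; exists g, h.
Qed.

Lemma ses_homotopy Y X Y' X' (s : ses Y X) (s' : ses Y' X')
    (g g' : hom C Y Y') (f f' : hom C X X') (v : hom C X (mid s')) :
  ses_mor s s' g f -> ses_mor s s' g' f' -> f - f' == prj s' \o v ->
  exists t : hom C (mid s) Y', g - g' == t \o inj s.
Proof.
move=> [e [e1 e2]] [e' [e1' e2']] fv.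
have [|t Ht] := @ses_kerP _ _ s' _ ((e - e') - (v \o prj s)).
  by rewrite 2!compBr e2 e2' compA -fv -compBl haddN.
exists t; apply: (ses_mono (s := s')).
rewrite compA Ht !compBl compBr e1 e1' -compA ses_comp0 comp0r hscale0 hadd0r.
reflexivity.
Qed.

Lemma yext_homotopy n X Y X' Y' (E : yext n X Y) (E' : yext n X' Y')
    (f : hom C X X') (g g' : hom C Y Y') :
  yext_all (@projective k C) E ->
  yext_mor E E' f g -> yext_mor E E' f g' ->
  exists t : hom C (yhead E) Y', g - g' == t \o yinj E.
Proof.
elim: n Y Y' E E' g g' => [|n IH] Y Y' E E' g g' /=.
  move=> _ H H'; apply: (ses_homotopy (v := 0) H H').
  by rewrite comp0r haddN.
move=> [P PE] [h [H1 H2]] [h' [H1' H2']].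
have [t Ht] := IH _ _ _ _ _ _ PE H2 H2'.
have [u Hu] := yext_all_head PE _ _ _ t (ses_epi (projT2 E').1).
apply: (ses_homotopy (v := u \o yinj (projT2 E).2) H1 H1').
by rewrite compA Hu.
Qed.

(* Ext^n(X, Y) = 0, tested on projective resolutions of X. *)
Definition extv n (X Y : C) : Prop :=
  match n with
  | 0%N => forall f : hom C X Y, f == 0
  | m.+1 => forall K (R : yext m X K), yext_all (@projective k C) R ->
      forall h : hom C K Y, exists t, t \o yinj R == h
  end.

Lemma extv_res n X Y K (R : yext n X K) :
  yext_all (@projective k C) R ->
  (forall h : hom C K Y, exists t, t \o yinj R == h) -> extv n.+1 X Y.
Proof.
move=> PR HR K' R' PR' h.
have [c Hc] := yext_lift R' 1 PR; have [c' Hc'] := yext_lift R 1 PR'.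
have [t Ht] := HR (h \o c).
have H1 := yext_mor_heq (comp1m 1) (heq_refl _) (yext_mor_comp Hc' Hc).
have [v Hv] := yext_homotopy PR' H1 (yext_mor1 R').
have [e He] : exists e, e \o yinj R' == yinj R \o c'.
  clear -Hc'; case: n R R' Hc' => [|n] R R' /=; first by case=> e []; exists e.
  by case=> h [[e [He _]] _]; exists e.
exists ((t \o e) - (h \o v)).
have E1 : t \o e \o yinj R' == h \o (c \o c') by rewrite -compA He compA Ht -compA.
have E2 : h \o v \o yinj R' == (h \o (c \o c')) - h by rewrite -compA -Hv compBr compm1.
rewrite compBl E1 E2; set a := comp h (comp c c').
rewrite -[in X in _ == X](hsubK h a) hscaleDr hscaleA mulrNN mulr1 hscale1.
by apply: hadd_heq (heq_refl _) _; rewrite haddC.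
Qed.

Lemma extv_iso n X Y Y' (f : hom C Y Y') (g : hom C Y' Y) :
  f \o g == 1 -> extv n X Y -> extv n X Y'.
Proof.
move=> fg; case: n => [|n] H.
  by move=> h; rewrite -(comp1m h) -fg -compA (H (g \o h)) comp0r.
move=> K R PR h; have [t Ht] := H K R PR (g \o h).
by exists (f \o t); rewrite -compA Ht compA fg comp1m.
Qed.

Section ExtLES.
Variables (K M Z : C) (s : ses K Z).
Local Notation P := (mid s).

Lemma extv_mid_quot n X K' (R : yext n X K') : yext_all (@projective k C) R ->
  forall K'' (a : ses K'' K'), projective (mid a) ->
  extv n.+1 X P -> extv n.+2 X K -> extv n.+1 X Z.
Proof.
move=> PR K'' a Pa HP HK; apply: (extv_res PR) => f.
have [g Hg] := Pa _ _ _ (f \o prj a) (ses_epi s).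
have [|w Hw] := @ses_kerP _ _ s _ (g \o inj a).
  by rewrite compA Hg -compA ses_comp0 comp0r.
have [|t Ht] := HK _ (existT _ K' (a, R) : yext n.+1 X K'') _ w; first by split.
rewrite /= in t Ht.
have [|v Hv] := @ses_cokerP _ _ a _ (g - (inj s \o t)).
  by rewrite compBl -compA Ht Hw haddN.
have [v' Hv'] := HP _ _ PR v.
exists (prj s \o v'); rewrite -compA Hv'; apply: (@ses_epi _ _ a).
by rewrite -compA Hv compBr Hg compA ses_comp0 comp0l hscale0 hadd0r.
Qed.

Lemma extv_mid_quot0 X K'' (a : ses K'' X) : projective (mid a) ->
  extv 0 X P -> extv 1 X K -> extv 0 X Z.
Proof.
move=> Pa HP HK f.
have [g Hg] := Pa _ _ _ (f \o prj a) (ses_epi s).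
have [|w Hw] := @ses_kerP _ _ s _ (g \o inj a).
  by rewrite compA Hg -compA ses_comp0 comp0r.
have [t Ht] := HK _ (a : yext 0 X K'') Pa w.
rewrite /= in t Ht.
have [|v Hv] := @ses_cokerP _ _ a _ (g - (inj s \o t)).
  by rewrite compBl -compA Ht Hw haddN.
apply: (@ses_epi _ _ a); rewrite comp0l -Hg.
have e := HP v; rewrite e comp0l in Hv.
move/heq_sym/hsub_eq0: Hv => ->.
by rewrite compA ses_comp0 comp0l.
Qed.

(* Injectivity of Ext^(n+1)(X, K) -> Ext^(n+1)(X, P) when Ext^n(X, Z) = 0. *)
Lemma extv_connecting n X K' (R : yext n X K') : yext_all (@projective k C) R ->
  extv n X Z -> forall (f : hom C K' K) (u : hom C (yhead R) P),
  inj s \o f == u \o yinj R -> exists t, t \o yinj R == f.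
Proof.
case: n R => [|n] R PR HZ f u fu.
  have [|w Hw] := @ses_cokerP _ _ R _ (prj s \o u).
    by rewrite /= in fu; rewrite -compA -fu compA ses_comp0 comp0l.
  have [|t Ht] := @ses_kerP _ _ s _ u; first by rewrite -Hw (HZ w) comp0l.
  exists t; apply: (ses_mono (s := s)).
  by rewrite compA Ht fu.
case: R PR u fu => L [a R] [/= Pa PR] u fu.
have [|w Hw] := @ses_cokerP _ _ a _ (prj s \o u).
  by rewrite -compA -fu compA ses_comp0 comp0l.
have [w' Hw'] := HZ _ _ PR w.
have [w'' Hw''] := yext_all_head PR _ _ _ w' (ses_epi s).
have [|t Ht] := @ses_kerP _ _ s _ (u - (w'' \o yinj R \o prj a)).
  by rewrite compBr -Hw 2!compA Hw'' Hw' haddN.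
exists t; apply: (ses_mono (s := s)).
by rewrite compA Ht compBl -compA -compA ses_comp0 !comp0r fu hscale0 hadd0r.
Qed.

Lemma extv_mid_sub n X K' (R : yext n X K') : yext_all (@projective k C) R ->
  extv n.+1 X P -> extv n X Z -> extv n.+1 X K.
Proof.
move=> PR HP HZ; apply: (extv_res PR) => f.
have [u Hu] := HP _ _ PR (inj s \o f).
by apply: (extv_connecting PR HZ (u := u)); rewrite Hu.
Qed.

End ExtLES.

Fixpoint yext_splice n (X Y Z : C) : yext n Z Y -> ses Z X -> yext n.+1 X Y :=
  match n with
  | 0%N => fun t s => existT _ Z (t, (s : yext 0 X Z))
  | m.+1 => fun E s => existT _ (projT1 E) ((projT2 E).1, yext_splice (projT2 E).2 s)
  end.

Lemma yext_splice_all (Q : C -> Prop) n (X Y Z : C) (E : yext n Z Y) (s : ses Z X) :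
  yext_all Q E -> Q (mid s) -> yext_all Q (yext_splice E s).
Proof.
elim: n Y E => [|n IH] Y E /=; first by [].
by case=> HE1 HE2 Hs; split=> //; exact: IH.
Qed.

Lemma yext_splice_boundary n X Y Z (E : yext n Z Y) (s : ses Z X) T (h : hom C Y T) :
  (exists t, t \o yinj E == h) <-> (exists t, t \o yinj (yext_splice E s) == h).
Proof. by case: n E => [|n] E. Qed.

Lemma extv_shift n X Y Z (s : ses Z X) K (R : yext n Z K) :
  projective (mid s) -> yext_all (@projective k C) R ->
  extv n.+1 Z Y -> extv n.+2 X Y.
Proof.
move=> Ps PR H; apply: (extv_res (yext_splice_all PR Ps)) => h.
exact/(yext_splice_boundary R s)/(H K R PR).
Qed.

Lemma extv_unshift n X Y Z (s : ses Z X) :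
  projective (mid s) -> extv n.+2 X Y -> extv n.+1 Z Y.
Proof.
move=> Ps H K R PR h.
exact/(yext_splice_boundary R s)/(H K (yext_splice R s) (yext_splice_all PR Ps)).
Qed.

Lemma pdim_le_resolution (O : C) : hzero O O == 1 -> forall m X, pdim_le m X ->
  forall n, (m <= n)%N -> exists K (R : yext n X K),
    yext_all (@projective k C) R /\ hzero K K == 1.
Proof.
move=> O0; have zeroL Z (f : hom C O Z) : f == 0.
  by rewrite -(compm1 f) -O0 comp0r.
have zeroR Z (f : hom C Z O) : f == 0.
  by rewrite -(comp1m f) -O0 comp0l.
have ker0 X : is_kernel (idm X) (hzero O X).
  split=> [|T g e]; first by rewrite comp0r.
  exists 0; split=> [|v _]; last exact: zeroR.
  by rewrite comp0r -e comp1m.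
have coker0 X : is_cokernel (hzero O X) (idm X).
  split=> [|T g _]; first by rewrite comp0r.
  by exists g; split=> [|v e]; rewrite ?compm1 // -e compm1.
pose s0 X := Ses (ker0 X) (coker0 X).
have PO : projective O by move=> X Y e f _; exists 0; rewrite comp0r (zeroL _ f).
have base n : forall X, projective X -> exists R : yext n X O, yext_all (@projective k C) R.
  move=> X PX; elim: n => [|n [R PR]]; first by exists (s0 X).
  by exists (existT _ O (s0 O, R)).
elim=> [|m IH] X HX n.
  by move=> _; have [R PR] := base n X HX; exists O, R.
case: n => // n mn; case: HX => K [s [Ps HK]].
have [L [R [PR HL]]] := IH K HK n mn.
by exists L, (yext_splice R s); split=> //; exact: yext_splice_all.
Qed.

Lemma pdim_le_extv (O : C) m X n Y : hzero O O == 1 -> pdim_le m X ->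
  (m < n)%N -> extv n X Y.
Proof.
case: n => // n O0 HX mn.
have [K [R [PR K0]]] := pdim_le_resolution O0 HX (mn : (m <= n)%N).
by apply: (extv_res PR) => h; exists 0; rewrite -(compm1 h) -K0 comp0r comp0l.
Qed.

End KlinearCategories.

Section YonedaExt.
Variables (k : fieldType) (C : klcat k).
Local Open Scope kl_scope.
Local Notation "f - g" := (hadd f (hscale (-1)%R g)) : kl_scope.

(* Ext^(n+1)(X, Y) from resolutions R i of objects XR i over X (in qgr A, of    *)
(* the truncations of X); an extension E lifts to R i for all large i, and val  *)
(* reads off the class of the resulting map KR i -> Y.                         *)
Section Criterion.
Variables (n : nat) (X Y : C) (N : nat).
Variables (I : Type) (big : (I -> Prop) -> Prop) (XR KR : I -> C).
Variables (R : forall i, yext n (XR i) (KR i)) (f : forall i, hom C (XR i) X).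
Variable val : forall i, hom C (KR i) Y -> 'rV[k]_N.
Hypothesis bigI : forall P Q : I -> Prop, big P -> big Q -> big (fun i => P i /\ Q i).
Hypothesis bigE : forall P : I -> Prop, big P -> exists i, P i.
Hypothesis val_heq : forall i (h h' : hom C (KR i) Y), h == h' -> val h = val h'.
Hypothesis valD : forall i (h h' : hom C (KR i) Y), val (h + h') = (val h + val h')%R.
Hypothesis valZ : forall i c (h : hom C (KR i) Y), val (c *: h) = (c *: val h)%R.
Hypothesis lift : forall X' Y' (E : yext n X' Y') (g : hom C X X'),
  big (fun i => exists h, yext_mor (R i) E (g \o f i) h).
Hypothesis lift_uniq : forall X' Y' (E : yext n X' Y') (g : hom C X X')
    (u : hom C Y' Y) i i' h h',
  yext_mor (R i) E (g \o f i) h -> yext_mor (R i') E (g \o f i') h' ->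
  val (u \o h) = val (u \o h').
Hypothesis val_inj : forall (E E' : yext n X Y) i i' h h',
  yext_mor (R i) E (f i) h -> yext_mor (R i') E' (f i') h' ->
  val h = val h' -> yext_eq E E'.
Hypothesis val_surj : forall v, exists (E : yext n X Y) i h,
  yext_mor (R i) E (f i) h /\ val h = v.

Lemma Ext_dim_criterion : Ext_dim n.+1 X Y N.
Proof.
have lift1 E : exists v, exists i h, yext_mor (R i) (E : yext n X Y) (f i) h /\ val h = v.
  have [i [h Hh]] := bigE (lift E 1).
  exists (val h), i, h; split=> //.
  exact: yext_mor_heq (comp1m _) (heq_refl _) Hh.
have [phi Hphi] := choice lift1.
have uniq E i h : yext_mor (R i) E (f i) h -> val h = phi E.
  move=> H; have [i' [h' [H' <-]]] := Hphi E.
  have := @lift_uniq _ _ E 1 1 i i' h h'.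
  rewrite !(val_heq (comp1m _)); apply.
    exact: yext_mor_heq (heq_sym (comp1m _)) (heq_refl _) H.
  exact: yext_mor_heq (heq_sym (comp1m _)) (heq_refl _) H'.
exists phi; split=> [E F|v|E F G|c E G].
- split=> [e|].
    have [i [h [H1 H2]]] := Hphi E; have [i' [h' [H1' H2']]] := Hphi F.
    by apply: (val_inj H1 H1'); rewrite H2 H2'.
  elim=> // {E F} [E F EF|E F G _ -> _ -> //].
  have [i [h [H1 <-]]] := Hphi E; apply: uniq.
  by apply: yext_mor_heq (yext_mor_comp H1 EF); rewrite comp1m.
- by have [E [i [h [H <-]]]] := val_surj v; exists E; rewrite (uniq _ _ _ H).
- case=> XX [i1 [i2 [p1 [p2 [YY [j1 [j2 [q1 [q2 [S [D]]]]]]]]]]].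
  case=> [[_ _ _ _ _] [a1 a2 a3 a4 _] [ES FS] DS DG].
  have big1 := bigI (lift E 1) (bigI (lift F 1) (lift D 1)).
  have [i [[hE HE] [[hF HF] [hD HD]]]] := bigE big1.
  have HE' := yext_mor_heq (comp1m _) (heq_refl _) HE.
  have HF' := yext_mor_heq (comp1m _) (heq_refl _) HF.
  rewrite -(uniq _ _ _ HE') -(uniq _ _ _ HF') -valD.
  have HDG : yext_mor (R i) G (f i) ((q1 + q2) \o hD).
    by apply: yext_mor_heq (yext_mor_comp HD DG); rewrite ?comp1m.
  rewrite -(uniq _ _ _ HDG).
  have H1 : yext_mor (R i) S ((i1 + i2) \o f i) ((j1 \o hE) + (j2 \o hF)).
    apply: yext_mor_heq (yext_morD (yext_mor_comp HE ES) (yext_mor_comp HF FS)) => //.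
    by rewrite comp1m compDl.
  have H2 : yext_mor (R i) S ((i1 + i2) \o f i) hD.
    by apply: yext_mor_heq (yext_mor_comp HD DS); rewrite ?comp1m.
  rewrite (lift_uniq (q1 + q2) H2 H1); apply: val_heq.
  rewrite compDr !compA !compDl a1 a2 a3 a4 !comp0l !comp1m hadd0 hadd0r.
  reflexivity.
- move=> EG; have [i [h [H1 <-]]] := Hphi E.
  rewrite -valZ; apply/esym/uniq.
  apply: yext_mor_heq (yext_mor_comp H1 EG); first by rewrite comp1m.
  by rewrite compZl comp1m.
Qed.

End Criterion.

Definition is_pushout_ses K X Y Q (s : ses K X) (h : hom C K Y) (s' : ses Y Q)
    (q : hom C X Q) : Prop :=
  ses_mor s s' h q /\
  forall Y' X' (s'' : ses Y' X') (g : hom C Y Y') (f : hom C Q X'),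
    ses_mor s s'' (g \o h) (f \o q) -> ses_mor s' s'' g f.

Definition is_pushout_yext n X K Y Q (E : yext n X K) (h : hom C K Y)
    (G : yext n Q Y) (q : hom C X Q) : Prop :=
  yext_mor E G q h /\
  forall Y' X' (F : yext n X' Y') (g : hom C Y Y') (f : hom C Q X'),
    yext_mor E F (f \o q) (g \o h) -> yext_mor G F f g.

Lemma pushout_yextS n X K Y Z (s : ses K Z) (h : hom C K Y) (s' : ses Y Z)
    (E : yext n X Z) :
  is_pushout_ses s h s' 1 ->
  is_pushout_yext (existT _ Z (s, E) : yext n.+1 X K) h
    (existT _ Z (s', E) : yext n.+1 X Y) 1.
Proof.
case=> H1 H2; split.
  by exists 1; split=> //; exact: yext_mor1.
move=> Y' X' F g f [u [/= Hu Hu']]; exists u; split.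
  by apply: H2; apply: ses_mor_heq Hu; rewrite ?compm1.
by apply: yext_mor_heq Hu'; rewrite ?compm1.
Qed.

Definition has_pushouts (K Y : C) : Prop :=
  forall Z (s : ses K Z) (h : hom C K Y), exists s' : ses Y Z, is_pushout_ses s h s' 1.

Lemma pushout_yext K Y : has_pushouts K Y ->
  forall n X (E : yext n X K) (h : hom C K Y), exists G, is_pushout_yext E h G 1.
Proof.
move=> PO [|n] X E h; first exact: PO.
case: E => Z [s E]; have [s' Hs'] := PO _ s h.
by exists (existT _ Z (s', E)); exact: pushout_yextS.
Qed.

Definition lin_quot (K Y : C) (B : hom C K Y -> Prop) N
    (th : hom C K Y -> 'rV[k]_N) : Prop :=
  [/\ forall h h', h == h' -> th h = th h',
      forall h h', th (h + h') = (th h + th h')%R,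
      forall c h, th (c *: h) = (c *: th h)%R,
      forall v, exists h, th h = v
    & forall h, th h = 0%R <-> B h].

Lemma lin_quotB K Y B N (th : hom C K Y -> 'rV[k]_N) : lin_quot B th ->
  forall h h', th (h - h') = (th h - th h')%R.
Proof. by case=> _ HD HZ _ _ h h'; rewrite HD HZ scaleN1r. Qed.

Lemma lin_quot_eq K Y B N (th : hom C K Y -> 'rV[k]_N) : lin_quot B th ->
  forall h h', th h = th h' <-> B (h - h').
Proof.
move=> Q h h'; have [_ _ _ _ <-] := Q; rewrite (lin_quotB Q).
by split=> [->|/eqP]; rewrite ?subrr // subr_eq0 => /eqP.
Qed.

Lemma lin_quot_zero K Y (B : hom C K Y -> Prop) : (forall h, B h) ->
  lin_quot B (fun=> 0%R : 'rV[k]_0).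
Proof.
move=> HB; split=> // [*|*|v]; rewrite ?addr0 ?scaler0 //.
by exists 0; rewrite [v]thinmx0.
Qed.

Section ProjectiveResolution.
Variables (n : nat) (X K : C) (R : yext n X K).
Hypothesis PR : yext_all (@projective k C) R.
Variable Y : C.

Definition boundary (h : hom C K Y) : Prop := exists t, t \o yinj R == h.

Lemma Ext_dim_resolution N (th : hom C K Y -> 'rV[k]_N) :
  has_pushouts K Y -> lin_quot boundary th -> Ext_dim n.+1 X Y N.
Proof.
move=> PO Q; have [Q1 Q2 Q3 Q4 Q5] := Q.
apply: (@Ext_dim_criterion n X Y N unit (fun P => P tt) (fun=> X) (fun=> K)
  (fun=> R) (fun=> 1) (fun=> th)) => //.
- by move=> P HP; exists tt.
- by move=> X' Y' E g; have [h Hh] := yext_lift E (g \o 1) PR; exists h.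
- move=> X' Y' E g u _ _ h h' H H'; have [t Ht] := yext_homotopy PR H H'.
  apply/(lin_quot_eq Q); exists (u \o t).
  by rewrite -compA -Ht compBr.
- move=> E E' _ _ h h' H H' /(lin_quot_eq Q) [t Ht].
  have H2 : yext_mor R E 1 h'.
    apply: yext_mor_heq (yext_mor_adjust ((-1)%R *: t) H) => //.
    rewrite compZl Ht hscaleDr hscaleA mulrNN mulr1 hscale1 haddA haddN.
    exact: hadd0.
  have [G [HG UG]] := pushout_yext PO R h'.
  apply: (rst_trans _ _ _ G); last first.
    apply: rst_step; apply: UG.
    by apply: yext_mor_heq H'; rewrite comp1m.
  apply/rst_sym/rst_step/UG.
  by apply: yext_mor_heq H2; rewrite comp1m.
- move=> v; have [h Hh] := Q4 v; have [G [HG _]] := pushout_yext PO R h.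
  by exists G, tt, h.
Qed.

Lemma yext_eq_homotopy (E F : yext n X Y) h h' :
  yext_eq E F -> yext_mor R E 1 h -> yext_mor R F 1 h' -> boundary (h - h').
Proof.
move=> EF; elim: EF h h' => {E F} [E F EF|E|E F _ IH|E F G _ IH1 _ IH2] h h' H H'.
- have HF := yext_mor_heq (comp1m _) (comp1m _) (yext_mor_comp H EF).
  by have [t Ht] := yext_homotopy PR HF H'; exists t; rewrite Ht.
- by have [t Ht] := yext_homotopy PR H H'; exists t; rewrite Ht.
- have [t Ht] := IH _ _ H' H; exists ((-1)%R *: t).
  rewrite compZl Ht hscaleDr hscaleA mulrNN mulr1 hscale1 haddC.
  reflexivity.
- have [l Hl] := yext_lift F 1 PR.
  have [t Ht] := IH1 _ _ H Hl; have [t' Ht'] := IH2 _ _ Hl H'.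
  exists (t + t'); rewrite compDl Ht Ht' -haddA (haddA _ l) (haddC _ l) haddN hadd0.
  reflexivity.
Qed.

Lemma Ext_dim0_boundary : has_pushouts K Y -> Ext_dim n.+1 X Y 0 ->
  forall h : hom C K Y, boundary h.
Proof.
move=> PO [phi [H1 _ _ _]] h.
have [G [HG _]] := pushout_yext PO R h; have [G' [HG' _]] := pushout_yext PO R 0.
have /H1 e : phi G = phi G' by rewrite [LHS]thinmx0 [RHS]thinmx0.
have [t Ht] := yext_eq_homotopy e HG HG'; exists t.
by rewrite Ht hscale0 hadd0r.
Qed.

Lemma Ext_dim0_extv : has_pushouts K Y -> Ext_dim n.+1 X Y 0 -> extv n.+1 X Y.
Proof. by move=> PO H; apply: extv_res PR _; exact: Ext_dim0_boundary. Qed.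

Lemma extv_Ext_dim0 : has_pushouts K Y -> extv n.+1 X Y -> Ext_dim n.+1 X Y 0.
Proof. by move=> PO H; apply: Ext_dim_resolution PO (lin_quot_zero (H _ _ PR)). Qed.

End ProjectiveResolution.

Lemma Ext_dim_hom X Y N (th : hom C X Y -> 'rV[k]_N) :
  lin_quot (fun h => h == 0) th -> Ext_dim 0 X Y N.
Proof.
move=> Q; have [Q1 Q2 Q3 Q4 Q5] := Q; exists th; split=> // [f g|f g h|c f g] /=.
- by rewrite (lin_quot_eq Q) hsub_eq0.
- by move/Q1 <-; exact: Q2.
- by move/Q1 <-; exact: Q3.
Qed.

Lemma extv_Ext_dim0_hom (X Y : C) : extv 0 X Y -> Ext_dim 0 X Y 0.
Proof. by move=> H; apply: (@Ext_dim_hom X Y 0 (fun=> 0%R)); exact: lin_quot_zero. Qed.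

Lemma Ext_dim0_extv_hom (X Y : C) : Ext_dim 0 X Y 0 -> extv 0 X Y.
Proof.
by move=> [phi [H _ _ _]] f; apply/(H f 0); rewrite [LHS]thinmx0 [RHS]thinmx0.
Qed.

Lemma Ext_dim_unique0 n (X Y : C) N : Ext_dim n X Y N -> Ext_dim n X Y 0 -> N = 0%N.
Proof.
case=> phi [H1 H2 _ _] [psi [H1' _ _ _]]; case: N phi H1 H2 => // N phi H1 H2.
have [E HE] := H2 0%R; have [F HF] := H2 (const_mx 1%R).
have /H1' /H1 : psi E = psi F by rewrite [LHS]thinmx0 [RHS]thinmx0.
rewrite HE HF => /rowP /(_ ord0); rewrite !mxE => /eqP.
by rewrite eq_sym oner_eq0.
Qed.

Lemma yext_base_iso n X X' Y (E : yext n X' Y) (f : hom C X' X) (g : hom C X X') :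
  f \o g == 1 -> g \o f == 1 -> exists G : yext n X Y,
    yext_mor E G f 1 /\ yext_mor G E g 1.
Proof.
move=> fg gf; elim: n Y E => [|n IH] Y E; last first.
  case: E => Z [s E]; have [G [G1 G2]] := IH _ E.
  exists (existT _ Z (s, G)).
  by split; exists 1; split=> //; exact: ses_mor1.
have Hk : is_kernel (f \o prj E) (inj E).
  split=> [|T h fh]; first by rewrite -compA ses_comp0 comp0r.
  have [|u Hu] := @ses_kerP _ _ _ _ E _ h.
    by rewrite -(comp1m (_ \o h)) -gf -compA (compA f) fh comp0r.
  exists u; split=> // v Hv; apply: (@ses_mono _ _ _ _ E).
  by rewrite Hu Hv.
have Hc : is_cokernel (inj E) (f \o prj E).
  split=> [|T h hi]; first by rewrite -compA ses_comp0 comp0r.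
  have [u Hu] := @ses_cokerP _ _ _ _ E _ _ hi.
  exists (u \o g); split; first by rewrite compA -(compA u) gf compm1.
  move=> v Hv; rewrite -(compm1 v) -fg compA.
  apply: comp_heq => //; apply: (@ses_epi _ _ _ _ E).
  by rewrite -compA Hv Hu.
exists (Ses Hk Hc : yext 0 X Y); split; exists 1; rewrite /= !comp1m !compm1 //.
by rewrite compA gf comp1m.
Qed.

Lemma ses_extend K' Q (t : ses K' Q) (a : C) (s : ses a Q) Y :
  projective (mid s) -> has_pushouts K' Y ->
  (forall l : hom C a Y, exists u, u \o inj s == l) ->
  forall h : hom C K' Y, exists u : hom C (mid t) Y, u \o inj t == h.
Proof.
move=> Ps PO Hs h; have [t' [[e [e1 e2]] _]] := PO _ t h.
have [c [m [m1 m2]]] := ses_lift t 1 Ps.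
have [u Hu] := Hs (h \o c).
have [|v Hv] := @ses_cokerP _ _ _ _ s _ ((e \o m) - (inj t' \o u)).
  rewrite compBl -compA m1 compA e1 -compA -[in X in _ - X]compA Hu haddN.
  reflexivity.
have [|r Hr] := @ses_section_retraction _ _ _ _ t' v.
  apply: (@ses_epi _ _ _ _ s); rewrite -compA Hv compBr !compA ses_comp0 comp0l hscale0 hadd0r.
  by rewrite e2 comp1m m2.
by exists (r \o e); rewrite -compA e1 compA Hr comp1m.
Qed.

End YonedaExt.

Section ExactFunctor.
Variables (k : fieldType) (C D : klcat k) (F : functor C D).
Local Open Scope kl_scope.

Definition exact_functor : Prop := forall Y X (s : ses Y X),
  is_kernel (fhom F (prj s)) (fhom F (inj s)) /\
  is_cokernel (fhom F (inj s)) (fhom F (prj s)).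

Hypothesis EF : exact_functor.

Definition fses Y X (s : ses Y X) : ses (F Y) (F X) :=
  Ses (proj1 (EF s)) (proj2 (EF s)).

Fixpoint fyext n X Y : yext n X Y -> yext n (F X) (F Y) :=
  match n with
  | 0%N => fun s => fses s
  | m.+1 => fun E => existT _ (F (projT1 E)) (fses (projT2 E).1, fyext (projT2 E).2)
  end.

Lemma fses_mor Y X Y' X' (s : ses Y X) (s' : ses Y' X') g f :
  ses_mor s s' g f -> ses_mor (fses s) (fses s') (fhom F g) (fhom F f).
Proof. by move=> [e [e1 e2]]; exists (fhom F e); rewrite /= -!fhomM e1 e2. Qed.

Lemma fyext_mor n X Y X' Y' (E : yext n X Y) (E' : yext n X' Y') f g :
  yext_mor E E' f g -> yext_mor (fyext E) (fyext E') (fhom F f) (fhom F g).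
Proof.
elim: n Y Y' E E' g => [|n IH] Y Y' E E' g /=; first exact: fses_mor.
by case=> h [H1 H2]; exists (fhom F h); split; [exact: fses_mor|exact: IH].
Qed.

Lemma fyext_all (Q : D -> Prop) n X Y (E : yext n X Y) :
  yext_all (fun Z => Q (F Z)) E -> yext_all Q (fyext E).
Proof. by elim: n Y E => [|n IH] Y E //= [H1 /IH H2]. Qed.

Lemma fyext_boundary n X Y (E : yext n X Y) T (h : hom D (F Y) T) :
  (exists t : hom D (F (yhead E)) T, t \o fhom F (yinj E) == h) <->
  (exists t, t \o yinj (fyext E) == h).
Proof. by case: n E => [|n] E. Qed.

End ExactFunctor.

(** * Graded modules *)

Lemma big_uniq_supp (I : eqType) (V : zmodType) (F : I -> V) (s u : seq I) :
  uniq s -> uniq u -> {subset s <= u} -> (forall i, i \notin s -> F i = 0) ->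
  \sum_(i <- u) F i = \sum_(i <- s) F i.
Proof.
move=> us uu su F0; rewrite (bigID (mem s)) /= [X in _ + X]big1 ?addr0; last exact: F0.
rewrite -big_filter; apply: perm_big; apply: uniq_perm => //; first exact: filter_uniq.
by move=> i; rewrite mem_filter /=; case si: (i \in s) => //=; rewrite (su _ si).
Qed.

Section DirectSumProjections.
Variables (I : eqType) (V : zmodType) (G : I -> V -> Prop) (D : direct_sum G).

Lemma dsum0 i : G i 0.
Proof. by have [H _ _] := D; have [] := H i. Qed.

Lemma dsumB i x y : G i x -> G i y -> G i (x - y).
Proof. by have [H _ _] := D; have [_] := H i; apply. Qed.

Lemma dsum_ind (P : V -> Prop) : P 0 ->
  (forall i x y, G i x -> P y -> P (x + y)) -> forall x, P x.
Proof.
move=> P0 PD x; have [_ H _] := D; have [s [c [Hc ->]]] := H x.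
by elim: s => [|i s IH]; rewrite ?big_nil ?big_cons //; exact: PD (Hc i) IH.
Qed.

Definition decomposes (f : I -> V) (s : seq I) (x : V) : Prop :=
  [/\ uniq s, forall i, G i (f i), forall i, i \notin s -> f i = 0
    & x = \sum_(i <- s) f i].

Lemma decomposes1 i x : G i x ->
  decomposes (fun j => if j == i then x else 0) [:: i] x.
Proof.
move=> Hx; split=> // [j|j|].
- by case: eqP => [->|_] //; exact: dsum0.
- by rewrite inE => /negbTE ->.
- by rewrite big_seq1 eqxx.
Qed.

Lemma decomposesB f s x g t y : decomposes f s x -> decomposes g t y ->
  decomposes (fun i => f i - g i) (undup (s ++ t)) (x - y).
Proof.
case=> us Hf f0 -> [ut Hg g0 ->]; split=> [|i|i|]; first exact: undup_uniq.
- exact: dsumB.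
- rewrite mem_undup mem_cat negb_or => /andP[/f0 -> /g0 ->]; exact: subr0.
rewrite sumrB; congr (_ - _); apply/esym/big_uniq_supp; rewrite ?undup_uniq //.
  by move=> i si; rewrite mem_undup mem_cat si.
by move=> i ti; rewrite mem_undup mem_cat ti orbT.
Qed.

Lemma decomposes_uniq f s g t x : decomposes f s x -> decomposes g t x -> f =1 g.
Proof.
move=> Hf Hg i; have := decomposesB Hf Hg; rewrite subrr => -[u H0 H1 H2].
have [_ _ H] := D; have {}H := H _ _ u H0 (esym H2).
apply/eqP; rewrite -subr_eq0; apply/eqP.
by case ui: (i \in undup (s ++ t)); [exact: H|apply: H1; rewrite ui].
Qed.

Lemma decomposes_ex x : exists f s, decomposes f s x.
Proof.
elim/dsum_ind: x => [|i x y Hx [f [s Hf]]].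
  by exists (fun=> 0), [::]; split=> // [i|]; [exact: dsum0|rewrite big_nil].
have := decomposesB (decomposes1 Hx) (decomposesB (decomposesB Hf Hf) Hf).
by rewrite subrr sub0r opprK; do 2!eexists; eauto.
Qed.

Definition dpr (i : I) (x : V) : V := sval (cid (decomposes_ex x)) i.

Lemma dprP x : exists s, decomposes (dpr^~ x) s x.
Proof. by rewrite /dpr; case: cid => f /= [s Hs]; exists s. Qed.

Lemma dpr_in i x : G i (dpr i x).
Proof. by have [s []] := dprP x. Qed.

Lemma dpr_eq f s x : decomposes f s x -> forall i, dpr i x = f i.
Proof. by move=> H; have [t Ht] := dprP x; exact: decomposes_uniq Ht H. Qed.

Lemma dpr_id i x : G i x -> dpr i x = x.
Proof. by move=> /decomposes1 /dpr_eq ->; rewrite eqxx. Qed.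

Lemma dpr_other i j x : G i x -> j != i -> dpr j x = 0.
Proof. by move=> /decomposes1 /dpr_eq -> /negbTE ->. Qed.

Lemma dprB i x y : dpr i (x - y) = dpr i x - dpr i y.
Proof.
have [s Hs] := dprP x; have [t Ht] := dprP y.
by rewrite (dpr_eq (decomposesB Hs Ht)).
Qed.

Lemma dpr0 i : dpr i 0 = 0.
Proof. by rewrite (dpr_id (dsum0 i)). Qed.

Lemma dprD i x y : dpr i (x + y) = dpr i x + dpr i y.
Proof. by rewrite -{1}(opprK y) dprB -(sub0r y) dprB dpr0 sub0r opprK. Qed.

Lemma dpr_sum i J (r : seq J) (F : J -> V) :
  dpr i (\sum_(j <- r) F j) = \sum_(j <- r) dpr i (F j).
Proof. by apply: big_morph; [exact: dprD|exact: dpr0]. Qed.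

Lemma dpr_eq0 x : (forall i, dpr i x = 0) -> x = 0.
Proof. by move=> H; have [s [_ _ _ ->]] := dprP x; rewrite big1. Qed.

End DirectSumProjections.

Section GradedConstructions.
Variables (k : fieldType) (A : gralg k).
Implicit Types (M N : grmod A).

Definition pr M (n : int) (x : M) : M := dpr (mgr_direct M) n x.

Lemma mgr_ind M (P : M -> Prop) : P 0 ->
  (forall n x y, mgr M n x -> P y -> P (x + y)) -> forall x, P x.
Proof. by move=> P0 PD; exact: (dsum_ind (mgr_direct M) P0 PD). Qed.

Lemma mgr_pr M n x : mgr M n (pr n x).
Proof. exact: dpr_in. Qed.

Lemma pr_id M n (x : M) : mgr M n x -> pr n x = x.
Proof. exact: dpr_id. Qed.

Lemma pr_other M n m (x : M) : mgr M n x -> m != n -> pr m x = 0.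
Proof. exact: dpr_other. Qed.

Lemma prD M n (x y : M) : pr n (x + y) = pr n x + pr n y.
Proof. exact: dprD. Qed.

Lemma pr0 M n : pr n (0 : M) = 0.
Proof. exact: dpr0. Qed.

Lemma pr_sum M n J (r : seq J) (F : J -> M) :
  pr n (\sum_(j <- r) F j) = \sum_(j <- r) pr n (F j).
Proof. exact: dpr_sum. Qed.

Lemma pr_eq0 M (x : M) : (forall n, pr n x = 0) -> x = 0.
Proof. exact: dpr_eq0. Qed.

Lemma pr_fin M (x : M) : exists s : seq int, [/\ uniq s,
  forall n, n \notin s -> pr n x = 0 & x = \sum_(n <- s) pr n x].
Proof. by have [s [H1 _ H2 H3]] := dprP (mgr_direct M) x; exists s. Qed.

Lemma pr_prE M n m (x : M) : pr n (pr m x) = if n == m then pr m x else 0.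
Proof.
case: eqP => [->|/eqP nm]; first exact/pr_id/mgr_pr.
exact: pr_other (mgr_pr m x) nm.
Qed.

Lemma mgr_sum M n (J : Type) (r : seq J) (P : pred J) (F : J -> M) :
  (forall j, P j -> mgr M n (F j)) -> mgr M n (\sum_(j <- r | P j) F j).
Proof. by move=> H; elim/big_rec: _ => [|j x Pj]; [exact: mgr0|apply: mgrD; exact: H]. Qed.

Lemma ract0 M (a : A) : (0 : M) *^ a = 0.
Proof. exact: scaler0. Qed.

Lemma ractx0 M (x : M) : x *^ (0 : A) = 0.
Proof. exact: scale0r. Qed.

Lemma ract1 M (x : M) : x *^ (1 : A) = x.
Proof. exact: scale1r. Qed.

Lemma ractN M (x : M) (a : A) : (- x) *^ a = - (x *^ a).
Proof. exact: scalerN. Qed.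

Lemma ractBa M (x : M) (a b : A) : x *^ (a - b) = x *^ a - x *^ b.
Proof. exact: scalerBl. Qed.

Lemma ract_suml M (J : Type) (r : seq J) (P : pred J) (F : J -> M) (a : A) :
  (\sum_(j <- r | P j) F j) *^ a = \sum_(j <- r | P j) F j *^ a.
Proof. exact: scaler_sumr. Qed.

Lemma ract_sumr M (J : Type) (r : seq J) (P : pred J) (F : J -> A) (x : M) :
  x *^ (\sum_(j <- r | P j) F j) = \sum_(j <- r | P j) x *^ F j.
Proof. exact: scaler_suml. Qed.

Lemma ghomM M N (f : grhom M N) x (a : A) : f (x *^ a) = f x *^ a.
Proof. exact: linearZ. Qed.

Lemma ghom_pr M N (f : grhom M N) n x : f (pr n x) = pr n (f x).
Proof.
elim/mgr_ind: x => [|m x y Hx IH]; first by rewrite pr0 linear0 pr0.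
rewrite prD !linearD IH prD; congr (_ + _).
case: (eqVneq n m) => [->|nm]; first by rewrite !pr_id //; exact: gfunP.
by rewrite (pr_other Hx nm) linear0 (pr_other (gfunP f Hx) nm).
Qed.

Lemma pr_act M n i (x : M) (a : A) : agr A i a ->
  pr (n + i%:Z) (x *^ a) = pr n x *^ a.
Proof.
move=> Ha; elim/mgr_ind: x => [|m x y Hx IH]; first by rewrite ract0 !pr0 ract0.
rewrite ractD !prD ractD IH; congr (_ + _).
case: (eqVneq n m) => [->|nm]; first by rewrite !pr_id //; exact: mgr_act.
rewrite (pr_other Hx nm) ract0 (pr_other (mgr_act Hx Ha)) //.
by apply: contra nm => /eqP /addIr ->.
Qed.

Lemma mgr_actz M n m (x : M) (a : A) : mgr M n x -> agrz m a -> mgr M (n + m) (x *^ a).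
Proof. by case: m => [i|i] Hx Ha; [exact: mgr_act|rewrite Ha ractx0; exact: mgr0]. Qed.

Definition mklin M N (f : M -> N) (_ : linear f) := f.
HB.instance Definition _ M N (f : M -> N) (Hf : linear f) :=
  GRing.isLinear.Build _ _ _ _ (mklin Hf) Hf.

Definition mkhom M N (f : M -> N) (Hf : linear f)
    (Hg : forall n m, mgr M n m -> mgr N n (f m)) : grhom M N :=
  @GrHom k A M N (mklin Hf) Hg.

Lemma inj_mgr M N (f : grhom M N) n x : injective f -> mgr N n (f x) -> mgr M n x.
Proof.
move=> fi Hx; have -> : x = pr n x by apply: fi; rewrite ghom_pr pr_id.
exact: mgr_pr.
Qed.

Lemma surj_mgr M N (f : grhom M N) n y : (exists x, f x = y) -> mgr N n y ->
  exists x, mgr M n x /\ f x = y.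
Proof.
move=> [x Hx] Hy; exists (pr n x); split; first exact: mgr_pr.
by rewrite ghom_pr Hx pr_id.
Qed.

Lemma ghom_inj M N (f : grhom M N) : (forall x, f x = 0 -> x = 0) -> injective f.
Proof.
move=> f0 x y fxy; apply/eqP; rewrite -subr_eq0; apply/eqP/f0.
by rewrite linearB fxy subrr.
Qed.

Lemma ghom_inj_hom M N (f : grhom M N) :
  (forall n x, mgr M n x -> f x = 0 -> x = 0) -> injective f.
Proof.
move=> H; apply: ghom_inj => x fx; apply: pr_eq0 => n; apply: (H n); first exact: mgr_pr.
by rewrite ghom_pr fx pr0.
Qed.

Lemma ghom_surj_hom M N (f : grhom M N) :
  (forall n y, mgr N n y -> exists x, f x = y) -> forall y, exists x, f x = y.
Proof.
move=> H; elim/mgr_ind => [|n y z Hy [x Hx]]; first by exists 0; rewrite linear0.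
by have [u Hu] := H n y Hy; exists (u + x); rewrite linearD Hu Hx.
Qed.

Lemma ghom_eq_hom M N (f g : grhom M N) :
  (forall n x, mgr M n x -> f x = g x) -> f =1 g.
Proof.
move=> H; elim/mgr_ind => [|n x y Hx IH]; first by rewrite !linear0.
by rewrite !linearD IH (H n x Hx).
Qed.

Lemma lift_through_inj T M N (i : grhom M N) (g : grhom T N) :
  injective i -> (forall t, exists x, i x = g t) -> exists u : grhom T M, i \o u =1 g.
Proof.
move=> ii H; have [u Hu] := choice H.
have Lu : linear u by move=> a x y; apply: ii; rewrite linearP !Hu linearP.
exists (@mkhom _ _ _ Lu (fun n m Hm => inj_mgr ii
  (eq_ind_r (mgr N n) (gfunP g Hm) (Hu m)))).
exact: Hu.
Qed.

Lemma desc_through_surj M N T (p : grhom M N) (g : grhom M T) :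
  (forall y, exists x, p x = y) -> (forall x, p x = 0 -> g x = 0) ->
  exists u : grhom N T, u \o p =1 g.
Proof.
move=> ps H; have [r Hr] := choice ps.
have e x y : p x = p y -> g x = g y.
  move=> pxy; apply/eqP; rewrite -subr_eq0 -linearB; apply/eqP/H.
  by rewrite linearB pxy subrr.
pose u y := g (r y).
have Lu : linear u.
  by move=> a x y; rewrite /u -linearP; apply: e; rewrite linearP !Hr.
have Gu n y : mgr N n y -> mgr T n (u y).
  move=> Hy; have [x [Hx xy]] := surj_mgr (ps y) Hy.
  by rewrite /u (e (r y) x) ?Hr //; exact: gfunP.
exists (mkhom Lu Gu) => x; exact/e/Hr.
Qed.

Record gsubm M := GSubm {
  gsm :> M -> Prop;
  gsm0 : gsm 0;
  gsmD : forall x y, gsm x -> gsm y -> gsm (x + y);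
  gsmM : forall x (a : A), gsm x -> gsm (x *^ a);
  gsm_pr : forall n x, gsm x -> gsm (pr n x)
}.

Lemma gsmN M (S : gsubm M) x : S x -> S (- x).
Proof. by move=> Hx; rewrite -scaleN1r; exact: gsmM Hx. Qed.

Lemma gsmB M (S : gsubm M) x y : S x -> S y -> S (x - y).
Proof. by move=> Hx /gsmN; exact: gsmD. Qed.

Section Sub.
Variables (M : grmod A) (S : gsubm M).

Definition gsm_pred : {pred M} := fun x => `[< S x >].

Lemma gsm_submod_closed : submod_closed gsm_pred.
Proof.
split=> [|a x y]; rewrite !unfold_in; first exact/asboolP/gsm0.
move=> /asboolP Hx /asboolP Hy; apply/asboolP/gsmD => //; exact: gsmM Hx.
Qed.

HB.instance Definition _ := GRing.isSubmodClosed.Build _ _ gsm_pred gsm_submod_closed.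

Record gsub_type := GSubType { gsv : M; gsv_in : gsv \in gsm_pred }.
HB.instance Definition _ := [isSub for gsv].
HB.instance Definition _ := [Choice of gsub_type by <:].
HB.instance Definition _ := [SubChoice_isSubLmodule of gsub_type by <:].

Lemma gsvP (x : gsub_type) : S (gsv x).
Proof. by apply/asboolP; exact: gsv_in. Qed.

Definition gsub_mk x (Hx : S x) : gsub_type := GSubType (introT (asboolP _) Hx).

Definition gsub_gr n (x : gsub_type) : Prop := mgr M n (gsv x).

Lemma gsub_direct : direct_sum gsub_gr.
Proof.
split=> [n|x|s c us Hc sc n sn].
- split=> [|x y Hx Hy]; first exact: mgr0.
  by rewrite /gsub_gr [gsv _](raddfB (GRing.Additive.clone _ _ (val : gsub_type -> M) _));
     exact: mgrB.
- have [s [us s0 xs]] := pr_fin (gsv x).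
  exists s, (fun n => gsub_mk (gsm_pr n (gsvP x))); split=> [n|]; first exact: mgr_pr.
  by apply: val_inj; rewrite raddf_sum; exact: xs.
- have [_ _ H] := mgr_direct M; apply: val_inj.
  apply: (H s (fun n => gsv (c n)) us Hc _ n sn).
  by rewrite -[RHS](raddf0 (val : gsub_type -> M)) -sc raddf_sum.
Qed.

Lemma gsub_act n i (a : A) (m : gsub_type) : gsub_gr n m -> agr A i a ->
  gsub_gr (n + i%:Z) ((a : A^c) *: m).
Proof. by move=> Hm Ha; exact: mgr_act. Qed.

Definition gsub : grmod A := MkGrMod gsub_direct gsub_act.

Lemma gsub_inc_linear : linear (fun x : gsub => gsv x).
Proof. by move=> a x y. Qed.

Definition gsub_inc : grhom gsub M := mkhom gsub_inc_linear (fun n m Hm => Hm).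

Lemma gsub_inc_inj : injective gsub_inc.
Proof. exact: val_inj. Qed.

Lemma gsub_inc_in x : S (gsub_inc x).
Proof. exact: gsvP. Qed.

Lemma gsub_inc_ex x : S x -> exists y, gsub_inc y = x.
Proof. by move=> Hx; exists (gsub_mk Hx). Qed.

Lemma gsub_factor T (f : grhom T M) : (forall t, S (f t)) ->
  exists u : grhom T gsub, gsub_inc \o u =1 f.
Proof.
by move=> H; apply: lift_through_inj gsub_inc_inj _ => t; exact: gsub_inc_ex.
Qed.

End Sub.

Section Quotient.
Variables (M : grmod A) (S : gsubm M).

Definition qcanon (x : M) : M := choose (fun y => `[< S (x - y) >]) x.

Lemma qcanonP x : S (x - qcanon x).
Proof.
apply/asboolP; apply: (@chooseP _ (fun y => `[< S (x - y) >])).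
by apply/asboolP; rewrite subrr; exact: gsm0.
Qed.

Lemma qcanon_eq x y : S (x - y) -> qcanon x = qcanon y.
Proof.
move=> Sxy; rewrite /qcanon.
have e : (fun z => `[< S (x - z) >]) =1 (fun z => `[< S (y - z) >]).
  move=> z; apply/asbool_equiv_eq; split=> H.
    have -> : y - z = (x - z) - (x - y) by rewrite opprB [RHS]addrC addrA subrK.
    exact: gsmB.
  have -> : x - z = (x - y) + (y - z) by rewrite addrA subrK.
  exact: gsmD.
rewrite (eq_choose e); apply: choose_id; apply/asboolP.
  by rewrite -opprB; exact: gsmN.
by rewrite subrr; exact: gsm0.
Qed.

Record gquo_type := GQuo { qrep : M; qrepP : qcanon qrep == qrep }.
HB.instance Definition _ := [isSub for qrep].
HB.instance Definition _ := [Choice of gquo_type by <:].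

Lemma qcanonK x : qcanon (qcanon x) == qcanon x.
Proof. by apply/eqP/qcanon_eq; rewrite -opprB; exact/gsmN/qcanonP. Qed.

Definition qpi (x : M) : gquo_type := GQuo (qcanonK x).

Lemma qpi_eq x y : S (x - y) -> qpi x = qpi y.
Proof. by move=> H; apply: val_inj; exact: qcanon_eq. Qed.

Lemma qrepK q : qpi (qrep q) = q.
Proof. by apply: val_inj; exact/eqP/qrepP. Qed.

Lemma qpiK x : S (x - qrep (qpi x)).
Proof. exact: qcanonP. Qed.

Lemma qpi_eqP x y : qpi x = qpi y -> S (x - y).
Proof.
move=> e; have -> : x - y = (x - qrep (qpi x)) - (y - qrep (qpi y)).
  by rewrite e opprB addrA subrK.
by apply: gsmB; exact: qpiK.
Qed.

Definition qadd (p q : gquo_type) := qpi (qrep p + qrep q).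
Definition qopp (p : gquo_type) := qpi (- qrep p).
Definition qact (a : A^c) (p : gquo_type) := qpi (a *: qrep p).

Lemma qaddE x y : qadd (qpi x) (qpi y) = qpi (x + y).
Proof.
apply: qpi_eq; rewrite opprD addrACA.
by apply: gsmD; rewrite -opprB; apply: gsmN; exact: qpiK.
Qed.

Lemma qoppE x : qopp (qpi x) = qpi (- x).
Proof. by apply: qpi_eq; rewrite opprK addrC; exact: qpiK. Qed.

Lemma qactE a x : qact a (qpi x) = qpi (a *: x).
Proof.
apply: qpi_eq; rewrite -scalerBr; apply: (gsmM (a : A)).
by rewrite -opprB; exact/gsmN/qpiK.
Qed.

Lemma qaddA : associative qadd.
Proof. by move=> p q r; rewrite -(qrepK p) -(qrepK q) -(qrepK r) !qaddE addrA. Qed.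
Lemma qaddC : commutative qadd.
Proof. by move=> p q; rewrite -(qrepK p) -(qrepK q) !qaddE addrC. Qed.
Lemma qadd0 : left_id (qpi 0) qadd.
Proof. by move=> p; rewrite -(qrepK p) !qaddE add0r. Qed.
Lemma qaddN : left_inverse (qpi 0) qopp qadd.
Proof. by move=> p; rewrite -(qrepK p) qoppE !qaddE addNr. Qed.

HB.instance Definition _ := GRing.isZmodule.Build gquo_type qaddA qaddC qadd0 qaddN.

Lemma qactA (a b : A^c) (p : gquo_type) : qact a (qact b p) = qact (a * b) p.
Proof. by rewrite -(qrepK p) !qactE scalerA. Qed.
Lemma qact1 : left_id 1 qact.
Proof. by move=> p; rewrite -(qrepK p) qactE scale1r. Qed.
Lemma qactDr : right_distributive qact +%R.
Proof.
by move=> a p q; rewrite -(qrepK p) -(qrepK q) [_ + _]qaddE !qactE [RHS]qaddE scalerDr.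
Qed.
Lemma qactDl v : {morph qact^~ v : a b / a + b}.
Proof. by move=> a b; rewrite -(qrepK v) !qactE [RHS]qaddE scalerDl. Qed.

HB.instance Definition _ := GRing.Zmodule_isLmodule.Build A^c gquo_type
  qactA qact1 qactDr qactDl.

Lemma qpi_linear : linear qpi.
Proof.
move=> a x y; change (qpi (a *: x + y) = qadd (qact a (qpi x)) (qpi y)).
by rewrite qactE qaddE.
Qed.

HB.instance Definition _ := GRing.isLinear.Build _ _ _ _ qpi qpi_linear.

Definition gquo_gr n (q : gquo_type) : Prop := exists x, mgr M n x /\ qpi x = q.

Lemma gquo_direct : direct_sum gquo_gr.
Proof.
split=> [n|q|s c us Hc sc n sn].
- split=> [|_ _ [x [Hx <-]] [y [Hy <-]]].
    by exists 0; split; [exact: mgr0|rewrite linear0].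
  by exists (x - y); split; [exact: mgrB|rewrite linearB].
- have [s [us s0 xs]] := pr_fin (qrep q).
  exists s, (fun n => qpi (pr n (qrep q))); split=> [n|].
    by exists (pr n (qrep q)); split=> //; exact: mgr_pr.
  by rewrite -{1}(qrepK q) {1}xs linear_sum.
- have [f Hf] := choice Hc.
  have Sf : S (\sum_(i <- s) f i).
    have -> : \sum_(i <- s) f i = \sum_(i <- s) f i - 0 by rewrite subr0.
    apply: qpi_eqP; rewrite linear0 linear_sum -[RHS]sc.
    by apply: eq_bigr => i _; case: (Hf i).
  have [Hfn <-] := Hf n; rewrite -(linear0 qpi); apply: qpi_eq; rewrite subr0.
  have := gsm_pr n Sf; rewrite pr_sum (bigD1_seq n) //= big1 ?addr0 ?pr_id // => m mn.
  by have [Hfm _] := Hf m; rewrite (pr_other Hfm) // eq_sym.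
Qed.

Lemma gquo_act n i (a : A) (m : gquo_type) : gquo_gr n m -> agr A i a ->
  gquo_gr (n + i%:Z) ((a : A^c) *: m).
Proof.
move=> [x [Hx <-]] Ha; exists ((a : A^c) *: x); split; first exact: mgr_act.
by rewrite linearZ.
Qed.

Definition gquo : grmod A := MkGrMod gquo_direct gquo_act.

Definition gquo_pi : grhom M gquo :=
  @GrHom k A M gquo qpi (fun n m Hm => ex_intro _ m (conj Hm erefl)).

Lemma gquo_surj (y : gquo) : exists x, gquo_pi x = y.
Proof. by exists (qrep y); exact: qrepK. Qed.

Lemma gquo_eq0 x : gquo_pi x = 0 <-> S x.
Proof.
split=> [e|Sx].
  by rewrite -(subr0 x); apply: qpi_eqP; rewrite linear0.
by rewrite -(linear0 gquo_pi); apply: qpi_eq; rewrite subr0.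
Qed.

End Quotient.

Section Product.
Variables (M N : grmod A).

Definition gprod_gr n (x : (M * N)%type) : Prop := mgr M n x.1 /\ mgr N n x.2.

Lemma sum_pair (J : Type) (r : seq J) (F : J -> (M * N)%type) :
  \sum_(j <- r) F j = (\sum_(j <- r) (F j).1, \sum_(j <- r) (F j).2).
Proof.
by elim: r => [|j r IH]; rewrite ?big_nil // !big_cons IH.
Qed.

Lemma gprod_direct : direct_sum (V := (M * N)%type) gprod_gr.
Proof.
split=> [n|[x y]|s c us Hc sc n sn].
- split=> [|[x y] [x' y'] [Hx Hy] [Hx' Hy']]; first by split; exact: mgr0.
  by split; exact: mgrB.
- have [s [us s0 xs]] := pr_fin x; have [t [ut t0 yt]] := pr_fin y.
  exists (undup (s ++ t)), (fun n => (pr n x, pr n y)); split=> [n|].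
    by split; exact: mgr_pr.
  rewrite sum_pair /=; congr pair; [rewrite {1}xs|rewrite {1}yt]; apply/esym/big_uniq_supp;
    rewrite ?undup_uniq // => i; rewrite mem_undup mem_cat => -> //.
  by rewrite orbT.
- rewrite sum_pair in sc; case: sc => sc1 sc2.
  have [_ _ H] := mgr_direct M; have [_ _ H'] := mgr_direct N.
  have e1 := H s (fun n => (c n).1) us (fun n => proj1 (Hc n)) sc1 n sn.
  have e2 := H' s (fun n => (c n).2) us (fun n => proj2 (Hc n)) sc2 n sn.
  by rewrite [c n]surjective_pairing e1 e2.
Qed.

Lemma gprod_act n i (a : A) (m : (M * N)%type) : gprod_gr n m -> agr A i a ->
  gprod_gr (n + i%:Z) ((a : A^c) *: m).
Proof. by move=> [H1 H2] Ha; split; exact: mgr_act. Qed.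

Definition gprod : grmod A := MkGrMod gprod_direct gprod_act.

Lemma gprod_inl_linear : linear (fun x : M => (x, 0) : gprod).
Proof. by move=> a x y; congr pair; rewrite /= scaler0 addr0. Qed.
Lemma gprod_inr_linear : linear (fun y : N => (0, y) : gprod).
Proof. by move=> a x y; congr pair; rewrite /= scaler0 addr0. Qed.
Lemma gprod_fst_linear : linear (fun x : gprod => x.1).
Proof. by move=> a x y. Qed.
Lemma gprod_snd_linear : linear (fun x : gprod => x.2).
Proof. by move=> a x y. Qed.

Definition ginl : grhom M gprod :=
  mkhom gprod_inl_linear (fun n m Hm => conj Hm (mgr0 N n)).
Definition ginr : grhom N gprod :=
  mkhom gprod_inr_linear (fun n m Hm => conj (mgr0 M n) Hm).
Definition gfst : grhom gprod M := mkhom gprod_fst_linear (fun n m Hm => proj1 Hm).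
Definition gsnd : grhom gprod N := mkhom gprod_snd_linear (fun n m Hm => proj2 Hm).

Lemma gprodE (x : gprod) : x = ginl x.1 + ginr x.2.
Proof. by case: x => x y; congr pair; rewrite /= ?addr0 ?add0r. Qed.

Lemma gprod_copair T (f : grhom M T) (g : grhom N T) :
  exists u : grhom gprod T, forall x, u x = f x.1 + g x.2.
Proof.
exists (gadd (gcomp f gfst) (gcomp g gsnd)); by [].
Qed.

End Product.

End GradedConstructions.

(** * Coherence *)

Section Families.
Variables (k : fieldType) (A : gralg k).
Implicit Types (M N : grmod A).

Lemma agrz0 n : agrz n (0 : A).
Proof. exact: (@mgr0 _ _ (regmod A) n). Qed.

Lemma agrzM m n (a b : A) : agrz m a -> agrz n b -> agrz (m + n) (a * b).
Proof. by move=> Ha Hb; exact: (@mgr_actz _ _ (regmod A) m n (a : regmod A) b Ha Hb). Qed.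

Lemma agrz_sum n (J : Type) (r : seq J) (P : pred J) (F : J -> A) :
  (forall j, P j -> agrz n (F j)) -> agrz n (\sum_(j <- r | P j) F j).
Proof. exact: (@mgr_sum _ _ (regmod A)). Qed.

Lemma agrz_neg n (a : A) : n < 0 -> agrz n a -> a = 0.
Proof. by case: n. Qed.

Definition homog_coef (n : int) (a : A) : A := pr (M := regmod A) n a.

Lemma homog_coefP n a : agrz n (homog_coef n a).
Proof. exact: (@mgr_pr _ _ (regmod A)). Qed.

Lemma pr_homog_act M e (g : M) n (a : A) : mgr M e g ->
  pr n (g *^ a) = g *^ homog_coef (n - e) a.
Proof.
move=> Hg; elim/(@mgr_ind _ _ (regmod A)): a => [|m x y Hx IH].
  by rewrite /homog_coef ractx0 !pr0 ractx0.
rewrite ractDa prD /homog_coef prD [RHS]ractDa; congr (_ + _); last exact: IH.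
have [->|nm] := eqVneq n (e + m).
  rewrite (addrC e) addrK pr_id; last by rewrite addrC; exact: mgr_actz.
  by rewrite (pr_id Hx).
rewrite (pr_other (mgr_actz Hg Hx) nm) (pr_other Hx) ?ractx0 //.
by apply: contra nm => /eqP <-; rewrite addrC subrK.
Qed.

Section Family.
Variables (M : grmod A) (I : finType) (e : I -> int) (g : I -> M).

Definition homog : Prop := forall i, mgr M (e i) (g i).

Definition gspan (x : M) : Prop := exists a : I -> A, x = \sum_i g i *^ a i.

Definition generates : Prop := forall x, gspan x.

Lemma homog_coeffs n x : homog -> mgr M n x -> gspan x ->
  exists a : I -> A, (forall i, agrz (n - e i) (a i)) /\ x = \sum_i g i *^ a i.
Proof.
move=> Hg Hx [a xa]; exists (fun i => homog_coef (n - e i) (a i)); split.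
  by move=> i; exact: homog_coefP.
rewrite -(pr_id Hx) xa pr_sum; apply: eq_bigr => i _; exact: pr_homog_act.
Qed.

Lemma gspan0 : gspan 0.
Proof. by exists (fun=> 0); rewrite big1 // => i _; exact: ractx0. Qed.

Lemma gspanD x y : gspan x -> gspan y -> gspan (x + y).
Proof.
move=> [a ->] [b ->]; exists (fun i => a i + b i); rewrite -big_split /=.
by apply: eq_bigr => i _; rewrite ractDa.
Qed.

Lemma gspanM x (a : A) : gspan x -> gspan (x *^ a).
Proof.
move=> [b ->]; exists (fun i => b i * a); rewrite ract_suml.
by apply: eq_bigr => i _; rewrite ractM.
Qed.

Lemma gspan_in i : gspan (g i).
Proof.
exists (fun j => if j == i then 1 else 0); rewrite (bigD1 i) //= eqxx ract1.
by rewrite big1 ?addr0 // => j /negbTE ->; exact: ractx0.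
Qed.

Lemma gspan_sum (J : Type) (r : seq J) (P : pred J) (F : J -> M) :
  (forall j, P j -> gspan (F j)) -> gspan (\sum_(j <- r | P j) F j).
Proof. by move=> H; elim/big_rec: _ => [|j x Pj]; [exact: gspan0|apply: gspanD; exact: H]. Qed.

Lemma gspan_pr n x : homog -> gspan x -> gspan (pr n x).
Proof.
move=> Hg [a ->]; rewrite pr_sum; apply: gspan_sum => i _.
rewrite (pr_homog_act n (a i) (Hg i)); exact/gspanM/gspan_in.
Qed.

Definition gspan_sub (Hg : homog) : gsubm M :=
  GSubm gspan0 gspanD gspanM (fun n x => @gspan_pr n x Hg).

Lemma generates_homog : (forall n x, mgr M n x -> gspan x) -> generates.
Proof.
move=> H; elim/mgr_ind => [|n x y Hx IH]; first exact: gspan0.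
by apply: gspanD IH; exact: H Hx.
Qed.

Definition rel_fg : Prop := exists (J : finType) (t : J -> int) (r : J -> I -> A),
  (forall j i, agrz (t j - e i) (r j i)) /\
  forall a : I -> A, \sum_i g i *^ a i = 0 <->
    exists b : J -> A, forall i, a i = \sum_j r j i * b j.

End Family.

Definition fin_gen M : Prop := exists (I : finType) (e : I -> int) (g : I -> M),
  homog e g /\ generates g.

Definition gcoh M : Prop := forall (I : finType) (e : I -> int) (g : I -> M),
  homog e g -> rel_fg e g.

Lemma reindex_enum (V : zmodType) (I : finType) (F : I -> V) :
  \sum_i F i = \sum_(j < #|I|) F (enum_val j).
Proof.
rewrite (reindex (@enum_val I predT)) //=.
by exists enum_rank => i _; rewrite ?enum_rankK ?enum_valK.
Qed.

Lemma fin_presP M : fin_gen M -> gcoh M -> fin_pres M.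
Proof.
move=> [I [e [g [Hg Gg]]]] CM; pose g' (j : 'I_#|I|) := g (enum_val j).
pose e' (j : 'I_#|I|) := e (enum_val j).
have Hg' : homog e' g' by move=> j; exact: Hg.
have [J [t [r [Hr Hrel]]]] := CM _ e' g' Hg'.
exists #|I|, e', g'; split=> // [m|].
  split=> // _; have [a ->] := Gg m; exists (fun j => a (enum_val j)).
  exact: reindex_enum.
exists #|J|, (fun j => t (enum_val j)), (fun j => r (enum_val j)); split=> // a.
rewrite Hrel; split=> -[b Hb].
  by exists (fun j => b (enum_val j)) => i; rewrite Hb reindex_enum.
exists (fun j => b (enum_rank j)) => i; rewrite Hb [RHS]reindex_enum.
by apply: eq_bigr => j _; rewrite enum_valK.
Qed.

Lemma fin_pres_fin_gen M : fin_pres M -> fin_gen M.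
Proof.
move=> [n [e [g [Hg Gg _]]]]; exists 'I_n, e, g; split=> // x.
by have [/(_ Logic.I)] := Gg x.
Qed.

Lemma gcoh_inj M N (i : grhom M N) : injective i -> gcoh N -> gcoh M.
Proof.
move=> ii CN I e g Hg.
have [|J [t [r [Hr Hrel]]]] := CN I e (fun j => i (g j)).
  by move=> j; exact: gfunP.
exists J, t, r; split=> // a.
have e1 : \sum_j i (g j) *^ a j = i (\sum_j g j *^ a j).
  by rewrite linear_sum; apply: eq_bigr => j _; rewrite ghomM.
rewrite -Hrel e1; split=> [->|e0]; first exact: linear0.
by apply: ii; rewrite e0 linear0.
Qed.

Lemma gcoh_ext M' M M'' (i : grhom M' M) (f : grhom M M'') :
  injective i -> (forall x, f x = 0 -> exists y, i y = x) ->
  gcoh M' -> gcoh M'' -> gcoh M.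
Proof.
move=> ii ex CM' CM'' I e g Hg.
have [|J [t [r [Hr Hrel]]]] := CM'' I e (fun j => f (g j)).
  by move=> j; exact: gfunP.
pose y j := \sum_i g i *^ r j i.
have Hy j : mgr M (t j) (y j).
  apply: mgr_sum => u _; have := mgr_actz (Hg u) (Hr j u).
  by rewrite addrC subrK.
have fsum (a : I -> A) : \sum_i f (g i) *^ a i = f (\sum_i g i *^ a i).
  by rewrite linear_sum; apply: eq_bigr => u _; rewrite ghomM.
have fy j : f (y j) = 0.
  rewrite -fsum; apply/Hrel; exists (fun l => if l == j then 1 else 0) => u.
  rewrite (bigD1 j) //= eqxx mulr1 big1 ?addr0 // => l /negbTE ->.
  by rewrite mulr0.
have Hz j : exists z, mgr M' (t j) z /\ i z = y j.
  exact/surj_mgr/Hy/ex/fy.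
have {Hz} [z Hz] := choice Hz.
have [|L [u [s [Hs Hsrel]]]] := CM' J t z; first by move=> j; have [] := Hz j.
have ysum (b : J -> A) : i (\sum_j z j *^ b j) =
    \sum_i g i *^ (\sum_j r j i * b j).
  rewrite linear_sum.
  transitivity (\sum_j \sum_i g i *^ (r j i * b j)).
    apply: eq_bigr => j _; rewrite ghomM; have [_ ->] := Hz j.
    by rewrite ract_suml; apply: eq_bigr => l _; rewrite ractM.
  rewrite exchange_big /=; apply: eq_bigr => l _.
  by rewrite ract_sumr.
exists L, u, (fun l i => \sum_j r j i * s l j); split=> [l j|a].
  apply: agrz_sum => v _; have := agrzM (Hr v j) (Hs l v).
  by rewrite addrC addrA subrK.
have comb (c : L -> A) i0 : \sum_l (\sum_j r j i0 * s l j) * c l =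
    \sum_j r j i0 * \sum_l s l j * c l.
  transitivity (\sum_l \sum_j r j i0 * (s l j * c l)).
    by apply: eq_bigr => l _; rewrite mulr_suml; apply: eq_bigr => j _; rewrite mulrA.
  by rewrite exchange_big /=; apply: eq_bigr => j _; rewrite mulr_sumr.
split=> [a0|[c Hc]].
  have /Hrel [b Hb] : \sum_i f (g i) *^ a i = 0 by rewrite fsum a0 linear0.
  have /Hsrel [c Hc] : \sum_j z j *^ b j = 0.
    apply: ii; rewrite ysum linear0 -[RHS]a0.
    by apply: eq_bigr => l _; rewrite Hb.
  by exists c => l; rewrite Hb comb; apply: eq_bigr => j _; rewrite Hc.
pose b j := \sum_l s l j * c l.
have /Hsrel /(congr1 i) : exists c, forall j, b j = \sum_l s l j * c l by exists c.
rewrite ysum linear0 => e0; rewrite -[RHS]e0; apply: eq_bigr => l _.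
by rewrite Hc comb.
Qed.

Lemma gcoh_quot M N (p : grhom M N) (J : finType) (t : J -> int) (y : J -> M) :
  (forall x, exists m, p m = x) -> homog t y ->
  (forall x, p x = 0 <-> gspan y x) -> gcoh M -> gcoh N.
Proof.
move=> ps Hy Ky CM I e g Hg.
have Hl i : exists m, mgr M (e i) m /\ p m = g i by exact/surj_mgr/Hg/ps.
have {Hl} [l Hl] := choice Hl.
pose G (v : I + J) := match v with inl i => l i | inr j => y j end.
pose E (v : I + J) := match v with inl i => e i | inr j => t j end.
have HG : homog E G by case=> [i|j] /=; [have [] := Hl i|exact: Hy].
have [L [u [s [Hs Hsrel]]]] := CM _ E G HG.
exists L, u, (fun l i => s l (inl i)); split=> [v i|a]; first exact: (Hs v (inl i)).
have psum : \sum_i g i *^ a i = p (\sum_i l i *^ a i).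
  by rewrite linear_sum; apply: eq_bigr => i _; rewrite ghomM; have [_ ->] := Hl i.
split=> [a0|[c Hc]].
  have /Ky [b Hb] : p (\sum_i l i *^ a i) = 0 by rewrite -psum.
  pose a' (v : I + J) := match v with inl i => a i | inr j => - b j end.
  have /Hsrel [c Hc] : \sum_v G v *^ a' v = 0.
    rewrite big_sumType /= Hb.
    have -> : \sum_j y j *^ - b j = - \sum_j y j *^ b j.
      by rewrite -sumrN; apply: eq_bigr => j _; exact: scaleNr.
    by rewrite subrr.
  by exists c => i; exact: (Hc (inl i)).
pose a' v := \sum_l s l v * c l.
have : \sum_v G v *^ a' v = 0 by apply/Hsrel; exists c.
rewrite big_sumType /= => /(congr1 p); rewrite linear0 linearD.
have -> : p (\sum_j y j *^ a' (inr j)) = 0 by apply/Ky; exists (fun j => a' (inr j)).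
rewrite addr0 psum => e0; rewrite -[RHS]e0; congr (p _).
by apply: eq_bigr => i _; rewrite Hc.
Qed.

Lemma kernel_fin_gen M N (f : grhom M N) : fin_gen M -> gcoh N ->
  exists (J : finType) (t : J -> int) (y : J -> M), homog t y /\
    forall x, f x = 0 <-> gspan y x.
Proof.
move=> [I [e [g [Hg Gg]]]] CN.
have [|J [t [r [Hr Hrel]]]] := CN I e (fun j => f (g j)).
  by move=> j; exact: gfunP.
have fsum (a : I -> A) : \sum_i f (g i) *^ a i = f (\sum_i g i *^ a i).
  by rewrite linear_sum; apply: eq_bigr => u _; rewrite ghomM.
have ysum (b : J -> A) : \sum_j (\sum_i g i *^ r j i) *^ b j =
    \sum_i g i *^ (\sum_j r j i * b j).
  transitivity (\sum_j \sum_i g i *^ (r j i * b j)).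
    apply: eq_bigr => j _.
    by rewrite ract_suml; apply: eq_bigr => l _; rewrite ractM.
  rewrite exchange_big /=; apply: eq_bigr => l _.
  by rewrite ract_sumr.
exists J, t, (fun j => \sum_i g i *^ r j i); split=> [j|x].
  apply: mgr_sum => u _; have := mgr_actz (Hg u) (Hr j u).
  by rewrite addrC subrK.
split=> [fx|[b ->]].
  have [a xa] := Gg x; rewrite xa -fsum in fx; have [b Hb] := proj1 (Hrel a) fx.
  by exists b; rewrite ysum xa; apply: eq_bigr => i _; rewrite Hb.
by rewrite ysum -fsum; apply/Hrel; exists b.
Qed.

Lemma fin_gen_surj M N (f : grhom M N) : (forall y, exists x, f x = y) ->
  fin_gen M -> fin_gen N.
Proof.
move=> fs [I [e [g [Hg Gg]]]]; exists I, e, (fun i => f (g i)); split.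
  by move=> i; exact: gfunP.
move=> y; have [x <-] := fs y; have [a ->] := Gg x; exists a.
by rewrite linear_sum; apply: eq_bigr => i _; rewrite ghomM.
Qed.

Section Free.
Variables (I : finType) (e : I -> int).

Definition free_type : Type := {ffun I -> (A^c)^o}.
HB.instance Definition _ := GRing.Lmodule.on free_type.

Definition free_gr n (x : free_type) : Prop := forall i, agrz (n - e i) (x i).

Lemma free_direct : direct_sum free_gr.
Proof.
split=> [n|x|s c us Hc sc n sn].
- split=> [i|x y Hx Hy i]; first by rewrite ffunE; exact: agrz0.
  rewrite !ffunE; exact: (@mgrB _ _ (regmod A) _ _ _ (Hx i) (Hy i)).
- have Hs i := pr_fin (x i : regmod A); have [s {}Hs] := choice Hs.
  pose u := undup (flatten [seq [seq m + e i | m <- s i] | i <- enum I]).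
  exists u, (fun n => [ffun i => homog_coef (n - e i) (x i)] : free_type); split.
    by move=> n i; rewrite ffunE; exact: homog_coefP.
  apply/ffunP => i; rewrite sum_ffunE.
  have [us s0 {1}->] := Hs i.
  have -> : \sum_(n <- u) ([ffun i0 => homog_coef (n - e i0) (x i0)] : free_type) i =
      \sum_(n <- u) homog_coef (n - e i) (x i).
    by apply: eq_bigr => n _; rewrite ffunE.
  rewrite (@big_uniq_supp _ _ _ [seq m + e i | m <- s i] u) ?undup_uniq //.
  + by rewrite big_map; apply: eq_bigr => m _; rewrite addrK.
  + by rewrite map_inj_uniq //; exact: addIr.
  + move=> n Hn; rewrite mem_undup; apply/flattenP.
    by exists [seq m + e i | m <- s i] => //; apply: map_f; rewrite mem_enum.
  + move=> n Hn; apply: s0; apply: contra Hn => Hn; apply/mapP.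
    by exists (n - e i); rewrite ?subrK.
- apply/ffunP => i; rewrite [RHS]ffunE.
  have [_ _ H] := agrz_direct A.
  have := H [seq m - e i | m <- s] (fun m => c (m + e i) i) _ _ _ (n - e i).
  rewrite subrK; apply.
  + by rewrite map_inj_uniq //; exact: addIr.
  + by move=> m; have := Hc (m + e i) i; rewrite addrK.
  + have := congr1 (fun y : free_type => y i) sc.
    rewrite /= ffunE sum_ffunE => sci; rewrite big_map -[RHS]sci.
    by apply: eq_bigr => m _; rewrite subrK.
  + by apply/mapP; exists n.
Qed.

Lemma free_act n i (a : A) (m : free_type) : free_gr n m -> agr A i a ->
  free_gr (n + i%:Z) ((a : A^c) *: m).
Proof.
move=> Hm Ha j; rewrite ffunE addrAC.
exact: (@mgr_act _ _ (regmod A) _ i a (m j) (Hm j) Ha).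
Qed.

Definition free : grmod A := MkGrMod free_direct free_act.

Definition free_gen (i : I) : free := [ffun j => if j == i then 1 else 0] : free_type.

Lemma free_gen_homog : homog e free_gen.
Proof.
move=> i j; rewrite ffunE; case: eqP => [->|_]; last exact: agrz0.
by rewrite subrr; exact: agr1.
Qed.

Lemma free_actE (x : free) (a : A) i : (x *^ a : free_type) i = ((x : free_type) i : A) * a.
Proof. by rewrite ffunE. Qed.

Lemma free_sumE (J : Type) (r : seq J) (F : J -> free) i :
  (\sum_(j <- r) F j : free_type) i = \sum_(j <- r) (F j : free_type) i.
Proof. by rewrite sum_ffunE. Qed.

Lemma free_genE (x : free) : x = \sum_i free_gen i *^ ((x : free_type) i : A).
Proof.
apply/ffunP => i; rewrite free_sumE (bigD1 i) //= free_actE ffunE eqxx mul1r.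
by rewrite big1 ?addr0 // => j ji; rewrite free_actE ffunE eq_sym (negbTE ji) mul0r.
Qed.

Lemma free_generates : generates free_gen.
Proof. by move=> x; exists (fun i => (x : free_type) i); exact: free_genE. Qed.

Lemma free_hom M (g : I -> M) : homog e g ->
  exists f : grhom free M, forall x, f x = \sum_i g i *^ ((x : free_type) i : A).
Proof.
move=> Hg; pose f (x : free) := \sum_i g i *^ ((x : free_type) i : A).
have Lf : linear f.
  move=> a x y; rewrite /f scaler_sumr -big_split /=; apply: eq_bigr => i _.
  rewrite !ffunE; rewrite [LHS]ractDa; congr (_ + _).
  exact: (ractM (g i) (x i : A) (a : A)).
have Gf n x : mgr free n x -> mgr M n (f x).
  move=> Hx; apply: mgr_sum => i _; have := mgr_actz (Hg i) (Hx i).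
  by rewrite addrC subrK.
by exists (mkhom Lf Gf).
Qed.

Lemma free_hom_gen M (g : I -> M) : homog e g ->
  exists f : grhom free M, forall i, f (free_gen i) = g i.
Proof.
move=> /free_hom [f Hf]; exists f => i; rewrite Hf (bigD1 i) //= ffunE eqxx ract1.
by rewrite big1 ?addr0 // => j ji; rewrite ffunE (negbTE ji) ractx0.
Qed.

Lemma free_fin_gen : fin_gen free.
Proof. by exists I, e, free_gen; split; [exact: free_gen_homog|exact: free_generates]. Qed.

End Free.

Lemma generated_hom_eq M N (I : finType) (g : I -> M) (f f' : grhom M N) :
  generates g -> (forall i, f (g i) = f' (g i)) -> f =1 f'.
Proof.
move=> Gg H x; have [a ->] := Gg x; rewrite !linear_sum.
by apply: eq_bigr => i _; rewrite !ghomM H.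
Qed.

Definition eproj (P : grmod A) : Prop := forall M N (e : grhom M N) (f : grhom P N),
  (forall y, exists x, e x = y) -> exists g : grhom P M, e \o g =1 f.

Lemma eproj_free (I : finType) (e : I -> int) : eproj (free e).
Proof.
move=> M N p f ps.
have H i : exists x, mgr M (e i) x /\ p x = f (free_gen e i).
  exact/surj_mgr/gfunP/free_gen_homog/ps.
have [x Hx] := choice H.
have [|g Hg] := @free_hom_gen _ e M x; first by move=> i; have [] := Hx i.
exists g; suff : gcomp p g =1 f by [].
apply: (generated_hom_eq (@free_generates _ e)) => i /=.
by rewrite Hg; have [] := Hx i.
Qed.

Lemma eproj_prod P Q : eproj P -> eproj Q -> eproj (gprod P Q).
Proof.
move=> HP HQ M N p f ps.
have [g Hg] := HP _ _ p (gcomp f (ginl P Q)) ps.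
have [h Hh] := HQ _ _ p (gcomp f (ginr P Q)) ps.
have [u Hu] := gprod_copair g h; exists u => x /=.
by rewrite Hu linearD [p _]Hg [p (h _)]Hh /= -linearD -gprodE.
Qed.

Lemma gcoh_prod M N : gcoh M -> gcoh N -> gcoh (gprod M N).
Proof.
move=> CM CN; apply: (@gcoh_ext M _ N (ginl M N) (gsnd M N)) => //.
  by move=> x y [].
case=> x y y0; exists x; congr pair; exact: esym y0.
Qed.

Lemma fin_gen_prod M N : fin_gen M -> fin_gen N -> fin_gen (gprod M N).
Proof.
move=> [I [e [g [Hg Gg]]]] [J [t [h [Hh Gh]]]].
exists (I + J)%type, (fun v => match v with inl i => e i | inr j => t j end),
  (fun v => match v with inl i => ginl M N (g i) | inr j => ginr M N (h j) end).
split=> [[i|j]|x]; [exact: gfunP|exact: gfunP|].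
have [a Ha] := Gg x.1; have [b Hb] := Gh x.2.
exists (fun v => match v with inl i => a i | inr j => b j end).
rewrite big_sumType /= {1}(gprodE x) Ha Hb !linear_sum.
by congr (_ + _); apply: eq_bigr => i _; rewrite ghomM.
Qed.

End Families.

Lemma dep_choice (I : Type) (T : I -> Type) (P : forall i, T i -> Prop) :
  (forall i, exists x : T i, P i x) -> exists f : forall i, T i, forall i, P i (f i).
Proof. by move=> H; exists (fun i => sval (cid (H i))) => i; exact: svalP. Qed.

Section Finiteness.
Variables (k : fieldType) (A : gralg k).
Implicit Types (M N : grmod A).

Lemma ract_comb M (I J : finType) (g : I -> M) (r : J -> I -> A) (b : J -> A) :
  \sum_i g i *^ (\sum_j r j i * b j) = \sum_j (\sum_i g i *^ r j i) *^ b j.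
Proof.
transitivity (\sum_j \sum_i g i *^ (r j i * b j)).
  by rewrite exchange_big /=; apply: eq_bigr => l _; rewrite ract_sumr.
apply: eq_bigr => j _.
by rewrite ract_suml; apply: eq_bigr => l _; rewrite ractM.
Qed.

(* Schanuel's lemma for two systems of generators of the same submodule. *)
Lemma rel_fg_same_span M (I J : finType) e (g : I -> M) t (h : J -> M) :
  homog e g -> homog t h -> (forall x, gspan g x <-> gspan h x) ->
  rel_fg t h -> rel_fg e g.
Proof.
move=> Hg Hh gh [L [u [r [Hr Hrel]]]].
have Hu i : exists c : J -> A, (forall j, agrz (e i - t j) (c j)) /\
    g i = \sum_j h j *^ c j by exact/(homog_coeffs Hh (Hg i))/gh/gspan_in.
have Hv j : exists c : I -> A, (forall i, agrz (t j - e i) (c i)) /\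
    h j = \sum_i g i *^ c i by exact/(homog_coeffs Hg (Hh j))/gh/gspan_in.
have {Hu} [c Hc] := choice Hu; have {Hv} [v Hv] := choice Hv.
pose R (q : L + I) i : A := match q with
  | inl l => \sum_j v j i * r l j
  | inr i0 => (if i == i0 then 1 else 0) - \sum_j v j i * c i0 j end.
have hv (a : J -> A) : \sum_i g i *^ (\sum_j v j i * a j) = \sum_j h j *^ a j.
  by rewrite ract_comb; apply: eq_bigr => j _; have [_ <-] := Hv j.
have gR q : \sum_i g i *^ R q i = 0.
  case: q => [l|i0] /=.
    rewrite hv; apply/Hrel; exists (fun l' => if l' == l then 1 else 0) => j.
    rewrite (bigD1 l) //= eqxx mulr1 big1 ?addr0 // => l' /negbTE ->.
    by rewrite mulr0.
  transitivity (\sum_i (g i *^ (if i == i0 then 1 else 0 : A)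
      - g i *^ \sum_j v j i * c i0 j)).
    by apply: eq_bigr => i _; exact: ractBa.
  rewrite sumrB hv; have [_ <-] := Hc i0.
  rewrite (bigD1 i0) //= eqxx ract1 big1 ?addr0 ?subrr // => i /negbTE ->.
  exact: ractx0.
exists (L + I)%type, (fun q => match q with inl l => u l | inr i => e i end), R.
split=> [[l|i0] i /=|a].
- apply: agrz_sum => j _; have [Hvj _] := Hv j.
  by have := agrzM (Hvj i) (Hr l j); rewrite addrC addrA subrK.
- have H1 : agrz (e i0 - e i) (if i == i0 then 1 else 0 : A).
    by case: eqP => [->|_]; [rewrite subrr; exact: agr1|exact: agrz0].
  have H2 : agrz (e i0 - e i) (\sum_j v j i * c i0 j).
    apply: agrz_sum => j _; have [Hvj _] := Hv j; have [Hcj _] := Hc i0.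
    by have := agrzM (Hvj i) (Hcj j); rewrite addrC addrA subrK.
  exact: (@mgrB _ _ (regmod A) _ _ _ H1 H2).
split=> [a0|[b Hb]]; last first.
  rewrite (eq_bigr (fun i => g i *^ (\sum_q R q i * b q))); last by move=> i _; rewrite Hb.
  by rewrite ract_comb big1 // => q _; rewrite gR ract0.
pose w j : A := \sum_i c i j * a i.
have /Hrel [b Hb] : \sum_j h j *^ w j = 0.
  rewrite ract_comb -[RHS]a0; apply: eq_bigr => i _.
  by have [_ <-] := Hc i.
exists (fun q => match q with inl l => b l | inr i => a i end) => i.
rewrite big_sumType /=.
have -> : \sum_l (\sum_j v j i * r l j) * b l = \sum_j v j i * w j.
  transitivity (\sum_l \sum_j v j i * (r l j * b l)).
    by apply: eq_bigr => l _; rewrite mulr_suml; apply: eq_bigr => j _; rewrite mulrA.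
  by rewrite exchange_big /=; apply: eq_bigr => j _; rewrite Hb mulr_sumr.
have -> : \sum_i0 ((if i == i0 then 1 else 0) - \sum_j v j i * c i0 j) * a i0 =
    a i - \sum_j v j i * w j.
  transitivity (\sum_i0 ((if i == i0 then 1 else 0) * a i0
      - \sum_j v j i * (c i0 j * a i0))).
    apply: eq_bigr => i0 _; rewrite mulrBl mulr_suml; congr (_ - _).
    by apply: eq_bigr => j _; rewrite mulrA.
  rewrite sumrB; congr (_ - _).
    rewrite (bigD1 i) //= eqxx mul1r big1 ?addr0 // => i0.
    by rewrite eq_sym => /negbTE ->; rewrite mul0r.
  by rewrite exchange_big /=; apply: eq_bigr => j _; rewrite mulr_sumr.
by rewrite addrC subrK.
Qed.

Lemma gcoh_regmod : coherent A -> gcoh (regmod A).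
Proof.
move=> cohA I e g Hg.
have [n [t [h [Hh Gh [p [u [r Hr]]]]]]] :=
  cohA #|I| (fun j => e (enum_val j)) (fun j => g (enum_val j)) (fun j => Hg _).
apply: (rel_fg_same_span Hg Hh); last by exists 'I_p, u, r.
move=> x; split=> [[a ->]|[a ->]].
  by apply/Gh; exists (fun j => a (enum_val j)); exact: reindex_enum.
have /Gh [b ->] : span h (\sum_i h i *^ a i) by exists a.
exists (fun i => b (enum_rank i)); rewrite [RHS]reindex_enum.
by apply: eq_bigr => j _; rewrite enum_valK.
Qed.

Lemma gcoh_shift M l : gcoh M -> gcoh (shift_mod M l).
Proof.
move=> CM I e g Hg; have [J [t [r [Hr Hrel]]]] := CM I (fun i => e i + l) g Hg.
exists J, (fun j => t j - l), r; split=> // j i.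
by have := Hr j i; rewrite opprD addrA addrAC.
Qed.

Lemma gcoh_free (cohA : coherent A) n (e : 'I_n -> int) : gcoh (free A e).
Proof.
elim: n e => [|n IH] e.
  apply: (@gcoh_inj _ _ _ _ (gzero _ (regmod A))); last exact: gcoh_regmod.
  by move=> x y _; apply/ffunP => -[].
have [|j Hj] := @free_hom _ _ _ (fun i => e (lift ord0 i)) (free A e)
    (fun i => free_gen A e (lift ord0 i)).
  by move=> i; exact: free_gen_homog.
have Lf : linear (fun x : free A e => (x : free_type A _) ord0 : shift_mod (regmod A) (- e ord0)).
  by move=> a x y; rewrite !ffunE.
pose f := mkhom Lf (fun n x Hx => Hx ord0).
have jE x i : (j x : free_type A _) (lift ord0 i) = (x : free_type A _) i.
  rewrite Hj free_sumE (bigD1 i) //= free_actE ffunE eqxx mul1r.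
  rewrite big1 ?addr0 // => i' i'i; rewrite free_actE ffunE.
  by rewrite (inj_eq lift_inj) eq_sym (negbTE i'i) mul0r.
apply: (@gcoh_ext _ _ _ _ _ j f) => //.
- by move=> x y xy; apply/ffunP => i; rewrite -!jE xy.
- move=> x x0; exists ([ffun i => (x : free_type A _) (lift ord0 i)] : free_type A _).
  rewrite Hj [RHS]free_genE big_ord_recl.
  have -> : (x : free_type A _) ord0 = 0 by exact: x0.
  by rewrite ractx0 add0r; apply: eq_bigr => i _; rewrite ffunE.
- exact/gcoh_shift/gcoh_regmod.
Qed.

Lemma fin_pres_gcoh (cohA : coherent A) M : fin_pres M -> gcoh M.
Proof.
move=> [n [e [g [Hg Gg [p [t [r [Hr Hrel]]]]]]]].
have [f Hf] := free_hom Hg.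
apply: (@gcoh_quot _ _ (free A e) M f 'I_p t (fun j => [ffun i => r j i] : free_type A _)).
- move=> x; have [/(_ Logic.I) [a ->] _] := Gg x.
  exists ([ffun i => a i] : free_type A _); rewrite Hf.
  by apply: eq_bigr => i _; rewrite ffunE.
- by move=> j i; rewrite ffunE.
- move=> x; rewrite Hf Hrel; split=> -[b Hb]; exists b.
    apply/ffunP => i; rewrite free_sumE Hb; apply: eq_bigr => j _.
    by rewrite free_actE ffunE.
  move=> i; rewrite Hb free_sumE; apply: eq_bigr => j _.
  by rewrite free_actE ffunE.
- exact: gcoh_free.
Qed.

Lemma Aplus_fin_gen : exists (n : nat) (d : 'I_n -> nat) (x : 'I_n -> A),
  (forall j, agr A (d j).+1 (x j)) /\
  forall m a, agr A m.+1 a -> exists b : 'I_n -> A,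
    (forall j, agrz (m.+1%:Z - (d j).+1%:Z) (b j)) /\ a = \sum_j x j * b j.
Proof.
have [s Hs] := agr_fg A.
pose comp i x := dpr (agr_direct A) i x.
have Hu (x : A) : exists u : seq nat, x = \sum_(i <- u) comp i x.
  by have [u [_ _ _ xu]] := dprP (agr_direct A) x; exists u.
have {Hu} [u Hu] := choice Hu.
pose L : seq (nat * A) := flatten [seq [seq (i.-1, comp i.-1.+1 x) | i <- u x] | x <- s].
pose d (j : 'I_(size L)) := (nth (0%N, 0) L j).1.
pose x (j : 'I_(size L)) := (nth (0%N, 0) L j).2.
have Hx j : agr A (d j).+1 (x j).
  have : nth (0%N, 0) L j \in L by exact: mem_nth.
  rewrite /d /x; case/flattenP => _ /mapP[y _ ->] /mapP[i _ ->] /=.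
  exact: dpr_in.
exists (size L), d, x; split=> //.
pose S (a : A) := exists (c : k) (b : 'I_(size L) -> A), a = c%:A + \sum_j x j * b j.
have S0 : S 0 by exists 0, (fun=> 0); rewrite scale0r add0r big1 // => j _; rewrite mulr0.
have SD c y z : S y -> S z -> S (c *: y + z).
  move=> [c1 [b1 ->]] [c2 [b2 ->]]; exists (c * c1 + c2), (fun j => c *: b1 j + b2 j).
  rewrite scalerDr addrACA scalerA -scalerDl; congr (_ + _).
  rewrite scaler_sumr -big_split /=; apply: eq_bigr => j _.
  by rewrite mulrDr scalerAr.
have Sx j : S (x j).
  exists 0, (fun i => if i == j then 1 else 0); rewrite scale0r add0r.
  rewrite (bigD1 j) //= eqxx mulr1 big1 ?addr0 // => i /negbTE ->.
  by rewrite mulr0.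
have SA a : S a.
  apply: Hs a => [y ys||//|y z].
  - rewrite (Hu y) big_seq; elim/big_ind: _ => [//|a b Sa Sb|i iu].
      by rewrite -(scale1r a); exact: SD.
    case: i iu => [|i] iu.
      have /agr_conn [c e0] := dpr_in (agr_direct A) 0%N y.
      rewrite /comp e0; exists c, (fun=> 0); rewrite big1 ?addr0 // => j _; exact: mulr0.
    have iL : (i, comp i.+1 y) \in L.
      apply/flattenP; eexists; first by apply: map_f ys.
      by apply/mapP; exists i.+1.
    have := Sx (Ordinal (n := size L) (m := index (i, comp i.+1 y) L) _).
    by rewrite /x /= index_mem => /(_ iL); rewrite nth_index.
  - exists 1, (fun=> 0); rewrite scale1r big1 ?addr0 // => j _; exact: mulr0.
  - move=> [c1 [b1 y1]] Sz; have [c2 [b2 z2]] := Sz.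
    exists (c1 * c2), (fun j => c1 *: b2 j + b1 j * z).
    rewrite y1 mulrDl mulr_algl {1}z2 scalerDr scalerA -addrA; congr (_ + _).
    rewrite scaler_sumr mulr_suml -big_split /=; apply: eq_bigr => j _.
    by rewrite mulrDr scalerAr mulrA.
move=> m a Ha; have [c [b ab]] := SA a.
have Hreg : homog (M := regmod A) (fun j => (d j).+1%:Z) x by exact: Hx.
have [|b' [Hb' ab']] := @homog_coeffs _ _ (regmod A) _ _ x m.+1%:Z a Hreg Ha.
  exists (fun j => homog_coef (m.+1%:Z - (d j).+1%:Z) (b j)).
  rewrite -(@pr_id _ _ (regmod A) m.+1%:Z a Ha) {1}ab prD.
  have -> : pr m.+1%:Z (c%:A : regmod A) = 0.
    by apply: (@pr_other _ _ (regmod A) 0) => //; apply/agr_conn; exists c.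
  rewrite add0r pr_sum; apply: eq_bigr => j _.
  exact: (@pr_homog_act _ _ (regmod A) _ (x j) _ (b j) (Hreg j)).
by exists b'.
Qed.

Definition deg_ge M (m : int) : Prop := forall (n : int) x, n < m -> mgr M n x -> x = 0.
Definition deg_lt M (m : int) : Prop := forall (n : int) x, m <= n -> mgr M n x -> x = 0.

Lemma fin_gen_deg_ge M : fin_gen M -> exists m, deg_ge M m.
Proof.
move=> [I [e [g [Hg Gg]]]].
have [m Hm] : exists m : int, forall i, m <= e i.
  exists (- \sum_i `|e i|) => i; rewrite lerNl (bigD1 i) //=.
  rewrite (le_trans (ler_norm _)) // normrN lerDl; exact: sumr_ge0.
exists m => n x nm Hx; have [a [Ha ->]] := homog_coeffs Hg Hx (Gg x).
rewrite big1 // => i _; rewrite (agrz_neg _ (Ha i)) ?ractx0 //.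
by have := Hm i; lia.
Qed.

Definition tail_generators M (m : int) : Prop :=
  exists (I : finType) (e : I -> int) (g : I -> M),
  [/\ homog e g, forall i, m <= e i &
      forall (n : int) x, m <= n -> mgr M n x -> gspan g x].

Lemma fin_gen_tail M m : fin_gen M -> tail_generators M m.
Proof.
move=> FM; have [m0 Hm0] := fin_gen_deg_ge FM.
have base (m' : int) : m' <= m0 -> tail_generators M m'.
  move=> mm; have [I [e [g [Hg Gg]]]] := FM.
  exists I, (fun i => Num.max (e i) m'), g; split=> // [i|i].
    case: (leP m' (e i)) => [_|em]; first exact: Hg.
    by rewrite (Hm0 _ _ (lt_le_trans em mm) (Hg i)); exact: mgr0.
  by rewrite le_max lexx orbT.
case: (leP m m0) => [|/ltW]; first exact: base.
rewrite -subr_ge0 => le; have -> : m = m0 + (absz (m - m0)%R)%:Z by rewrite gez0_abs //; lia.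
elim: (absz _) => [|s [I [e [g [Hg He Gg]]]]]; first by apply: base; rewrite addr0.
have [q [d [x [Hx Gx]]]] := Aplus_fin_gen.
set m1 : int := m0 + s%:Z in He Gg.
exists (I + I * 'I_q)%type, (fun v => match v with
  | inl i => Num.max (e i) (m0 + s.+1%:Z) | inr p => m1 + (d p.2).+1%:Z end),
  (fun v => match v with
  | inl i => if e i == m1 then 0 else g i
  | inr p => if e p.1 == m1 then g p.1 *^ x p.2 else 0 end).
split=> [[i|[i j]] /=|[i|[i j]] /=|n y nm Hy].
- case: eqP => [_|ne]; first exact: mgr0.
  by have -> : Num.max (e i) (m0 + s.+1%:Z) = e i; [have := He i; lia|exact: Hg].
- by case: eqP => [<-|_]; [exact: mgr_act (Hg i) (Hx j)|exact: mgr0].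
- by rewrite le_max lexx orbT.
- by rewrite /m1; lia.
have [|a [Ha ->]] := homog_coeffs Hg Hy (Gg n y _ Hy); first by lia.
apply: gspan_sum => i _.
set G := (fun v => _); have [em|em] := eqVneq (e i) m1; last first.
  by have := gspanM (a i) (gspan_in G (inl i)); rewrite /G (negbTE em).
have : exists r : nat, n - e i = r.+1%:Z by exists (absz (n - e i - 1)%R); lia.
case=> r nr; have := Ha i; rewrite nr => Har.
have [b [_ ->]] := Gx r (a i) Har; rewrite ract_sumr; apply: gspan_sum => j _.
by have := gspanM (b j) (gspan_in G (inr (i, j))); rewrite /G /= em eqxx ractM.
Qed.

Lemma fin_gen_component M n : fin_gen M -> exists (r : nat) (v : 'I_r -> M),
  (forall i, mgr M n (v i)) /\
  forall x, mgr M n x -> exists c : 'I_r -> k, x = \sum_i v i *^ ((c i)%:A : A).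
Proof.
move=> /(fin_gen_tail n) [I [e [g [Hg He Gg]]]].
pose g' i := if e i == n then g i else 0.
exists #|I|, (fun j => g' (enum_val j)); split=> [j|x Hx].
  by rewrite /g'; case: eqP => [<-|_]; [exact: Hg|exact: mgr0].
have [a [Ha ->]] := homog_coeffs Hg Hx (Gg n x (lexx _) Hx).
have Hc i : exists c : k, g i *^ a i = g' i *^ (c%:A : A).
  rewrite /g'; case: eqP => [en|/eqP en].
    by have := Ha i; rewrite en subrr => /agr_conn [c ->]; exists c.
  exists 0; rewrite (agrz_neg _ (Ha i)) ?ractx0 ?ract0 //.
  by have := He i; lia.
have [c {}Hc] := choice Hc; exists (fun j => c (enum_val j)).
by rewrite reindex_enum; apply: eq_bigr => j _; rewrite Hc.
Qed.

Lemma pr_neq0_in M (x : M) (s : seq int) :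
  uniq s -> (forall n, n \notin s -> pr n x = 0) -> x = \sum_(n <- s) pr n x.
Proof.
move=> us s0; have [t [ut t0 {1}->]] := pr_fin x.
transitivity (\sum_(n <- undup (s ++ t)) pr n x).
  apply/esym/big_uniq_supp; rewrite ?undup_uniq //.
  by move=> i it; rewrite mem_undup mem_cat it orbT.
apply: big_uniq_supp; rewrite ?undup_uniq //.
by move=> i it; rewrite mem_undup mem_cat it.
Qed.

Lemma bounded_fin_dim M m : fin_gen M -> deg_lt M m -> fin_dim M.
Proof.
move=> FM Mm; have [m0 Hm0] := fin_gen_deg_ge FM.
have Hr n := fin_gen_component n FM.
have {Hr} [r Hr] := choice Hr; have {Hr} [v Hv] := dep_choice Hr.
have key : exists (J : finType) (w : J -> M), forall x, exists c : J -> k,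
    x = \sum_j w j *^ ((c j)%:A : A).
  pose N := absz (m - m0)%R; pose J := {j : 'I_N & 'I_(r (m0 + j%:Z))}.
  exists J, (fun j : J => v (m0 + (nat_of_ord (tag j))%:Z) (tagged j)) => x.
  have Hc (j : 'I_N) := proj2 (Hv (m0 + j%:Z)) _ (mgr_pr (m0 + j%:Z) x).
  have {Hc} [c Hc] := dep_choice Hc.
  exists (fun j : J => c (tag j) (tagged j)).
  rewrite -(sig_big_dep (fun=> true) (fun _ _ => true)
    (fun (j : 'I_N) i => v (m0 + j%:Z) i *^ ((c j i)%:A : A))) /=.
  transitivity (\sum_(n <- [seq m0 + j%:Z | j <- iota 0 N]) pr n x).
    apply: pr_neq0_in.
      by rewrite map_inj_uniq ?iota_uniq // => a b /addrI [].
    move=> n Hn; case: (ltP n m0) => [nm|mn]; first exact: Hm0 nm (mgr_pr _ _).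
    apply: (Mm n); last exact: mgr_pr.
    case: (leP m n) => // nm; case/negP: Hn; apply/mapP; exists (absz (n - m0)%R).
      by rewrite mem_iota /= /N; lia.
    by lia.
  rewrite big_map -{1}(subn0 N) -/(index_iota 0 N) big_mkord.
  by apply: eq_bigr => j _; rewrite Hc.
have [J [w Hw]] := key; exists #|J|, (fun j => w (enum_val j)) => x.
have [c ->] := Hw x; exists (fun j => c (enum_val j)); exact: reindex_enum.
Qed.

Lemma fin_dim_bounded M : fin_dim M -> exists m, deg_lt M m.
Proof.
move=> [n [v Hv]].
have [m Hm] : exists m : int, forall i l, m <= l -> pr l (v i) = 0.
  have Hs i := pr_fin (v i); have [s {}Hs] := choice Hs.
  exists (1 + \sum_i \sum_(l <- s i) `|l|) => i l Hl.
  have [_ H _] := Hs i; apply: H; apply/negP => ls.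
  have : `|l| <= \sum_i \sum_(l <- s i) `|l|.
    rewrite (bigD1 i) //= (big_rem l ls) /=.
    rewrite -addrA lerDl addr_ge0 // ?sumr_ge0 // => j _; exact: sumr_ge0.
  by have := ler_norm l; lia.
exists m => l x ml Hx; rewrite -(pr_id Hx); have [c ->] := Hv x.
rewrite pr_sum big1 // => i _.
have Hc : agr A 0 ((c i)%:A : A) by apply/agr_conn; exists (c i).
by rewrite -[l]addr0 (pr_act l (v i) Hc) Hm // ract0.
Qed.

Section Truncation.
Variables (M : grmod A) (m : int).

Definition trunc_sub : gsubm M.
Proof.
refine (@GSubm _ _ M (fun x => forall n, n < m -> pr n x = 0) _ _ _ _).
- by move=> n _; exact: pr0.
- by move=> x y Hx Hy n nm; rewrite prD Hx // Hy // addr0.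
- move=> x a Hx n nm; have [_ H _] := agr_direct A; have [s [c [Hc ->]]] := H a.
  rewrite ract_sumr pr_sum big1 // => i _.
  by rewrite -[n](subrK i%:Z) pr_act // Hx ?ract0 //; lia.
- by move=> n x Hx l lm; rewrite pr_prE; case: eqP => [<-|//]; exact: Hx.
Defined.

Definition trunc : grmod A := gsub trunc_sub.
Definition trunc_inc : grhom trunc M := gsub_inc trunc_sub.

Lemma trunc_inc_inj : injective trunc_inc.
Proof. exact: gsub_inc_inj. Qed.

Lemma trunc_deg_ge : deg_ge trunc m.
Proof.
move=> n x nm Hx; apply: trunc_inc_inj; rewrite linear0.
by rewrite -(pr_id (gfunP trunc_inc Hx)); exact: (gsvP x).
Qed.

Lemma trunc_inc_surj n x : m <= n -> mgr M n x -> exists y, mgr trunc n y /\ trunc_inc y = x.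
Proof.
move=> mn Hx; have Sx : trunc_sub x.
  by move=> l lm; apply: pr_other Hx _; lia.
by exists (gsub_mk Sx); split.
Qed.

Lemma trunc_factor T (f : grhom T M) : deg_ge T m ->
  exists u : grhom T trunc, trunc_inc \o u =1 f.
Proof.
move=> HT; apply: gsub_factor => t n nm.
by rewrite -ghom_pr (HT n _ nm (mgr_pr _ _)) linear0.
Qed.

Lemma trunc_fin_gen : fin_gen M -> fin_gen trunc.
Proof.
move=> /(fin_gen_tail m) [I [e [g [Hg He Gg]]]].
have Hy i := trunc_inc_surj (He i) (Hg i); have {Hy} [y Hy] := choice Hy.
exists I, e, y; split=> [i|]; first by have [] := Hy i.
apply: generates_homog => n x Hx.
case: (ltP n m) => [nm|mn]; first by rewrite (trunc_deg_ge nm Hx); exact: gspan0.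
have [a Ha] := Gg n _ mn (gfunP trunc_inc Hx); exists a; apply: trunc_inc_inj.
rewrite Ha linear_sum; apply: eq_bigr => i _.
by rewrite ghomM; have [_ ->] := Hy i.
Qed.

End Truncation.

Lemma deg_ge_generators M m : fin_gen M -> deg_ge M m ->
  exists (n : nat) (e : 'I_n -> int) (g : 'I_n -> M),
    [/\ homog e g, generates g & forall i, m <= e i].
Proof.
move=> [I [e [g [Hg Gg]]]] HM.
exists #|I|, (fun j => Num.max (e (enum_val j)) m), (fun j => g (enum_val j)).
split=> [j|x|j]; last by rewrite le_max lexx orbT.
- case: (leP m (e (enum_val j))) => [_|em]; first exact: Hg.
  by rewrite (HM _ _ em (Hg _)); exact: mgr0.
- have [a ->] := Gg x; exists (fun j => a (enum_val j)); exact: reindex_enum.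
Qed.

Lemma free_deg_ge (I : finType) (e : I -> int) m : (forall i, m <= e i) -> deg_ge (free A e) m.
Proof.
move=> He n x nm Hx; apply/ffunP => i; rewrite (agrz_neg _ (Hx i)) ?ffunE //.
by have := He i; lia.
Qed.

End Finiteness.

(** * Resolutions by finitely presented modules *)

Section Boundaries.
Variables (k : fieldType) (C : klcat k).
Local Open Scope kl_scope.
Local Notation "f - g" := (hadd f (hscale (-1)%R g)) : kl_scope.

Lemma boundaryD n X K (R : yext n X K) (Y : C) (h h' : hom C K Y) :
  boundary R h -> boundary R h' -> boundary R (h + h').
Proof. by move=> [t Ht] [t' Ht']; exists (t + t'); rewrite compDl Ht Ht'. Qed.

Lemma boundaryZ n X K (R : yext n X K) (Y : C) c (h : hom C K Y) :
  boundary R h -> boundary R (c *: h).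
Proof. by move=> [t Ht]; exists (c *: t); rewrite compZl Ht. Qed.

Lemma boundary_heq n X K (R : yext n X K) (Y : C) (h h' : hom C K Y) :
  h == h' -> boundary R h -> boundary R h'.
Proof. by move=> e [t Ht]; exists t; rewrite Ht. Qed.

Lemma boundary_subC n X K (R : yext n X K) (Y : C) (h h' : hom C K Y) :
  boundary R (h - h') -> boundary R (h' - h).
Proof.
move=> /(boundaryZ (-1)%R); apply: boundary_heq.
rewrite hscaleDr hscaleA mulrNN mulr1 hscale1; exact: haddC.
Qed.

Lemma boundary_sub_trans n X K (R : yext n X K) (Y : C) (h h' h'' : hom C K Y) :
  boundary R (h - h') -> boundary R (h' - h'') -> boundary R (h - h'').
Proof.
move=> H /(boundaryD H); apply: boundary_heq.
rewrite -haddA (haddA _ h') (haddC _ h') haddN hadd0; reflexivity.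
Qed.

Lemma boundary_sub0 n X K (R : yext n X K) (Y : C) (h h' : hom C K Y) :
  boundary R (h - h') -> boundary R h' -> boundary R h.
Proof.
move=> H H'; apply: boundary_heq (boundaryD H' H); exact: hsubK.
Qed.

Lemma boundary_pull n X K (R : yext n X K) X' K' (R' : yext n X' K')
    (f : hom C X X') (c : hom C K K') (Y : C) (h : hom C K' Y) :
  yext_mor R R' f c -> boundary R' h -> boundary R (h \o c).
Proof.
move=> H [t Ht].
have [e He] : exists e, e \o yinj R == yinj R' \o c.
  clear -H; case: n R R' H => [|n] R R' /=; first by case=> e [He _]; exists e.
  by case=> l [[e [He _]] _]; exists e.
by exists (t \o e); rewrite -compA He compA Ht.
Qed.

Lemma boundary_homotopy n X K (R : yext n X K) X' K' (R' : yext n X' K')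
    (f : hom C X X') (c c' : hom C K K') (Y : C) (h : hom C K' Y) :
  yext_all (@projective k C) R -> yext_mor R R' f c -> yext_mor R R' f c' ->
  boundary R ((h \o c) - (h \o c')).
Proof.
move=> PR H H'; have [t Ht] := yext_homotopy PR H H'.
by exists (h \o t); rewrite -compA -Ht compBr.
Qed.

End Boundaries.

Section Exactness.
Variables (k : fieldType) (A : gralg k).
Implicit Types (M N : grmod A).
Local Notation GM := (GrMod A).

Definition sexact K M X (i : grhom K M) (p : grhom M X) : Prop :=
  [/\ injective i, forall x, p (i x) = 0, forall x, p x = 0 -> exists y, i y = x
    & forall y, exists x, p x = y].

Lemma sexact_kernel K M X (i : grhom K M) (p : grhom M X) :
  sexact i p -> is_kernel (C := GM) p i.
Proof.
move=> [ii pi ex _]; split=> [x|T g pg]; first exact: pi.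
have [u Hu] := lift_through_inj ii (fun t => ex _ (pg t)).
exists u; split=> [//|v Hv x]; apply: ii; rewrite [i (u x)]Hu; exact: Hv.
Qed.

Lemma sexact_cokernel K M X (i : grhom K M) (p : grhom M X) :
  sexact i p -> is_cokernel (C := GM) i p.
Proof.
move=> [ii pi ex ps]; split=> [x|T g gi]; first exact: pi.
have [x|u Hu] := desc_through_surj (p := p) (g := g) ps.
  by move=> /ex [y <-]; exact: gi.
exists u; split=> [//|v Hv y]; have [x <-] := ps y; rewrite [u _]Hu; exact: Hv.
Qed.

Definition gm_ses K M X (i : grhom K M) (p : grhom M X) (H : sexact i p) : ses (C := GM) K X :=
  @Ses k GM K X M i p (sexact_kernel H) (sexact_cokernel H).

Definition im_sub M N (f : grhom M N) : gsubm N.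
Proof.
refine (@GSubm _ _ N (fun y => exists x, f x = y) _ _ _ _).
- by exists 0; exact: linear0.
- by move=> _ _ [x <-] [y <-]; exists (x + y); exact: linearD.
- by move=> _ a [x <-]; exists (x *^ a); exact: ghomM.
- by move=> n _ [x <-]; exists (pr n x); exact: ghom_pr.
Defined.

Definition ker_sub M N (f : grhom M N) : gsubm M.
Proof.
refine (@GSubm _ _ M (fun x => f x = 0) _ _ _ _).
- exact: linear0.
- by move=> x y Hx Hy; rewrite linearD Hx Hy addr0.
- by move=> x a Hx; rewrite ghomM Hx ract0.
- by move=> n x Hx; rewrite ghom_pr Hx pr0.
Defined.

Definition gcoker M N (f : grhom M N) : grmod A := gquo (im_sub f).
Definition gker M N (f : grhom M N) : grmod A := gsub (ker_sub f).

Lemma gker_sexact M N (f : grhom M N) : (forall y, exists x, f x = y) ->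
  sexact (gsub_inc (ker_sub f)) f.
Proof.
move=> fs; split=> //; first exact: gsub_inc_inj.
  by move=> x; exact: (gsub_inc_in (S := ker_sub f)).
by move=> x fx; exact: (gsub_inc_ex (S := ker_sub f)).
Qed.

Lemma gcoker_sexact M N (f : grhom M N) : injective f ->
  sexact f (gquo_pi (im_sub f)).
Proof.
move=> fi; split=> //; [|by move=> x /gquo_eq0|exact: gquo_surj].
by move=> x; apply/gquo_eq0; exists x.
Qed.

Definition point_mod (n : int) : grmod A := shift_mod (regmod A) (- n).

Lemma point_hom M n (x : M) : mgr M n x ->
  exists f : grhom (point_mod n) M, forall a : A, f a = x *^ a.
Proof.
move=> Hx.
have Lf : linear (fun a : point_mod n => x *^ (a : A)).
  by move=> a b c; rewrite ractDa; congr (_ + _); exact: ractM.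
have Gf m a : mgr (point_mod n) m a -> mgr M m (x *^ (a : A)).
  by move=> Ha; have := mgr_actz Hx Ha; rewrite addrC subrK.
by exists (mkhom Lf Gf).
Qed.

Lemma point_fin_pres n : fin_pres (point_mod n).
Proof. exact/fin_pres_shift/fin_pres_regmod. Qed.

(* The elementwise meaning of short exact sequences, in GrMod A and in cmod A, *)
(* is read off by testing on the modules A[-n] and on cokernels.               *)
Section FullSubcategory.
Variable P : GM -> Prop.
Hypothesis Ppoint : forall n, P (point_mod n).
Hypothesis Pcoker : forall M N (f : grhom M N), P M -> P N -> P (gcoker f).
Local Notation C := (full_sub P).

Definition gr (X Y : C) (f : hom C X Y) : grhom (sval X) (sval Y) := f.
Definition ungr (X Y : C) (f : grhom (sval X) (sval Y)) : hom C X Y := f.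

Lemma ungrK (X Y : C) (f : grhom (sval X) (sval Y)) : gr (ungr f) = f.
Proof. by []. Qed.

Lemma gr_comp (X Y Z : C) (g : hom C Y Z) (f : hom C X Y) x :
  gr (comp g f) x = gr g (gr f x).
Proof. by []. Qed.

Lemma gr1 (X : C) x : gr (idm X) x = x.
Proof. by []. Qed.

Lemma gr0 (X Y : C) x : gr (hzero X Y) x = 0.
Proof. by []. Qed.

Lemma gr_add (X Y : C) (f g : hom C X Y) x : gr (hadd f g) x = gr f x + gr g x.
Proof. by []. Qed.

Lemma gr_scale (X Y : C) c (f : hom C X Y) x : gr (hscale c f) x = gr f x *^ (c%:A : A).
Proof. by []. Qed.

Lemma heq_gr (X Y : C) (f g : hom C X Y) : heq f g <-> forall x, gr f x = gr g x.
Proof. by []. Qed.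

Lemma heq_gr_comp (X Y Z T : C) (g : hom C Y Z) (f : hom C X Y) (g' : hom C T Z) (f' : hom C X T) :
  heq (comp g f) (comp g' f') <-> forall x, gr g (gr f x) = gr g' (gr f' x).
Proof. by []. Qed.

Lemma heq_gr_fact (X Y Z : C) (g : hom C Y Z) (f : hom C X Y) (h : hom C X Z) :
  heq (comp g f) h <-> forall x, gr g (gr f x) = gr h x.
Proof. by []. Qed.

Lemma heq_gr_eq0 (X Y : C) (f : hom C X Y) : heq f (hzero X Y) <-> forall x, gr f x = 0.
Proof. by []. Qed.

Lemma heq_gr_comp0 (X Y Z : C) (g : hom C Y Z) (f : hom C X Y) :
  heq (comp g f) (hzero X Z) <-> forall x, gr g (gr f x) = 0.
Proof. by []. Qed.

Lemma full_epi_surj (X Y : C) (e : hom C X Y) : epi e -> forall y, exists x, gr e x = y.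
Proof.
move=> He y; pose Q : C := exist P (gcoker (gr e)) (Pcoker _ (svalP X) (svalP Y)).
suff : im_sub (gr e) y by [].
have /heq_gr H : heq (@ungr Y Q (gquo_pi (im_sub (gr e)))) (hzero Y Q).
  apply: (He Q); apply/heq_gr => x; rewrite !gr_comp gr0 ungrK.
  by apply/gquo_eq0; exists x.
by apply/gquo_eq0; have := H y; rewrite gr0 ungrK.
Qed.

Lemma full_ses_sexact (X Y : C) (s : ses Y X) : sexact (gr (inj s)) (gr (prj s)).
Proof.
have mono n x : mgr (sval Y) n x -> gr (inj s) x = 0 -> x = 0.
  move=> Hx ix; have [f Hf] := point_hom Hx.
  pose T : C := exist P _ (Ppoint n); pose g : hom C T Y := @ungr T Y f.
  have /heq_gr_eq0 H : heq g (hzero T Y).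
    apply: (ses_mono0 (s := s)); apply/heq_gr_comp0 => a.
    by rewrite ungrK Hf ghomM ix ract0.
  by rewrite -(ract1 x) -Hf -[RHS](H (1 : A)) ungrK.
have ker n x : mgr (sval (mid s)) n x -> gr (prj s) x = 0 ->
    exists y, gr (inj s) y = x.
  move=> Hx px; have [f Hf] := point_hom Hx.
  pose T : C := exist P _ (Ppoint n); pose g : hom C T (mid s) := @ungr T (mid s) f.
  have [|u /heq_gr_fact Hu] := ses_kerP (s := s) (g := g).
    by apply/heq_gr_comp0 => a; rewrite ungrK Hf ghomM px ract0.
  by exists (gr u (1 : A)); rewrite Hu ungrK Hf ract1.
split.
- exact: ghom_inj_hom mono.
- by have /heq_gr_comp0 := ses_comp0 s.
- move=> x px; have H n : exists y, gr (inj s) y = pr n x.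
    by apply: ker (mgr_pr n x) _; rewrite ghom_pr px pr0.
  have [y Hy] := choice H; have [t [_ _ ->]] := pr_fin x.
  by exists (\sum_(n <- t) y n); rewrite linear_sum; apply: eq_bigr => n _.
- exact: (full_epi_surj (@ses_epi _ _ _ _ s)).
Qed.

Lemma full_eproj_projective (X : C) : eproj (sval X) -> projective X.
Proof.
move=> H Y Z e f He; have [g Hg] := H _ _ (gr e) (gr f) (full_epi_surj He).
by exists (ungr g); apply/heq_gr_fact => x; rewrite ungrK; exact: Hg.
Qed.

Section SesOf.
Variables (K M X : C) (i : grhom (sval K) (sval M)) (p : grhom (sval M) (sval X)).
Hypothesis H : sexact i p.

Lemma full_sexact_kernel : is_kernel (ungr p) (ungr i).
Proof.
have [ii pi ex _] := H; split=> [|T g]; first exact/heq_gr_comp0.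
move=> /heq_gr_comp0 pg.
have [u Hu] := lift_through_inj ii (fun t => ex _ (pg t)).
exists (ungr u); split=> [|v /heq_gr_fact Hv]; first exact/heq_gr_fact.
by apply/heq_gr => x; apply: ii; rewrite [LHS]Hv ungrK [RHS]Hu.
Qed.

Lemma full_sexact_cokernel : is_cokernel (ungr i) (ungr p).
Proof.
have [ii pi ex ps] := H; split=> [|T g]; first exact/heq_gr_comp0.
move=> /heq_gr_comp0 gi; have [x|u Hu] := desc_through_surj (p := p) (g := gr g) ps.
  by move=> /ex [y <-]; exact: gi.
exists (ungr u); split=> [|v /heq_gr_fact Hv]; first exact/heq_gr_fact.
by apply/heq_gr => y; have [x <-] := ps y; rewrite [LHS]Hv ungrK [RHS]Hu.
Qed.

Definition full_ses : ses K X := Ses full_sexact_kernel full_sexact_cokernel.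

Lemma full_ses_prj : gr (prj full_ses) = p. Proof. by []. Qed.

End SesOf.

End FullSubcategory.

Lemma gm_epi_surj M N (e : grhom M N) : epi (C := GM) e -> forall y, exists x, e x = y.
Proof.
move=> He y; suff : im_sub e y by [].
apply/gquo_eq0; apply: (He _ (gquo_pi (im_sub e)) (gzero _ _)).
by move=> x; apply/gquo_eq0; exists x.
Qed.

Lemma gm_eproj_projective M : eproj M -> projective (C := GM) M.
Proof. by move=> H Y Z e f /gm_epi_surj es; have [g Hg] := H _ _ e f es; exists g. Qed.

Lemma gm_ses_sexact X Y (s : ses (C := GM) Y X) : sexact (inj s) (prj s).
Proof.
pose T (M : GM) : full_sub (fun _ : GM => True) := exist _ M Logic.I.
have Hk : is_kernel (C := full_sub (fun _ : GM => True)) (M := T _) (N := T _) (K := T _) (prj s) (inj s).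
  have [H1 H2] := ses_ker s; split=> [//|[Z ?] g pg]; exact: H2 pg.
have Hc : is_cokernel (C := full_sub (fun _ : GM => True)) (M := T _) (N := T _) (Q := T _) (inj s) (prj s).
  have [H1 H2] := ses_coker s; split=> [//|[Z ?] g pg]; exact: H2 pg.
exact: (full_ses_sexact (fun=> Logic.I) (fun _ _ _ _ _ => Logic.I) (Ses Hk Hc)).
Qed.

(* The push-out of 0 -> K -> M -> X -> 0 along h : K -> Y. *)
Lemma sexact_pushout K M X Y (i : grhom K M) (p : grhom M X) (h : grhom K Y) :
  sexact i p -> exists (w : grhom K (gprod M Y)),
  let Q := gcoker w in let q := gquo_pi (im_sub w) in
  [/\ injective w, forall x, w x = (i x, - h x) &
  exists (i' : grhom Y Q) (p' : grhom Q X) (e : grhom M Q),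
  (forall m y, q (m, y) = e m + i' y) /\
  [/\ sexact i' p', forall x, e (i x) = i' (h x), forall x, p' (e x) = p x,
      forall q, exists m y, q = e m + i' y
    & forall T (a : grhom M T) (b : grhom Y T), (forall x, a (i x) = b (h x)) ->
      exists u : grhom Q T, (forall m, u (e m) = a m) /\ forall y, u (i' y) = b y]].
Proof.
move=> [ii pi ex ps].
pose w : grhom K (gprod M Y) := gadd (gcomp (ginl M Y) i) (gscale (-1) (gcomp (ginr M Y) h)).
have wE x : w x = (i x, - h x).
  rewrite /= /scale_map /ract scaleN1r scaleN1r; congr pair; rewrite /= ?oppr0 ?addr0 ?add0r //.
exists w => Q q1; split=> //.
  by move=> x y; rewrite !wE => -[/ii].
pose q : grhom (gprod M Y) Q := gquo_pi (im_sub w).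
have q0 x : q (w x) = 0 by apply/gquo_eq0; exists x.
have [x|p' Hp'] := @desc_through_surj _ _ (gprod M Y) Q X q (gcomp p (gfst M Y)) (gquo_surj (S := _)).
  by move=> /gquo_eq0 [y Hy]; rewrite -Hy wE; exact: pi.
pose i' := gcomp q (ginr M Y); pose e := gcomp q (ginl M Y).
have ei x : e (i x) = i' (h x).
  have e0 : (i x, - h x) = ginl M Y (i x) - ginr M Y (h x).
    by congr pair; rewrite /= ?subr0 ?sub0r.
  apply/eqP; rewrite -subr_eq0; apply/eqP; rewrite -[RHS](q0 x) wE e0.
  exact/esym/(linearB q).
have qE x : q x = e x.1 + i' x.2 by rewrite {1}(gprodE x) linearD.
exists i', p', e; split; first by move=> m y; exact: (qE (m, y)).
split=> //.
- split.
  + apply: ghom_inj => y /gquo_eq0 [x]; rewrite wE => -[ix hx].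
    have x0 : x = 0 by apply: ii; rewrite ix linear0.
    by rewrite -[LHS]hx x0 linear0 oppr0.
  + by move=> y; rewrite [LHS]Hp' /= linear0.
  + move=> z; have [x <-] := gquo_surj z.
    rewrite [X in X = 0 -> _]Hp' /= => /ex [y xy].
    exists (x.2 + h y); rewrite [RHS]qE -[x.1](xy : i y = x.1) ei [RHS]addrC; exact: (linearD i').
  + by move=> y; have [x Hx] := ps y; exists (e x); rewrite [LHS]Hp'.
- by move=> x; rewrite [LHS]Hp'.
- by move=> z; have [x <-] := gquo_surj z; exists x.1, x.2; exact: qE.
- move=> T a b ab; have [c Hc] := gprod_copair a b.
  have [x|u Hu] := @desc_through_surj _ _ (gprod M Y) Q T q c (gquo_surj (S := _)).
    by move=> /gquo_eq0 [y <-]; rewrite wE Hc /= ab linearN subrr.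
  by exists u; split=> x; rewrite [LHS]Hu Hc /= linear0 ?addr0 ?add0r.
Qed.

Lemma gm_pushouts (K Y : GM) : has_pushouts K Y.
Proof.
move=> Z s h; have [w [_ _ [i' [p' [e [_ [E1 E2 E3 E4 E5]]]]]]] :=
  sexact_pushout h (gm_ses_sexact s).
exists (gm_ses E1); split; first by exists e; split=> x; [exact: E2|exact: E3].
move=> Y' X' s'' g f [a [a1 a2]]; have [u [u1 u2]] := E5 _ a (gcomp (inj s'') g) a1.
exists u; split=> x /=; first exact: u2.
have [m [y ->]] := E4 x.
rewrite !linearD u1 u2 E3; congr (_ + _); first exact: a2.
have [_ pi _ _] := E1; rewrite pi linear0; exact: (ses_comp0 s'' (g y)).
Qed.

End Exactness.

Section CoherentModules.
Variables (k : fieldType) (A : gralg k).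

Lemma deg_ge_le (M : grmod A) m m' : m <= m' -> deg_ge M m' -> deg_ge M m.
Proof. by move=> mm HM n x nm; apply: HM; exact: lt_le_trans mm. Qed.

Hypothesis cohA : coherent A.
Local Notation GM := (GrMod A).
Local Notation C := (cmod A).

Lemma fp_coker (M N : GM) (f : grhom M N) : fin_pres M -> fin_pres N -> fin_pres (gcoker f).
Proof.
move=> FM FN; have [I [e [g [Hg Gg]]]] := fin_pres_fin_gen FM.
apply: fin_presP; first exact: fin_gen_surj (@gquo_surj _ _ _ _) (fin_pres_fin_gen FN).
apply: (gcoh_quot (t := e) (y := fun i => f (g i)) (@gquo_surj _ _ _ (im_sub f))).
- by move=> i; exact: gfunP.
- move=> x; rewrite gquo_eq0; split=> [[y <-]|[a ->]].
    have [a ->] := Gg y; exists a; rewrite linear_sum.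
    by apply: eq_bigr => i _; rewrite ghomM.
  exists (\sum_i g i *^ a i); rewrite linear_sum.
  by apply: eq_bigr => i _; rewrite ghomM.
- exact: fin_pres_gcoh.
Qed.

Lemma fp_sub (M : GM) (S : gsubm M) : fin_pres M -> fin_gen (gsub S) -> fin_pres (gsub S).
Proof.
move=> FM FS; apply: fin_presP => //; apply: gcoh_inj (@gsub_inc_inj _ _ _ S) _.
exact: fin_pres_gcoh.
Qed.

Lemma fp_ker (M N : GM) (f : grhom M N) : fin_pres M -> fin_pres N -> fin_pres (gker f).
Proof.
move=> FM FN; apply: fp_sub => //.
have [J [t [y [Hy Ky]]]] := kernel_fin_gen f (fin_pres_fin_gen FM) (fin_pres_gcoh cohA FN).
have H j : exists z : gker f, gsub_inc (ker_sub f) z = y j.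
  by apply: gsub_inc_ex; apply/Ky; exact: gspan_in.
have [z Hz] := choice H; exists J, t, z; split=> [j|x].
  by apply: (inj_mgr (@gsub_inc_inj _ _ _ (ker_sub f))); rewrite Hz.
have /Ky [a Ha] := gsub_inc_in x; exists a; apply: gsub_inc_inj.
rewrite Ha linear_sum; apply: eq_bigr => j _.
by rewrite ghomM Hz.
Qed.

Lemma fp_prod (M N : GM) : fin_pres M -> fin_pres N -> fin_pres (gprod M N).
Proof.
move=> FM FN; apply: fin_presP.
  by apply: fin_gen_prod; exact: fin_pres_fin_gen.
by apply: gcoh_prod; exact: fin_pres_gcoh.
Qed.

Lemma fp_trunc (M : GM) m : fin_pres M -> fin_pres (trunc M m).
Proof. by move=> FM; apply: fp_sub => //; exact/trunc_fin_gen/fin_pres_fin_gen. Qed.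

Lemma fp_free n (e : 'I_n -> int) : fin_pres (free A e).
Proof. by apply: fin_presP; [exact: free_fin_gen|exact: gcoh_free]. Qed.

Lemma cmod_sexact (X Y : C) (s : ses Y X) :
  sexact (gr (inj s)) (gr (prj s)).
Proof. exact: (full_ses_sexact (@point_fin_pres _ A) fp_coker s). Qed.

Lemma cmod_projective (X : C) : eproj (sval X) -> projective X.
Proof. exact: (full_eproj_projective fp_coker). Qed.

Definition cobj (M : GM) (FM : fin_pres M) : C := exist _ M FM.

Lemma pushout_ses_mor (K Z Y : C) (s : ses K Z) (h : hom C K Y) :
  exists s' : ses Y Z, is_pushout_ses s h s' (idm Z).
Proof.
have exs := cmod_sexact s.
have [w [_ _ [i' [p' [e [_ [E1 E2 E3 E4 E5]]]]]]] := sexact_pushout (gr h) exs.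
pose Q := cobj (fp_coker w (svalP K) (fp_prod (svalP (mid s)) (svalP Y))).
exists (@full_ses _ _ _ Y Q Z i' p' E1).
split.
  exists (@ungr _ _ _ (mid s) Q e); split.
    by apply/heq_gr_comp => x; rewrite ungrK E2.
  by apply/heq_gr_comp => x; rewrite ungrK E3 gr1.
move=> Y' X' s'' g f [a [a1 a2]].
have [x|u [u1 u2]] := E5 _ (gr a) (gcomp (gr (inj s'')) (gr g)).
  by move/heq_gr_comp: a1 => ->; rewrite gr_comp.
exists (@ungr _ _ _ Q (mid s'') u); split.
  by apply/heq_gr_comp => x; rewrite ungrK u2.
apply/heq_gr_comp => x; rewrite ungrK (@full_ses_prj _ _ _ Y Q Z i' p' E1).
have [m [y ->]] := E4 x.
have [_ pi _ _] := E1; have [_ pi' _ _] := cmod_sexact s''.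
rewrite !linearD u1 u2 E3 pi linear0 addr0.
move/heq_gr_comp: a2 => ->; rewrite gr_comp gr1 [X in _ + X](_ : _ = 0) ?addr0 //.
exact: pi'.
Qed.

Lemma cmod_pushouts (K Y : C) : has_pushouts K Y.
Proof. by move=> Z s h; exact: pushout_ses_mor. Qed.

Definition resp m (X : C) : Prop := eproj (sval X) /\ deg_ge (sval X) m.

Lemma resp_projective m (X : C) : resp m X -> projective X.
Proof. by case=> /cmod_projective. Qed.

Lemma res_projective m n (X K : C) (R : yext n X K) :
  yext_all (resp m) R -> yext_all (@projective k C) R.
Proof. by apply: yext_all_imp => X'; exact: resp_projective. Qed.

Lemma cover_ses m (X : C) : deg_ge (sval X) m ->
  exists (K : C) (s : ses K X), resp m (mid s) /\ deg_ge (sval K) m.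
Proof.
move=> HX; have [n [e [g [Hg Gg He]]]] := deg_ge_generators (fin_pres_fin_gen (svalP X)) HX.
have [f Hf] := free_hom Hg.
have fs y : exists x, f x = y.
  have [a ->] := Gg y; exists ([ffun i => a i] : free_type A _); rewrite Hf.
  by apply: eq_bigr => i _; rewrite ffunE.
pose F := cobj (fp_free e); pose K := cobj (fp_ker f (svalP F) (svalP X)).
have DF : deg_ge (free A e) m by exact: free_deg_ge.
exists K, (@full_ses _ _ _ K F X _ f (gker_sexact fs)).
split; first by split; [exact: eproj_free|].
move=> l x lm Hx; apply: (@gsub_inc_inj _ _ _ (ker_sub f)).
by rewrite linear0; apply: DF lm _; exact: gfunP.
Qed.

Lemma resolution_ex m n (X : C) : deg_ge (sval X) m ->
  exists (K : C) (R : yext n X K), yext_all (resp m) R /\ deg_ge (sval K) m.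
Proof.
move=> HX; elim: n => [|n [K [R [HR HK]]]]; first exact: cover_ses.
have [L [s [Hs HL]]] := cover_ses HK.
by exists L, (existT _ K (s, R)).
Qed.

Lemma cmod_deg_ge (X : C) : exists m, deg_ge (sval X) m.
Proof. exact/fin_gen_deg_ge/fin_pres_fin_gen/svalP. Qed.

Definition cmod_inc : functor C GM.
Proof.
by refine (@Functor k C GM (fun X => sval X) (fun X Y f => f) _ _ _ _ _).
Defined.

Lemma cmod_inc_exact : exact_functor cmod_inc.
Proof.
move=> Y X s; split; [exact: sexact_kernel (cmod_sexact s)|exact: sexact_cokernel (cmod_sexact s)].
Qed.

Lemma inc_full (X Y : C) (f : hom GM (cmod_inc X) (cmod_inc Y)) :
  exists g : hom C X Y, fhom cmod_inc g = f.
Proof. by exists f. Qed.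

Lemma inc_faithful (X Y : C) (f g : hom C X Y) :
  heq (fhom cmod_inc f) (fhom cmod_inc g) <-> heq f g.
Proof. by []. Qed.

Lemma res_gm_projective m n (X K : C) (R : yext n X K) : yext_all (resp m) R ->
  yext_all (@projective k GM) (fyext cmod_inc_exact R).
Proof.
by move=> HR; apply: fyext_all; apply: yext_all_imp HR => Z [H _]; exact: gm_eproj_projective.
Qed.

Lemma boundary_gm_cmod n (X K Y : C) (R : yext n X K) (h : hom C K Y) :
  boundary (fyext cmod_inc_exact R) (fhom cmod_inc h) <-> boundary R h.
Proof.
split=> [/(fyext_boundary cmod_inc_exact R) [t Ht]|[t Ht]].
  have [u tu] := inc_full t; exists u.
  apply: (proj1 (inc_faithful (comp u (yinj R)) h)).
  by rewrite fhomM tu.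
apply/(fyext_boundary cmod_inc_exact R); exists (fhom cmod_inc t).
rewrite -fhomM; exact: (proj2 (inc_faithful (comp t (yinj R)) h) Ht).
Qed.

Lemma extv_gm_cmod n (X Y : C) : extv (C := GM) n (sval X) (sval Y) <-> extv n X Y.
Proof.
case: n => [//|n]; have [m Hm] := cmod_deg_ge X.
have [K [R [HR _]]] := resolution_ex n Hm.
split=> H.
  apply: (extv_res (res_projective HR)) => h; apply/(boundary_gm_cmod R h).
  exact: (H _ _ (res_gm_projective HR)).
apply: (extv_res (res_gm_projective HR)) => h; have [g <-] := inc_full h.
apply/(boundary_gm_cmod R g); exact: (H _ _ (res_projective HR)).
Qed.

Lemma horseshoe_step m (Z' ZQ K' KQ : C) (t : ses Z' ZQ) (a' : ses K' Z') (aQ : ses KQ ZQ) :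
  resp m (mid a') -> resp m (mid aQ) ->
  exists (u : ses K' KQ) (a'' : ses (mid u) (mid t)),
  [/\ resp m (mid a''), ses_mor a' a'' (inj u) (inj t), ses_mor a'' aQ (prj u) (prj t)
    & exists r : hom C (mid a'') (mid a'), (comp r (comp (inj a'') (inj u)) == inj a')%KL].
Proof.
move=> [EP DP] [ES DS].
have [ii pi ex ps] := cmod_sexact t.
have [ii' pi' ex' ps'] := cmod_sexact a'.
have [iiQ piQ exQ psQ] := cmod_sexact aQ.
set i := gr (inj t) in ii pi ex; set p := gr (prj t) in pi ex ps.
set j' := gr (inj a') in ii' pi' ex'; set q' := gr (prj a') in pi' ex' ps'.
set jQ := gr (inj aQ) in iiQ piQ exQ; set qQ := gr (prj aQ) in piQ exQ psQ.
have [l Hl] := ES _ _ p qQ ps.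
have {}Hl x : p (l x) = qQ x by exact: Hl.
pose P' := sval (mid a'); pose S := sval (mid aQ).
have [q'' Hq''] : exists q'' : grhom (gprod P' S) (sval (mid t)),
    forall x, q'' x = i (q' x.1) + l x.2 by have [u Hu] := gprod_copair (gcomp i q') l; exists u.
have sq'' y : exists x, q'' x = y.
  have [s Hs] := psQ (p y); have [z Hz] : exists z, i z = y - l s.
    by apply: ex; rewrite linearB -Hs Hl subrr.
  have [x Hx] := ps' z; exists (x, s); rewrite Hq'' /=.
  by rewrite Hx Hz subrK.
pose F := cobj (fp_prod (svalP (mid a')) (svalP (mid aQ))).
pose K'' := cobj (fp_ker q'' (svalP F) (svalP (mid t))).
pose inc := gsub_inc (ker_sub q'').
have incK x : q'' (inc x) = 0 by exact: (gsub_inc_in (S := ker_sub q'')).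
have incE y : q'' y = 0 -> exists x, inc x = y by exact: (gsub_inc_ex (S := ker_sub q'')).
have [v Hv] : exists v : grhom (sval K') (gker q''), inc \o v =1 gcomp (ginl P' S) j'.
  apply: lift_through_inj (@gsub_inc_inj _ _ _ (ker_sub q'')) _ => x; apply: incE.
  by rewrite Hq'' /= linear0 addr0 pi' linear0.
have {}Hv x : inc (v x) = (j' x, 0) by exact: Hv.
have [w Hw] : exists w : grhom (gker q'') (sval KQ), jQ \o w =1 gcomp (gsnd P' S) inc.
  apply: lift_through_inj => // x; apply: exQ; rewrite -Hl.
  by have := incK x; rewrite Hq'' => /(congr1 p); rewrite linearD linear0 pi add0r.
have {}Hw x : jQ (w x) = (inc x).2 by exact: Hw.
have exu : sexact v w.
  split.
  - by move=> x y xy; apply: ii'; have := Hv x; rewrite xy Hv => -[].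
  - by move=> x; apply: iiQ; rewrite linear0 Hw Hv.
  - move=> x wx; have x2 : (inc x).2 = 0 by rewrite -Hw wx linear0.
    have : i (q' (inc x).1) = i 0 by have := incK x; rewrite Hq'' x2 !linear0 addr0.
    move=> /ii /ex' [y Hy].
    exists y; apply: (@gsub_inc_inj _ _ _ (ker_sub q'')).
    by rewrite [LHS]Hv [RHS]surjective_pairing x2 -Hy.
  - move=> y; have [z Hz] : exists z, i z = l (jQ y) by apply: ex; rewrite Hl piQ.
    have [x Hx] := ps' z.
    have [e He] : exists e, inc e = (- x, jQ y).
      by apply: incE; rewrite Hq'' /= !linearN Hx Hz addNr.
    by exists e; apply: iiQ; rewrite Hw He.
pose u := @full_ses _ _ _ K' K'' KQ v w exu.
pose a'' := @full_ses _ _ _ K'' F (mid t) inc q'' (gker_sexact sq'').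
exists u, a''; split.
- split; first exact: eproj_prod.
  move=> n [x y] nm [Hx Hy]; congr pair; [exact: DP nm Hx|exact: DS nm Hy].
- exists (@ungr _ _ _ (mid a') F (ginl P' S)); split; apply/heq_gr_comp => x.
    by rewrite !ungrK; exact: esym (Hv x).
  by rewrite !ungrK Hq'' /= linear0 addr0.
- exists (@ungr _ _ _ F (mid aQ) (gsnd P' S)); split; apply/heq_gr_comp => x.
    by rewrite !ungrK; exact: esym (Hw x).
  rewrite !ungrK -/p Hq'' linearD -/i pi add0r Hl; reflexivity.
- exists (@ungr _ _ _ F (mid a') (gfst P' S)); apply/heq_gr_fact => x.
  by rewrite gr_comp !ungrK Hv.
Qed.

Lemma horseshoe m n (X' XQ K' KQ : C) (t : ses X' XQ) (R' : yext n X' K') (S : yext n XQ KQ) :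
  yext_all (resp m) R' -> yext_all (resp m) S ->
  exists (u : ses K' KQ) (R : yext n (mid t) (mid u)),
  [/\ yext_all (resp m) R, yext_mor R' R (inj t) (inj u), yext_mor R S (prj t) (prj u)
    & exists r : hom C (yhead R) (yhead R'), (comp r (comp (yinj R) (inj u)) == yinj R')%KL].
Proof.
elim: n K' KQ R' S => [|n IH] K' KQ R' S.
  move=> H1 H2; have [u [a [Ha H3 H4 Hr]]] := horseshoe_step t H1 H2.
  by exists u, a.
case: R' => Z' [a' R']; case: S => ZQ [aQ S] [H1 H1'] [H2 H2'].
have [u [R [HR M1 M2 _]]] := IH _ _ _ _ H1' H2'.
have [v [a [Ha H3 H4 Hr]]] := horseshoe_step u H1 H2.
exists v, (existT _ (mid u) (a, R)); split=> //.
  by exists (inj u).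
by exists (prj u).
Qed.

Section LongExactFirstVariable.
Variables (X' XQ Y : C) (t : ses X' XQ).
Local Open Scope kl_scope.
Local Notation "f - g" := (hadd f (hscale (-1)%R g)) : kl_scope.

Lemma horseshoe_boundary m n (K' KQ : C) (R' : yext n X' K') (S : yext n XQ KQ)
    (u : ses K' KQ) (R : yext n (mid t) (mid u)) :
  yext_all (resp m) S ->
  yext_mor R S (prj t) (prj u) ->
  (exists r : hom C (yhead R) (yhead R'), r \o (yinj R \o inj u) == yinj R') ->
  extv n.+1 XQ Y -> forall h : hom C (mid u) Y, boundary R' (h \o inj u) -> boundary R h.
Proof.
move=> HS M2 [r Hr] HQ h [b Hb].
have [|g Hg] := @ses_cokerP _ _ _ _ u _ (h - (b \o r \o yinj R)).
  rewrite compBl -Hb -[in X in _ - X]compA -[in X in _ - X]compA Hr haddN.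
  reflexivity.
have HSg : boundary S g := HQ _ _ (res_projective HS) g.
apply: (boundary_sub0 (h' := b \o r \o yinj R)); last by exists (b \o r).
by apply: boundary_heq Hg _; exact: boundary_pull M2 HSg.
Qed.

Lemma extv_mid n : extv n X' Y -> extv n XQ Y -> extv n (mid t) Y.
Proof.
case: n => [|n] H' HQ.
  move=> f; have [|g Hg] := @ses_cokerP _ _ _ _ t _ f; first exact: H'.
  by rewrite -Hg (HQ g) comp0l.
have [m [Hm1 Hm2]] : exists m, deg_ge (sval X') m /\ deg_ge (sval XQ) m.
  have [m1 Hm1] := cmod_deg_ge X'; have [m2 Hm2] := cmod_deg_ge XQ.
  exists (Num.min m1 m2); split; [apply: deg_ge_le Hm1|apply: deg_ge_le Hm2].
    by rewrite ge_min lexx.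
  by rewrite ge_min lexx orbT.
have [K' [R' [HR' _]]] := resolution_ex n Hm1.
have [KQ [S [HS _]]] := resolution_ex n Hm2.
have [u [R [HR M1 M2 Hr]]] := horseshoe t HR' HS.
apply: (extv_res (res_projective HR)) => h.
apply: (horseshoe_boundary HS M2 Hr HQ).
exact: (H' _ _ (res_projective HR')).
Qed.

Section Stability.
Variables (m : int) (n : nat) (K' K'' : C) (R' : yext n X' K') (R'' : yext n (mid t) K'').
Hypotheses (HR' : yext_all (resp m) R') (HR'' : yext_all (resp m) R'').
Variables (c : hom C K' K'').
Hypothesis Hc : yext_mor R' R'' (inj t) c.
Let PR' := res_projective HR'.
Let PR'' := res_projective HR''.

Lemma resolution_common : exists m' KQ (S : yext n XQ KQ),
  [/\ yext_all (resp m') S, yext_all (resp m') R' & deg_ge (sval KQ) m'].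
Proof.
have [m1 Hm1] := cmod_deg_ge XQ; pose m' := Num.min m m1.
have [|KQ [S [HS DS]]] := @resolution_ex m' n XQ.
  by apply: deg_ge_le Hm1; rewrite ge_min lexx orbT.
exists m', KQ, S; split=> //; apply: yext_all_imp HR' => Z [EZ DZ].
by split=> //; apply: deg_ge_le DZ; rewrite ge_min lexx.
Qed.

Lemma restriction_inj (h : hom C K'' Y) :
  extv n.+1 XQ Y -> boundary R' (h \o c) -> boundary R'' h.
Proof.
move=> HQ Hh; have [m' [KQ [S [HS HR'm _]]]] := resolution_common.
have [u [R [HR M1 M2 Hr]]] := horseshoe t HR'm HS.
have PR := res_projective HR.
have [v Hv] := yext_lift R'' 1 PR; have [v' Hv'] := yext_lift R 1 PR''.
have H1 : yext_mor R' R'' (inj t) (v \o inj u).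
  exact: yext_mor_heq (comp1m _) (heq_refl _) (yext_mor_comp M1 Hv).
have H2 : boundary R' (h \o v \o inj u).
  apply: boundary_heq (compA _ _ _) _.
  exact: boundary_sub0 (boundary_homotopy h PR' H1 Hc) Hh.
have H3 := boundary_pull Hv' (horseshoe_boundary HS M2 Hr HQ H2).
have H4 := yext_mor_heq (comp1m _) (heq_refl _) (yext_mor_comp Hv' Hv).
have H5 := boundary_homotopy h PR'' (yext_mor1 R'') H4.
apply: boundary_heq (compm1 h) _; apply: boundary_sub0 H5 _.
exact: boundary_heq (heq_sym (compA _ _ _)) H3.
Qed.

Lemma restriction_surj (h' : hom C K' Y) :
  extv n.+2 XQ Y -> exists h : hom C K'' Y, boundary R' (h' - (h \o c)).
Proof.
move=> HQ; have [m' [KQ [S [HS HR'm DS]]]] := resolution_common.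
have [u [R [HR M1 M2 Hr]]] := horseshoe t HR'm HS.
have PR := res_projective HR.
have [v' Hv'] := yext_lift R 1 PR''.
have [L [s [Hs _]]] := cover_ses DS.
have [|g Hg] := ses_extend u (resp_projective Hs) (@cmod_pushouts K' Y) _ h'.
  exact: (HQ L (existT _ KQ (s, S) : yext n.+1 XQ L)
    (conj (resp_projective Hs) (res_projective HS))).
exists (g \o v').
have H1 := yext_mor_heq (comp1m _) (heq_refl _) (yext_mor_comp Hc Hv').
have H2 := boundary_homotopy g PR' M1 H1.
apply: boundary_heq H2; rewrite Hg compA; reflexivity.
Qed.

End Stability.

Lemma restriction_hom_inj (h : hom C (mid t) Y) :
  extv 0 XQ Y -> h \o inj t == 0 -> h == 0.
Proof.
move=> HQ /ses_cokerP [g Hg]; by rewrite -Hg (HQ g) comp0l.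
Qed.

Lemma restriction_hom_surj (h' : hom C X' Y) :
  extv 1 XQ Y -> exists h : hom C (mid t) Y, h \o inj t == h'.
Proof.
move=> HQ; have [m Hm] := cmod_deg_ge XQ; have [L [s [Hs _]]] := cover_ses Hm.
apply: (ses_extend t (resp_projective Hs) (@cmod_pushouts X' Y)).
exact: (HQ L (s : yext 0 XQ L) (resp_projective Hs)).
Qed.

End LongExactFirstVariable.

End CoherentModules.

(** * The condition chi *)

Section FiniteQuotients.
Variable k : fieldType.

Definition lin_closed (W : lmodType k) (U : W -> Prop) : Prop :=
  U 0 /\ forall c x y, U x -> U y -> U (c *: x + y).

Lemma lin_closed_mx r (P : 'rV[k]_r -> Prop) : lin_closed P ->
  exists M : 'M[k]_r, forall v, P v <-> (v <= M)%MS.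
Proof.
move=> [P0 PD]; pose Q n := `[< exists M : 'M[k]_r, (forall v, (v <= M)%MS -> P v) /\ \rank M = n >].
have exQ : exists n, Q n.
  exists 0%N; apply/asboolP; exists 0; split; last exact: mxrank0.
  by move=> v; rewrite submx0 => /eqP ->.
have ubQ n : Q n -> (n <= r)%N by move=> /asboolP [M [_ <-]]; exact: rank_leq_row.
case: (ex_maxnP exQ ubQ) => n /asboolP [M [PM rM]] max; exists M => v; split; last exact: PM.
move=> Pv; apply: contraT => vM; suff /max : Q (\rank (M + v)%MS).
  rewrite -rM leqNgt; case/negP; rewrite ltn_neqAle mxrankS ?addsmxSl // andbT.
  apply: contra vM; rewrite (mxrank_leqif_sup (addsmxSl M v)).
  exact: submx_trans (addsmxSr M v).
apply/asboolP; exists (M + v)%MS; split=> // w /sub_addsmxP [[a b] -> /=].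
have Pb : P (b *m v) by rewrite [b]mx11_scalar mul_scalar_mx -[_ *: _]addr0; exact: PD.
by rewrite -[a *m M]scale1r; apply: PD => //; apply: PM; exact: submxMl.
Qed.

Lemma fin_quotient (W : lmodType k) (U B : W -> Prop) (J : finType) (s : J -> W) :
  lin_closed U -> lin_closed B -> (forall x, B x -> U x) ->
  (forall x, U x -> exists c : J -> k, x = \sum_j c j *: s j) ->
  exists (N : nat) (th : W -> 'rV[k]_N),
  [/\ forall c x y, U x -> U y -> th (c *: x + y) = c *: th x + th y,
      forall v, exists x, U x /\ th x = v
    & forall x, U x -> (th x = 0 <-> B x)].
Proof.
move=> LU LB BU span; pose r := #|J|.
pose phi (c : 'rV[k]_r) := \sum_(j < r) c 0 j *: s (enum_val j).
have phiL a c d : phi (a *: c + d) = a *: phi c + phi d.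
  rewrite /phi scaler_sumr -big_split /=; apply: eq_bigr => j _.
  by rewrite !mxE scalerDl scalerA.
have phi0 : phi 0 = 0 by rewrite /phi big1 // => j _; rewrite mxE scale0r.
have pull P : lin_closed P -> lin_closed (fun c => P (phi c)).
  by move=> [P0 PD]; split=> [|a x y]; rewrite ?phi0 // phiL; exact: PD.
have [MU HU] := lin_closed_mx (pull _ LU); have [MB HB] := lin_closed_mx (pull _ LB).
have phiS x : U x -> exists c, phi c = x.
  move=> /span [c ->]; exists (\row_j c (enum_val j)).
  rewrite (reindex (@enum_val J predT)) /=; last first.
    by exists enum_rank => i _; rewrite ?enum_rankK ?enum_valK.
  by apply: eq_bigr => j _; rewrite mxE.
pose D := MU *m cokermx MB; pose RB := row_base D.
pose th' (c : 'rV[k]_r) := c *m cokermx MB *m pinvmx RB.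
have th'K c : (c <= MU)%MS -> th' c *m RB = c *m cokermx MB.
  by move=> cU; rewrite mulmxKpV // eq_row_base submxMr.
have th'0 c : (c <= MU)%MS -> (th' c = 0 <-> (c <= MB)%MS).
  move=> cU; split=> [e|].
    by rewrite submxE -th'K // e mul0mx.
  by rewrite submxE /th' => /eqP ->; rewrite mul0mx.
have th'L a c d : th' (a *: c + d) = a *: th' c + th' d.
  by rewrite /th' !mulmxDl -!scalemxAl.
have /choice [pre Hpre] : forall x, exists c, U x -> phi c = x.
  by move=> x; case: (pselect (U x)) => [/phiS [c <-]|]; [exists c|exists 0].
have preU x : U x -> (pre x <= MU)%MS by move=> Ux; apply/HU; rewrite Hpre.
have th'E c d : (c <= MU)%MS -> (d <= MU)%MS -> phi c = phi d -> th' c = th' d.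
  move=> cU dU cd; apply/eqP; rewrite -subr_eq0; apply/eqP.
  have -> : th' c - th' d = th' (-1 *: d + c) by rewrite th'L scaleN1r addrC.
  have e : phi (-1 *: d + c) = 0 by rewrite phiL cd scaleN1r addNr.
  apply/th'0; first by rewrite addmx_sub // scalemx_sub.
  by apply/HB; rewrite e; case: LB.
exists (\rank D), (fun x => th' (pre x)); split=> [c x y Ux Uy|v|x Ux].
- rewrite -th'L; apply: th'E; first by apply: preU; case: LU => _; exact.
    by rewrite addmx_sub ?scalemx_sub ?preU.
  by rewrite phiL !Hpre //; case: LU => _; exact.
- have /submxP [u Hu] : (v *m RB <= MU *m cokermx MB)%MS.
    by apply: submx_trans (submxMl v RB) _; rewrite /RB eq_row_base.
  have cU : (u *m MU <= MU)%MS by exact: submxMl.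
  exists (phi (u *m MU)); split; first exact/HU.
  have Uc : U (phi (u *m MU)) by exact/HU.
  rewrite (@th'E _ (u *m MU)) ?preU ?Hpre //.
  have /row_free_inj inj : row_free RB := row_base_free D.
  by apply: inj; rewrite th'K // -mulmxA -Hu.
- by rewrite th'0 ?preU // -HB Hpre.
Qed.

Lemma lin_quot_ex (C : klcat k) (K Y : C) (B : hom C K Y -> Prop) (W : lmodType k)
    (ev : hom C K Y -> W) (J : finType) (s : J -> W) :
  (forall f g, heq f g <-> ev f = ev g) ->
  (forall f g, ev (hadd f g) = ev f + ev g) ->
  (forall c f, ev (hscale c f) = c *: ev f) ->
  (forall f, exists c : J -> k, ev f = \sum_j c j *: s j) ->
  (forall f g, heq f g -> B f -> B g) -> B (hzero K Y) ->
  (forall c f g, B f -> B g -> B (hadd (hscale c f) g)) ->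
  exists N (th : hom C K Y -> 'rV[k]_N), lin_quot B th.
Proof.
move=> E1 E2 E3 sp Bh B0 BL.
have ev0 : ev (hzero K Y) = 0.
  by rewrite -[RHS](scale0r (ev (hzero K Y))) -E3; apply/E1; rewrite hscale0.
pose U w := exists f, ev f = w; pose B' w := exists f, B f /\ ev f = w.
have LU : lin_closed U.
  split; first by exists (hzero K Y).
  by move=> c _ _ [f <-] [g <-]; exists (hadd (hscale c f) g); rewrite E2 E3.
have LB : lin_closed B'.
  split; first by exists (hzero K Y).
  move=> c _ _ [f [Bf <-]] [g [Bg <-]]; exists (hadd (hscale c f) g).
  by rewrite E2 E3; split=> //; exact: BL.
have BU w : B' w -> U w by move=> [f [_ <-]]; exists f.
have sp' w : U w -> exists c : J -> k, w = \sum_j c j *: s j.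
  by move=> [f <-]; exact: sp.
have [N [th [T1 T2 T3]]] := fin_quotient LU LB BU sp'.
have Uev f : U (ev f) by exists f.
have th0 : th 0 = 0.
  have := T1 (-1) 0 0 LU.1 LU.1; rewrite scaler0 addr0 scaleN1r addNr.
  by [].
exists N, (fun f => th (ev f)); split.
- by move=> f g /E1 ->.
- move=> f g; rewrite E2 -[ev f]scale1r T1 // scale1r scale1r.
  by [].
- by move=> c f; rewrite E3 -[c *: _]addr0 T1 // ?th0 ?addr0 //; case: LU.
- by move=> v; have [_ [[f <-] Hf]] := T2 v; exists f.
- move=> f; rewrite T3 //; split=> [[g [Bg /E1 gf]]|Bf]; last by exists f.
  exact: Bh gf Bg.
Qed.

End FiniteQuotients.

Section ScalarAction.
Variables (k : fieldType) (A : gralg k) (M : grmod A).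

Definition kmod : Type := M.
HB.instance Definition _ := GRing.Zmodule.on kmod.

Definition kact (c : k) (x : kmod) : kmod := ract (x : M) (c%:A : A).

Lemma kactA (a b : k) (x : kmod) : kact a (kact b x) = kact (a * b) x.
Proof. by rewrite /kact -ractM -scalerAl mul1r scalerA mulrC. Qed.
Lemma kact1 : left_id 1 kact.
Proof. by move=> x; rewrite /kact scale1r; exact: ract1. Qed.
Lemma kactDr : right_distributive kact +%R.
Proof. by move=> a x y; exact: ractD. Qed.
Lemma kactDl v : {morph kact^~ v : a b / a + b}.
Proof. by move=> a b; rewrite /kact scalerDl ractDa. Qed.

HB.instance Definition _ := GRing.Zmodule_isLmodule.Build k kmod kactA kact1 kactDr kactDl.

End ScalarAction.

Section FiniteExt.
Variables (k : fieldType) (A : gralg k).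
Hypothesis cohA : coherent A.
Local Notation GM := (GrMod A).
Local Notation C := (cmod A).

Lemma cmod_lin_quot (K Y : C) (B : hom C K Y -> Prop) :
  (forall f g, heq f g -> B f -> B g) -> B (hzero K Y) ->
  (forall c f g, B f -> B g -> B (hadd (hscale c f) g)) ->
  exists N (th : hom C K Y -> 'rV[k]_N), lin_quot B th.
Proof.
have [I [e [g [Hg Gg]]]] := fin_pres_fin_gen (svalP K).
have Hr i := fin_gen_component (e i) (fin_pres_fin_gen (svalP Y)).
have {Hr} [r Hr] := choice Hr; have {Hr} [v Hv] := dep_choice Hr.
pose J := {i : I & 'I_(r i)}.
apply: (lin_quot_ex (W := {ffun I -> kmod (sval Y)})
  (ev := fun f => [ffun i => gr f (g i) : kmod (sval Y)]) (J := J)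
  (s := fun j : J => [ffun i => if i == tag j then (v (tag j) (tagged j) : kmod (sval Y)) else 0])).
- move=> f h; rewrite heq_gr; split=> [fh|fh x].
    by apply/ffunP => i; rewrite !ffunE fh.
  apply: (generated_hom_eq Gg) => i; have := congr1 (fun u : {ffun I -> kmod (sval Y)} => u i) fh.
  by rewrite !ffunE.
- by move=> f h; apply/ffunP => i; rewrite !ffunE gr_add.
- by move=> c f; apply/ffunP => i; rewrite !ffunE gr_scale.
- move=> f; have Hc i := proj2 (Hv i) _ (gfunP (gr f) (Hg i)).
  have {Hc} [c Hc] := dep_choice Hc.
  exists (fun j : J => c (tag j) (tagged j)); apply/ffunP => i; rewrite ffunE sum_ffunE.
  rewrite Hc -(sig_big_dep (fun=> true) (fun _ _ => true)
    (fun i' l => (c i' l *: [ffun i => if i == i' then (v i' l : kmod (sval Y)) else 0] : {ffun I -> kmod (sval Y)}) i)) /=.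
  rewrite (bigD1 i) //= [X in _ + X]big1 ?addr0.
    by apply: eq_bigr => l _; rewrite !ffunE eqxx.
  by move=> i' i'i; rewrite big1 // => l _; rewrite !ffunE eq_sym (negbTE i'i) scaler0.
Qed.

Lemma boundary_lin_quot n (X K Y : C) (R : yext n X K) :
  exists N (th : hom C K Y -> 'rV[k]_N), lin_quot (boundary R (Y := Y)) th.
Proof.
apply: cmod_lin_quot => [f g||c f g Bf Bg].
- exact: boundary_heq.
- by exists (hzero _ _); rewrite comp0l.
- by apply: boundaryD => //; exact: boundaryZ.
Qed.

Lemma hom_lin_quot (X Y : C) :
  exists N (th : hom C X Y -> 'rV[k]_N), lin_quot (fun h => heq h (hzero X Y)) th.
Proof.
apply: cmod_lin_quot => [f g -> //|//|c f g -> ->].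
by rewrite hscale0 hadd0.
Qed.

Lemma lin_quot_inc (K Y : C) (B : hom C K Y -> Prop)
    (B' : hom GM (cmod_inc A K) (cmod_inc A Y) -> Prop) N (th : hom C K Y -> 'rV[k]_N) :
  (forall h, B' (fhom (cmod_inc A) h) <-> B h) ->
  lin_quot B th -> exists th' : _ -> 'rV[k]_N, lin_quot B' th'.
Proof.
move=> BB' [H1 H2 H3 H4 H5]; exists (th : hom GM (cmod_inc A K) (cmod_inc A Y) -> 'rV[k]_N).
split=> [//|//|//|//|h]; have [g <-] := inc_full h.
rewrite BB'; exact: H5.
Qed.

Lemma gm_Ext_dim_ex n (X Y : C) : exists N, Ext_dim (C := GM) n (sval X) (sval Y) N.
Proof.
case: n => [|n].
  have [N [th Hth]] := hom_lin_quot X Y.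
  have [|th' Hth'] := lin_quot_inc (B' := fun h => heq h (hzero _ _)) _ Hth.
    by move=> h; exact: (inc_faithful h (hzero X Y)).
  by exists N; exact: Ext_dim_hom Hth'.
have [m Hm] := cmod_deg_ge X; have [K [R [HR _]]] := resolution_ex cohA n Hm.
have [N [th Hth]] := boundary_lin_quot Y R.
have [|th' Hth'] := lin_quot_inc (B' := boundary (fyext (cmod_inc_exact cohA) R) (Y := _)) _ Hth.
  exact: boundary_gm_cmod.
exists N; exact: (Ext_dim_resolution (res_gm_projective cohA HR) (@gm_pushouts _ _ _ _) Hth').
Qed.

Lemma gm_Ext_dim0 n (X Y : C) : Ext_dim (C := GM) n (sval X) (sval Y) 0 <-> extv n X Y.
Proof.
rewrite -(extv_gm_cmod cohA); case: n => [|n].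
  by split; [exact: Ext_dim0_extv_hom|exact: extv_Ext_dim0_hom].
have [m Hm] := cmod_deg_ge X; have [K [R [HR _]]] := resolution_ex cohA n Hm.
have PR := res_gm_projective cohA HR.
by split; [exact: (Ext_dim0_extv PR (@gm_pushouts _ _ _ _))
          |exact: (extv_Ext_dim0 PR (@gm_pushouts _ _ _ _))].
Qed.

Lemma fin_pres_residue : fin_pres (resmod A).
Proof.
have [q [d [x [Hx Gx]]]] := Aplus_fin_gen A.
have actE (a : A) (u : resmod A) : u *^ a = aug a * (u : k) by [].
exists 1%N, (fun=> 0), (fun=> (1 : k) : resmod A); split.
- by move=> i; left.
- move=> u; split=> // _; exists (fun=> (u : k)%:A); rewrite big_ord1 actE mulr1.
  by symmetry; apply: aug_eq; rewrite subrr; exact: Aplus0.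
exists q, (fun j => (d j).+1%:Z), (fun j _ => x j); split.
  by move=> j i; rewrite subr0; exact: Hx.
move=> a; rewrite big_ord1 actE mulr1; split=> [a0|[b Hb]].
  have : Aplus (a ord0) by have := augP (a ord0); rewrite a0 scale0r subr0.
  have gen y : Aplus y -> exists b : 'I_q -> A, y = \sum_j x j * b j.
    elim=> {y} [|i u v Hu _ [b ->]].
      by exists (fun=> 0); rewrite big1 // => j _; rewrite mulr0.
    have [c [_ ->]] := Gx i u Hu; exists (fun j => c j + b j).
    by rewrite -big_split /=; apply: eq_bigr => j _; rewrite mulrDr.
  by move=> /gen [b Hb]; exists b => i; rewrite (ord1 i).
rewrite Hb; elim/big_rec: _ => [|j y _ IH].
  by apply: aug_eq; rewrite scale0r subr0; exact: Aplus0.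
by rewrite augD IH addr0 augM (aug_pos (Hx j)) mul0r.
Qed.

Definition kC : C := cobj fin_pres_residue.
Definition shC (l : int) (M : C) : C := cobj (fin_pres_shift l (svalP M)).
Definition AC (l : int) : C := shC l (cobj (fin_pres_regmod A)).

Lemma extA_dim0 i (M : C) l : extA_dim i (sval M) l 0 <-> extv i kC (shC l M).
Proof. exact: (gm_Ext_dim0 i kC (shC l M)). Qed.

Lemma cmod_shift_exact l : exact_functor (cmod_shift A l).
Proof.
move=> Y X s; have Q := cmod_shift_quasi_inverse A l.
split; [exact: quasi_inverse_kernel Q _ _ _ _ _ (ses_ker s)
       |exact: quasi_inverse_cokernel Q _ _ _ _ _ (ses_coker s)].
Qed.

Lemma coord_hom (I : finType) (e : I -> int) l j :
  exists f : grhom (shift_mod (free A e) l) (shift_mod (regmod A) (l - e j)),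
    forall x, f x = (x : free_type A I) j.
Proof.
have Lf : linear (fun x : shift_mod (free A e) l => (x : free_type A I) j : shift_mod (regmod A) (l - e j)).
  by move=> a x y; rewrite !ffunE.
have Gf n x : mgr (shift_mod (free A e) l) n x ->
    mgr (shift_mod (regmod A) (l - e j)) n ((x : free_type A I) j).
  by move=> Hx; have := Hx j; rewrite /= addrA.
by exists (mkhom Lf Gf).
Qed.

Lemma hom_to_free T (I : finType) (e : I -> int) l
    (f : forall j, grhom T (shift_mod (regmod A) (l - e j))) :
  exists g : grhom T (shift_mod (free A e) l), forall x j, (g x : free_type A I) j = f j x.
Proof.
pose g x : shift_mod (free A e) l := [ffun j => f j x] : free_type A I.
have Lg : linear g by move=> a x y; apply/ffunP => j; rewrite !ffunE linearP.
have Gg n x : mgr T n x -> mgr (shift_mod (free A e) l) n (g x).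
  by move=> Hx j; rewrite ffunE -addrA; exact: (gfunP (f j) Hx).
by exists (mkhom Lg Gg) => x j; rewrite /= ffunE.
Qed.

Lemma extv_free i n (e : 'I_n -> int) l (X : C) :
  (forall j, extv i X (AC (l - e j))) -> extv i X (shC l (cobj (fp_free cohA e))).
Proof.
have Hp j := coord_hom e l j; have {Hp} [p Hp] := dep_choice Hp.
pose F := shC l (cobj (fp_free cohA e)).
pose q j : hom C F (AC (l - e j)) := @ungr _ _ _ F (AC (l - e j)) (p j).
have qE j (x : sval F) : gr (q j) x = (x : free_type A _) j by exact: Hp.
case: i => [|i] H.
  move=> f; apply/heq_gr_eq0 => x; apply/ffunP => j.
  by have /heq_gr_comp0 /(_ x) := H j (comp (q j) f); rewrite qE => ->; rewrite ffunE.
move=> K R PR h; have Ht j := H j K R PR (comp (q j) h).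
have {Ht} [t Ht] := dep_choice Ht.
have [g Hg] := @hom_to_free _ _ e l (fun j => gr (t j)).
exists (@ungr _ _ _ (yhead R) F g); apply/heq_gr_fact => x; apply/ffunP => j.
rewrite ungrK Hg -qE; exact: (proj1 (heq_gr_comp _ _ _ _) (Ht j) x).
Qed.

Lemma free_cover (X : C) : exists n (e : 'I_n -> int) (K : C) (s : ses K X),
  mid s = cobj (fp_free cohA e).
Proof.
have [m HX] := cmod_deg_ge X.
have [n [e [g [Hg Gg He]]]] := deg_ge_generators (fin_pres_fin_gen (svalP X)) HX.
have [f Hf] := free_hom Hg.
have fs y : exists x, f x = y.
  have [a ->] := Gg y; exists ([ffun i => a i] : free_type A _); rewrite Hf.
  by apply: eq_bigr => i _; rewrite ffunE.
pose F := cobj (fp_free cohA e); pose K := cobj (fp_ker cohA f (svalP F) (svalP X)).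
by exists n, e, K, (@full_ses _ _ _ K F X _ f (gker_sexact fs)).
Qed.

Section Regular.
Variable d : nat.
Hypothesis regA : regular A d.

Lemma extv_gt n (X Y : C) : (d < n)%N -> extv n X Y.
Proof.
move=> dn; apply/(extv_gm_cmod cohA).
have [[H _] _] := regA; apply: (@pdim_le_extv _ GM (free A (fun i : 'I_0 => 0)) d) (H _) dn.
by move=> x; apply/ffunP => -[].
Qed.

Lemma extv_residue_ne i l : i <> d -> extv i kC (AC l).
Proof.
move=> id; have [_ [H _]] := regA.
exact/(gm_Ext_dim0 i kC (AC l))/H.
Qed.

Lemma extv_residue_eq : exists l0, (forall l, l <> l0 -> extv d kC (AC l)) /\
  ~ extv d kC (AC l0).
Proof.
have [_ [_ [l Hl]]] := regA; exists (- l); split=> [n nl|].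
  apply/(gm_Ext_dim0 d kC (AC n)); have := Hl n; case: eqP => // e.
  by case: nl; lia.
move=> /(gm_Ext_dim0 d kC (AC (- l))) H; have := Hl (- l); rewrite addNr eqxx => H'.
by have := Ext_dim_unique0 H' H.
Qed.

Lemma extv_residue_bounded i (M : C) : exists s : seq int,
  forall l, l \notin s -> extv i kC (shC l M).
Proof.
have [n Hn] : exists n, (d < i + n)%N by exists d.+1; lia.
elim: n i M Hn => [|n IH] i M Hn.
  by exists [::] => l _; apply: extv_gt; lia.
have [q [e [K [s Hs]]]] := free_cover M.
have [|S HS] := IH i.+1 K; first by lia.
have [l0 [Hl0 _]] := extv_residue_eq.
exists (S ++ [seq l0 + e j | j : 'I_q]) => l; rewrite mem_cat negb_or => /andP[/HS HK He].
have HF : extv i kC (shC l (mid s)).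
  rewrite Hs; apply: extv_free => j; have [->|id] := pselect (i = d).
    apply: Hl0 => lj; case/negP: He; apply/mapP; exists j; first by rewrite mem_enum.
    by rewrite -lj subrK.
  exact: extv_residue_ne.
pose t : ses (shC l K) (shC l M) := fses (cmod_shift_exact l) s.
have [m Hm] := cmod_deg_ge kC.
case: i HK HF {Hn IH HS He} => [|i] HK HF.
  have [L [a [Ha _]]] := cover_ses cohA Hm.
  exact: (extv_mid_quot0 (s := t) (resp_projective cohA Ha) HF HK).
have [K' [R [HR DK']]] := resolution_ex cohA i Hm.
have [L [a [Ha _]]] := cover_ses cohA DK'.
exact: (extv_mid_quot (s := t) (res_projective cohA HR) (resp_projective cohA Ha) HF HK).
Qed.

Lemma chi_holds : chi A.
Proof.
move=> i M FM; split=> [l|].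
  exact: (gm_Ext_dim_ex i kC (shC l (cobj FM))).
have [s Hs] := extv_residue_bounded i (cobj FM).
by exists s => l /Hs H; exact/(extA_dim0 i (cobj FM)).
Qed.

End Regular.

End FiniteExt.

(** * Bounded modules *)

Section Devissage.
Variables (k : fieldType) (A : gralg k).
Hypothesis cohA : coherent A.
Local Notation GM := (GrMod A).
Local Notation C := (cmod A).

Lemma extv_retract i (X X' Y : C) (a : hom C X X') (b : hom C X' X) :
  (comp b a == idm X)%KL -> extv i X' Y -> extv i X Y.
Proof.
move=> ba; case: i => [|n] H.
  by move=> f; rewrite -(compm1 f) -ba compA (H (comp f b)) comp0l.
have [m Hm] := cmod_deg_ge X; have [m' Hm'] := cmod_deg_ge X'.
have [K [R [HR _]]] := resolution_ex cohA n Hm.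
have [K' [R' [HR' _]]] := resolution_ex cohA n Hm'.
have PR := res_projective cohA HR; have PR' := res_projective cohA HR'.
have [c Hc] := yext_lift R' a PR; have [c' Hc'] := yext_lift R b PR'.
apply: (extv_res PR) => h.
have B1 : boundary R' (comp h c') := H _ _ PR' _.
have B2 := boundary_pull Hc B1.
have H1 := yext_mor_heq ba (heq_refl _) (yext_mor_comp Hc Hc').
have B3 := boundary_homotopy h PR (yext_mor1 R) H1.
apply: boundary_heq (compm1 h) _; apply: boundary_sub0 B3 _.
exact: boundary_heq (heq_sym (compA _ _ _)) B2.
Qed.

Lemma eproj_shift (M : GM) l : eproj M -> eproj (shift_mod M l).
Proof.
move=> HM N P e f es.
have Hf n x : mgr M n x -> mgr (shift_mod P (- l)) n (f x).
  by move=> Hx; apply: (gfunP f); rewrite /= subrK.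
have He n x : mgr (shift_mod N (- l)) n x -> mgr (shift_mod P (- l)) n (e x).
  by move=> Hx; exact: (gfunP e Hx).
have [g Hg] := HM (shift_mod N (- l)) (shift_mod P (- l))
  (@GrHom k A (shift_mod N (- l)) (shift_mod P (- l)) e He)
  (@GrHom k A M (shift_mod P (- l)) f Hf) es.
have Hg' n x : mgr (shift_mod M l) n x -> mgr N n (g x).
  by move=> Hx; have := gfunP g Hx; rewrite /= addrK.
by exists (@GrHom k A (shift_mod M l) N g Hg').
Qed.

Lemma shift_adjunct (M N : GM) l (f : grhom (shift_mod M (- l)) N) :
  exists g : grhom M (shift_mod N l), forall x, g x = f x.
Proof.
have Hf n x : mgr M n x -> mgr (shift_mod N l) n (f x).
  by move=> Hx; apply: (gfunP f); rewrite /= addrK.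
by exists (@GrHom k A M (shift_mod N l) f Hf).
Qed.

Lemma shift_adjunct_inv (M N : GM) l (f : grhom M (shift_mod N l)) :
  exists g : grhom (shift_mod M (- l)) N, forall x, g x = f x.
Proof.
have Hf n x : mgr (shift_mod M (- l)) n x -> mgr N n (f x).
  by move=> Hx; have := gfunP f Hx; rewrite /= subrK.
by exists (@GrHom k A (shift_mod M (- l)) N f Hf).
Qed.

Lemma gr_shift l (X Y : C) (f : hom C X Y) x : gr (fhom (cmod_shift A l) f) x = gr f x.
Proof. by []. Qed.

Lemma extv_shift_adjunct i l (X Y : C) :
  extv i X (shC l Y) -> extv i (shC (- l) X) Y.
Proof.
case: i => [|n] H.
  move=> f; have [g Hg] := shift_adjunct (gr f); apply/heq_gr_eq0 => x.
  rewrite -Hg; exact: (proj1 (heq_gr_eq0 _) (H (@ungr _ _ _ X (shC l Y) g)) x).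
have [m Hm] := cmod_deg_ge X; have [K [R [HR _]]] := resolution_ex cohA n Hm.
have PR := res_projective cohA HR.
have PS : yext_all (@projective k C) (fyext (cmod_shift_exact (- l)) R).
  apply: fyext_all; apply: yext_all_imp HR => Z [EZ _].
  exact/(cmod_projective cohA)/eproj_shift.
apply: (extv_res PS) => h; have [g Hg] := shift_adjunct (gr h).
have [t Ht] := H _ _ PR (@ungr _ _ _ K (shC l Y) g).
apply/(fyext_boundary (cmod_shift_exact (- l)) R).
have [t' Ht'] := shift_adjunct_inv (gr t).
exists (@ungr _ _ _ (shC (- l) (yhead R)) Y t'); apply/heq_gr_fact => x.
rewrite ungrK gr_shift Ht' -[RHS]Hg.
exact: (proj1 (heq_gr_fact _ _ _) Ht x).
Qed.

Lemma residue_act_aug (M : GM) (x : M) m : (forall n y, m < n -> mgr M n y -> y = 0) ->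
  mgr M m x -> forall a : A, x *^ a = x *^ ((aug a)%:A : A).
Proof.
move=> HM Hx a; apply/eqP; rewrite -subr_eq0 -ractBa; apply/eqP.
elim: (augP a) => [|i u v Hu _ IH]; first exact: ractx0.
rewrite ractDa IH addr0; apply: (HM (m + i.+1%:Z)); last exact: mgr_act.
by lia.
Qed.

Section DevissageY.
Variables (i : nat) (Y : C) (m0 : int).
Hypothesis HY : forall j, m0 <= j -> extv i (shC (- j) (kC A)) Y.

Lemma extv_zero_module (V : C) : (forall x : sval V, x = 0) -> extv i V Y.
Proof.
move=> V0; apply: (@extv_retract _ _ _ _ (hzero _ _) (hzero _ _)) (HY (lexx m0)).
by apply/heq_gr => x; exact: etrans (V0 _) (esym (V0 _)).
Qed.

Lemma extv_cyclic m (V : C) (x : sval V) : m0 <= m ->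
  (forall n y, m < n -> mgr (sval V) n y -> y = 0) -> mgr (sval V) m x ->
  (forall y, exists c : k, y = x *^ (c%:A : A)) -> extv i V Y.
Proof.
move=> mm HV Hx gx; have [x0|x0] := eqVneq x 0.
  by apply: extv_zero_module => y; have [c ->] := gx y; rewrite x0 ract0.
pose K := shift_mod (resmod A) (- m).
pose f (u : K) : sval V := x *^ ((u : k)%:A : A).
have Lf : linear f.
  move=> a u v; rewrite /f [X in (X : k)%:A](_ : _ = aug (a : A) * (u : k) + (v : k)) //.
  rewrite scalerDl ractDa; congr (_ + _).
  transitivity (x *^ ((u : k)%:A : A) *^ (a : A)); last by [].
  have Hxu : mgr (sval V) m (x *^ ((u : k)%:A : A)) by exact: mgrZ.
  rewrite (residue_act_aug HV Hxu) -ractM -scalerAl mul1r scalerA; congr (_ *^ _).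
  by rewrite mulrC.
have Gf n u : mgr K n u -> mgr (sval V) n (f u).
  case=> [nm|->]; last by rewrite /f scale0r ractx0; exact: mgr0.
  by have -> : n = m by [lia]; exact: mgrZ.
pose b := mkhom Lf Gf.
have bi : injective b.
  apply: ghom_inj => u bu; apply: contra_eq (bu : f u = 0) => u0.
  apply: contra x0 => /eqP fu; apply/eqP.
  have -> : x = f u *^ (((u : k)^-1)%:A : A).
    by rewrite /f -ractM -scalerAl mul1r scalerA divff // scale1r ract1.
  by rewrite fu ract0.
have [a Ha] : exists a : grhom (sval V) K, b \o a =1 gid (sval V).
  by apply: lift_through_inj bi _ => y; have [c ->] := gx y; exists c.
apply: (@extv_retract _ _ (shC (- m) (kC A)) _ (@ungr _ _ _ V (shC (- m) (kC A)) a)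
  (@ungr _ _ _ (shC (- m) (kC A)) V b)) (HY mm).
by apply/heq_gr_fact => y; rewrite !ungrK gr1; exact: Ha.
Qed.

Lemma extv_concentrated m r : m0 <= m -> forall V : C,
  (forall n y, m < n -> mgr (sval V) n y -> y = 0) ->
  (exists v : 'I_r -> sval V, (forall j, mgr (sval V) m (v j)) /\
    forall y, exists c : 'I_r -> k, y = \sum_j v j *^ ((c j)%:A : A)) -> extv i V Y.
Proof.
move=> mm; elim: r => [|r IH] V HV [v [Hv Gv]].
  by apply: extv_zero_module => y; have [c ->] := Gv y; rewrite big_ord0.
pose w j := v (lift ord0 j).
have Hw : homog (fun=> m) w by move=> j; exact: Hv.
pose S := gspan_sub Hw.
have wS j : exists z, gsub_inc S z = w j by apply: gsub_inc_ex; exact: gspan_in.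
have {wS} [z Hz] := choice wS.
have Hzm j : mgr (gsub S) m (z j).
  by apply: (inj_mgr (@gsub_inc_inj _ _ _ S)); rewrite Hz; exact: Hw.
have HS n y : m < n -> mgr (gsub S) n y -> y = 0.
  move=> nm Hy; apply: (@gsub_inc_inj _ _ _ S); rewrite linear0.
  by apply: HV nm _; exact: (gfunP (gsub_inc S) Hy).
have Gz y : exists c : 'I_r -> k, y = \sum_j z j *^ ((c j)%:A : A).
  have [a Ha] := gsub_inc_in y; exists (fun j => aug (a j)).
  apply: (@gsub_inc_inj _ _ _ S); rewrite Ha linear_sum; apply: eq_bigr => j _.
  by rewrite ghomM Hz (residue_act_aug HV (Hw j)).
have FS : fin_pres (gsub S).
  apply: (fp_sub cohA (svalP V)); exists 'I_r, (fun=> m), z; split=> // y.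
  by have [c ->] := Gz y; exists (fun j => (c j)%:A).
pose V' := cobj FS; pose V'' := cobj (fp_coker cohA (gsub_inc S) FS (svalP V)).
pose p := gquo_pi (im_sub (gsub_inc S)).
have ex : sexact (gsub_inc S) p := gcoker_sexact (@gsub_inc_inj _ _ _ S).
pose t := @full_ses _ _ _ V' V V'' (gsub_inc S) p ex.
apply: (@extv_mid _ _ cohA _ _ _ t).
  by apply: IH; [exact: HS|exists z].
apply: (@extv_cyclic m V'' (p (v ord0))) => //.
- move=> n y nm [x [Hx <-]].
  by rewrite (HV _ _ nm Hx) linear0.
- exact: (gfunP p (Hv ord0)).
- move=> y; have [x <-] := gquo_surj y; have [c ->] := Gv x; exists (c ord0).
  rewrite big_ord_recl linearD ghomM linear_sum big1 ?addr0 // => j _.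
  rewrite ghomM -[v _]/(w j) -Hz; have [_ -> _ _] := ex.
  exact: ract0.
Qed.

Lemma extv_bounded s : forall m (V : C), m0 <= m -> deg_ge (sval V) m ->
  deg_lt (sval V) (m + s%:Z) -> extv i V Y.
Proof.
elim: s => [|s IH] m V mm DV LV.
  apply: extv_zero_module => x; apply: pr_eq0 => n.
  case: (ltP n m) => [nm|mn]; first exact: DV nm (mgr_pr _ _).
  by apply: LV (mgr_pr _ _); rewrite addr0.
pose V' := cobj (fp_trunc cohA (m + 1) (svalP V)).
pose f := trunc_inc (sval V) (m + 1).
pose V'' := cobj (fp_coker cohA f (svalP V') (svalP V)).
pose p := gquo_pi (im_sub f).
have ex : sexact f p := gcoker_sexact (@trunc_inc_inj _ _ (sval V) (m + 1)).
pose t := @full_ses _ _ _ V' V V'' f p ex.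
apply: (@extv_mid _ _ cohA _ _ _ t).
  apply: (IH (m + 1)); first by lia.
    exact: trunc_deg_ge.
  move=> n x mn Hx; apply: (@trunc_inc_inj _ _ (sval V) (m + 1)); rewrite linear0.
  by apply: LV (gfunP f Hx); lia.
have V0 n y : m < n -> mgr (sval V'') n y -> y = 0.
  move=> mn [x [Hx <-]]; apply/gquo_eq0.
  have [|z [_ Hz]] := @trunc_inc_surj _ _ (sval V) (m + 1) n x _ Hx; first by lia.
  by exists z.
have V1 n y : n < m -> mgr (sval V'') n y -> y = 0.
  by move=> nm [x [Hx <-]]; rewrite (DV _ _ nm Hx) linear0.
have [r [v [Hv Gv]]] := fin_gen_component m (fin_pres_fin_gen (svalP V'')).
apply: (@extv_concentrated m r mm V'' V0); exists v; split=> // y.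
have -> : y = pr m y.
  rewrite [LHS](@pr_neq0_in _ _ _ y [:: m]) ?big_seq1 // => n; rewrite inE => nm.
  have [nm'|mn|e] := ltrgtP n m; [exact: V1 nm' (mgr_pr _ _)|exact: V0 mn (mgr_pr _ _)|].
  by rewrite e eqxx in nm.
exact/Gv/mgr_pr.
Qed.

Lemma extv_bounded_above m (V : C) : deg_ge (sval V) m0 -> deg_lt (sval V) m -> extv i V Y.
Proof.
move=> DV LV; apply: (@extv_bounded (absz (m - m0)%R) m0) => //.
by move=> n x Hn; apply: LV; lia.
Qed.

End DevissageY.

End Devissage.

(** * Morphisms of qgr A *)

Section LocalizationFunctor.
Variables (k : fieldType) (C : klcat k) (W : forall X Y : C, hom C X Y -> Prop).

Definition loc : functor C (localization W) :=
  @Functor k C (localization W) (fun X => X) (fun X Y f => LHom W f)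
    (fun X Y f g => @lw_hom k C W X Y f g) (fun X => lw_refl (LHom W (idm X)))
    (fun X Y Z g f => lw_homM W g f) (fun X Y f g => lw_homD W f g)
    (fun X Y c f => lw_homZ W c f).

Lemma loc_inv X Y (s : hom C X Y) : W s -> exists v : hom (localization W) (loc Y) (loc X),
  heq (comp v (fhom loc s)) (idm _) /\ heq (comp (fhom loc s) v) (idm _).
Proof. by move=> Ws; exists (LInv Ws); split; [exact: lw_invl|exact: lw_invr]. Qed.

Section Fractions.
Variables (tr : int -> C -> C) (ti : forall m X, hom C (tr m X) X).
Hypothesis ti_factor : forall m m' X Y (f : hom C (tr m X) Y), m' <= m ->
  exists u, heq (comp (ti m' Y) u) f.
Hypothesis W_section : forall X Y (s : hom C X Y), W s -> exists m0 : int, forall m, m0 <= m ->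
  exists f : hom C (tr m Y) X, heq (comp s f) (ti m Y).

Lemma lword_fraction (X Y : C) (w : lword W X Y) : exists m0 : int, forall m, m0 <= m ->
  exists f : hom C (tr m X) Y, lword_eq (LComp w (LHom W (ti m X))) (LHom W f).
Proof.
elim: w => {X Y} [X Y f|X Y s Ws|X Y Z v [m1 H1] w [m2 H2]|X Y v [m1 H1] w [m2 H2]|X Y c w [m1 H1]].
- by exists 0 => m _; exists (comp f (ti m X)); exact/lw_sym/lw_homM.
- have [m0 Hm0] := W_section Ws; exists m0 => m /Hm0 [f Hf]; exists f.
  apply: lw_trans (lw_comp (lw_refl _) (lw_trans (lw_hom W (heq_sym Hf)) (lw_homM _ _ _))) _.
  apply: lw_trans (lw_compA _ _ _) _.
  apply: lw_trans (lw_comp (lw_invl Ws) (lw_refl _)) _.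
  exact: lw_comp1m.
- exists (Num.max m1 m2) => m mm.
  have [|g Hg] := H1 m; first by lia.
  have [|f Hf] := H2 m; first by lia.
  have [u Hu] := ti_factor f (lexx m).
  exists (comp g u); apply: lw_trans (lw_sym (lw_compA _ _ _)) _.
  apply: lw_trans (lw_comp (lw_refl _) (lw_trans Hf (lw_trans (lw_hom W (heq_sym Hu)) (lw_homM _ _ _)))) _.
  apply: lw_trans (lw_compA _ _ _) _.
  apply: lw_trans (lw_comp Hg (lw_refl _)) _.
  exact/lw_sym/lw_homM.
- exists (Num.max m1 m2) => m mm.
  have [|g Hg] := H1 m; first by lia.
  have [|f Hf] := H2 m; first by lia.
  exists (hadd g f); apply: lw_trans (lw_compDl _ _ _) _.
  by apply: lw_trans (lw_add Hg Hf) _; exact/lw_sym/lw_homD.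
- exists m1 => m /H1 [f Hf]; exists (hscale c f).
  apply: lw_trans (lw_compZl _ _ _) _.
  by apply: lw_trans (lw_scale c Hf) _; exact/lw_sym/lw_homZ.
Qed.

Lemma hom_fraction (X Y : C) (w : hom (localization W) (loc X) (loc Y)) :
  exists m0 : int, forall m, m0 <= m ->
  exists f : hom C (tr m X) Y, heq (comp w (fhom loc (ti m X))) (fhom loc f).
Proof. exact: lword_fraction. Qed.

End Fractions.

End LocalizationFunctor.

Lemma generated_hom_eq0 (k : fieldType) (A : gralg k) (M N : grmod A) (f : grhom M N) :
  (forall n x, mgr M n x -> f x = 0) -> forall x, f x = 0.
Proof. by move=> H; exact: (ghom_eq_hom (g := gzero M N) H). Qed.

Section Qgr.
Variables (k : fieldType) (A : gralg k).
Hypothesis cohA : coherent A.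
Local Notation GM := (GrMod A).
Local Notation C := (cmod A).
Local Notation W := (@serre_iso k C (@tors k A)).

Definition tr m (X : C) : C := cobj (fp_trunc cohA m (svalP X)).
Definition ti m (X : C) : hom C (tr m X) X := @ungr _ _ _ (tr m X) X (trunc_inc (sval X) m).

Lemma tiE m (X : C) x : gr (ti m X) x = trunc_inc (sval X) m x.
Proof. by []. Qed.

Lemma ti_inj m (X : C) : injective (gr (ti m X)).
Proof. exact: (@trunc_inc_inj _ _ (sval X) m). Qed.

Lemma ti_surj m (X : C) n x : m <= n -> mgr (sval X) n x ->
  exists y, mgr (sval (tr m X)) n y /\ gr (ti m X) y = x.
Proof. exact: (@trunc_inc_surj _ _ (sval X) m). Qed.

Lemma tr_deg_ge m (X : C) : deg_ge (sval (tr m X)) m.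
Proof. exact: trunc_deg_ge. Qed.

Lemma ti_factor m (T X : C) (f : hom C T X) : deg_ge (sval T) m ->
  exists u : hom C T (tr m X), heq (comp (ti m X) u) f.
Proof.
move=> DT; have [u Hu] := trunc_factor (gr f) DT.
by exists (@ungr _ _ _ T (tr m X) u); apply/heq_gr_fact => x; rewrite ungrK tiE; exact: Hu.
Qed.

Lemma tr_incl m m' (X : C) : m <= m' ->
  exists u : hom C (tr m' X) (tr m X), heq (comp (ti m X) u) (ti m' X).
Proof. by move=> mm; apply: ti_factor; apply: deg_ge_le mm _; exact: tr_deg_ge. Qed.

Lemma ti_mono m (T X : C) (f g : hom C T (tr m X)) :
  heq (comp (ti m X) f) (comp (ti m X) g) -> heq f g.
Proof. by move=> /heq_gr_comp H; apply/heq_gr => x; apply: (@ti_inj m X). Qed.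

Lemma cmod_kernel (X Y : C) (f : hom C X Y) :
  is_kernel f (@ungr _ _ _ (cobj (fp_ker cohA (gr f) (svalP X) (svalP Y))) X
    (gsub_inc (ker_sub (gr f)))).
Proof.
set K := cobj _; split=> [|T g /heq_gr_comp0 fg].
  by apply/heq_gr_comp0 => x; rewrite ungrK; exact: (gsub_inc_in (S := ker_sub (gr f))).
have [u Hu] := @gsub_factor _ _ _ (ker_sub (gr f)) _ (gr g) fg.
exists (@ungr _ _ _ T K u); split=> [|v /heq_gr_fact Hv].
  by apply/heq_gr_fact => x; rewrite !ungrK; exact: Hu.
apply/heq_gr => x; apply: (@gsub_inc_inj _ _ _ (ker_sub (gr f))).
by rewrite ungrK [RHS]Hu -Hv ungrK.
Qed.

Lemma cmod_cokernel (X Y : C) (f : hom C X Y) :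
  is_cokernel f (@ungr _ _ _ Y (cobj (fp_coker cohA (gr f) (svalP X) (svalP Y)))
    (gquo_pi (im_sub (gr f)))).
Proof.
set K := cobj _; split=> [|T g /heq_gr_comp0 gf].
  by apply/heq_gr_comp0 => x; rewrite ungrK; apply/gquo_eq0; exists x.
have [x|u Hu] := desc_through_surj (g := gr g) (@gquo_surj _ _ _ (im_sub (gr f))).
  by move=> /gquo_eq0 [y <-]; exact: gf.
exists (@ungr _ _ _ K T u); split=> [|v /heq_gr_fact Hv].
  by apply/heq_gr_fact => x; rewrite !ungrK; exact: Hu.
apply/heq_gr => q; have [x <-] := gquo_surj q.
by rewrite ungrK [RHS]Hu -Hv ungrK.
Qed.

Lemma serre_iso_bijective (X Y : C) (s : hom C X Y) : W s -> exists m : int,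
  forall n, m <= n -> (forall x, mgr (sval X) n x -> gr s x = 0 -> x = 0) /\
    (forall y, mgr (sval Y) n y -> exists x, mgr (sval X) n x /\ gr s x = y).
Proof.
move=> [[K [i [Ki TK]]] [L [p [Lp TL]]]].
have [m1 H1] := fin_dim_bounded TK; have [m2 H2] := fin_dim_bounded TL.
exists (Num.max m1 m2) => n mn; split=> [x Hx sx|y Hy].
  have [c0 _] := cmod_kernel s; have [_ Hi] := Ki.
  have [u [/heq_gr_fact Hu _]] := Hi _ _ c0.
  have [z Hz] := @gsub_inc_ex _ _ _ (ker_sub (gr s)) _ sx.
  have Dz : mgr (gker (gr s)) n z.
    by apply: (inj_mgr (@gsub_inc_inj _ _ _ (ker_sub (gr s)))); rewrite Hz.
  have e := Hu z; rewrite ungrK Hz in e.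
  rewrite -e (H1 n (gr u z)) ?linear0 //; first by lia.
  exact: (gfunP (gr u) Dz).
have [c0 _] := cmod_cokernel s; have [_ Hp] := Lp.
have [u [/heq_gr_fact Hu _]] := Hp _ _ c0.
have : gquo_pi (im_sub (gr s)) y = 0.
  have e := Hu y; rewrite ungrK in e.
  rewrite -e (H2 n (gr p y)) ?linear0 //; first by lia.
  exact: (gfunP (gr p) Hy).
by move=> /gquo_eq0 ex; exact: surj_mgr ex Hy.
Qed.

Lemma ti_serre_iso m (X : C) : W (ti m X).
Proof.
split.
  do 2!eexists; split; first exact: cmod_kernel.
  apply: (@bounded_fin_dim _ _ _ 0); first exact/fin_pres_fin_gen/svalP.
  move=> n x _ _; apply: (@gsub_inc_inj _ _ _ (ker_sub (gr (ti m X)))).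
  rewrite linear0; apply: (@ti_inj m X); rewrite linear0.
  exact: (gsub_inc_in (S := ker_sub (gr (ti m X)))).
do 2!eexists; split; first exact: cmod_cokernel.
apply: (@bounded_fin_dim _ _ _ m); first exact/fin_pres_fin_gen/svalP.
move=> n _ mn [x [Hx <-]]; apply/gquo_eq0.
by have [y [_ Hy]] := ti_surj mn Hx; exists y.
Qed.

Lemma image_homog (T M N : GM) (f : grhom M N) (g : grhom T N) :
  (forall n t, mgr T n t -> exists x, f x = g t) -> forall t, exists x, f x = g t.
Proof.
move=> H; elim/mgr_ind => [|n x y Hx [u Hu]]; first by exists 0; rewrite !linear0.
by have [v Hv] := H n x Hx; exists (v + u); rewrite !linearD Hu Hv.
Qed.

Lemma serre_iso_section (X Y : C) (s : hom C X Y) : W s -> exists m0 : int, forall m, m0 <= m ->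
  exists f : hom C (tr m Y) X, heq (comp s f) (ti m Y).
Proof.
move=> Ws; have [m0 Hm0] := serre_iso_bijective Ws; exists m0 => m mm.
have [||u Hu] := @lift_through_inj _ _ (sval (tr m Y)) (sval (tr m X)) (sval Y)
    (gcomp (gr s) (gr (ti m X))) (gr (ti m Y)).
- apply: ghom_inj_hom => n x Hx sx; apply: (@ti_inj m X); rewrite linear0.
  case: (ltP n m) => [nm|mn]; first by rewrite (tr_deg_ge nm Hx) linear0.
  have [H _] := Hm0 n (le_trans mm mn); apply: H sx; exact: gfunP.
- apply: image_homog => n y Hy.
  case: (ltP n m) => [nm|mn].
    by exists 0; rewrite (tr_deg_ge nm Hy) !linear0.
  have [_ H] := Hm0 n (le_trans mm mn).
  have [x [Hx xy]] := H _ (gfunP (gr (ti m Y)) Hy).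
  by have [z [_ Hz]] := ti_surj mn Hx; exists z; rewrite /= Hz.
exists (comp (ti m X) (@ungr _ _ _ (tr m Y) (tr m X) u)).
by apply/heq_gr_fact => x; rewrite gr_comp ungrK; exact: Hu.
Qed.

Definition lword_inv (X Y : C) (s : hom C X Y) (y : sval Y) : sval X :=
  match pselect (exists x, [/\ exists n, mgr (sval X) n x /\ mgr (sval Y) n y,
    gr s x = y & y = 0 -> x = 0]) with
  | left H => sval (cid H)
  | right _ => 0
  end.

(* Only meaningful on elements of high degree, where [lword_inv] is an inverse. *)
Fixpoint lword_fun (X Y : C) (w : lword W X Y) : sval X -> sval Y :=
  match w in lword _ X Y return sval X -> sval Y with
  | LHom _ _ f => gr f
  | LInv _ _ s _ => lword_inv s
  | LComp _ _ _ v w => fun x => lword_fun v (lword_fun w x)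
  | LAdd _ _ v w => fun x => lword_fun v x + lword_fun w x
  | LScale _ _ c w => fun x => lword_fun w x *^ (c%:A : A)
  end.

Definition linear_above (X Y : C) (m : int) (f : sval X -> sval Y) : Prop :=
  forall n, m <= n -> [/\ forall x, mgr (sval X) n x -> mgr (sval Y) n (f x),
    forall x y, mgr (sval X) n x -> mgr (sval X) n y -> f (x + y) = f x + f y
    & forall c x, mgr (sval X) n x -> f (x *^ (c%:A : A)) = f x *^ (c%:A : A)].

Lemma lword_inv_spec (X Y : C) (s : hom C X Y) : W s -> exists m : int, forall n, m <= n ->
  (forall x, mgr (sval X) n x -> lword_inv s (gr s x) = x) /\
  (forall y, mgr (sval Y) n y -> mgr (sval X) n (lword_inv s y) /\ gr s (lword_inv s y) = y).
Proof.
move=> Ws; have [m Hm] := serre_iso_bijective Ws; exists m => n mn.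
have [I S] := Hm n mn.
have inv y : mgr (sval Y) n y -> mgr (sval X) n (lword_inv s y) /\ gr s (lword_inv s y) = y.
  move=> Hy; rewrite /lword_inv; case: pselect => [H|[]]; last first.
    have [x [Hx xy]] := S y Hy; exists x; split=> //; first by exists n.
    by move=> y0; apply: I => //; rewrite xy.
  case: cid => x /= [[l [Hx Hl]] sx x0]; split=> //.
  have [<-//|ln] := eqVneq l n.
  by rewrite x0; [exact: mgr0|rewrite -(pr_id Hl); exact: pr_other ln].
split=> // x Hx; have [H1 H2] := inv _ (gfunP (gr s) Hx).
apply/eqP; rewrite -subr_eq0; apply/eqP/I; first exact: mgrB.
by rewrite linearB H2 subrr.
Qed.

Lemma lword_fun_linear (X Y : C) (w : lword W X Y) : exists m, linear_above m (lword_fun w).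
Proof.
elim: w => {X Y} [X Y f|X Y s Ws|X Y Z v [m1 H1] w [m2 H2]|X Y v [m1 H1] w [m2 H2]|X Y c w [m1 H1]].
- exists 0 => n _; split=> [x|x y _ _|c x _]; [exact: gfunP|exact: linearD|exact: ghomM].
- have [m Hm] := lword_inv_spec Ws; exists m => n mn; have [H1 H2] := Hm n mn.
  split=> [y Hy|y z Hy Hz|c y Hy]; first by have [] := H2 y Hy.
    have [Ky ey] := H2 y Hy; have [Kz ez] := H2 z Hz.
    by rewrite /= -{1}ey -{1}ez -linearD H1 //; exact: mgrD.
  have [Ky ey] := H2 y Hy.
  by rewrite /= -{1}ey -ghomM H1 //; exact: mgrZ.
- exists (Num.max m1 m2) => n mn.
  have [|P1 A1 S1] := H1 n; first by lia.
  have [|P2 A2 S2] := H2 n; first by lia.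
  split=> [x Hx|x y Hx Hy|c x Hx] /=; first exact/P1/P2.
    by rewrite A2 // A1 //; exact: P2.
  by rewrite S2 // S1 //; exact: P2.
- exists (Num.max m1 m2) => n mn.
  have [|P1 A1 S1] := H1 n; first by lia.
  have [|P2 A2 S2] := H2 n; first by lia.
  split=> [x Hx|x y Hx Hy|c x Hx] /=; first by apply: mgrD; [exact: P1|exact: P2].
    by rewrite A1 // A2 // addrACA.
  by rewrite S1 // S2 // ractD.
- exists m1 => n /H1 [P1 A1 S1].
  split=> [x Hx|x y Hx Hy|c' x Hx] /=; first exact/mgrZ/P1.
    by rewrite A1 // ractD.
  rewrite S1 // -!ractM; congr (_ *^ _).
  by rewrite -!scalerAl !mul1r !scalerA mulrC.
Qed.

Definition eq_above (X Y : C) (f g : sval X -> sval Y) : Prop :=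
  exists m : int, forall n x, m <= n -> mgr (sval X) n x -> f x = g x.

Lemma lword_eq_fun (X Y : C) (v w : lword W X Y) :
  lword_eq v w -> eq_above (lword_fun v) (lword_fun w).
Proof.
have trans (X' Y' : C) (f g h : sval X' -> sval Y') : eq_above f g -> eq_above g h -> eq_above f h.
  move=> [m1 H1] [m2 H2]; exists (Num.max m1 m2) => n x mn Hx.
  by rewrite (H1 n) ?(H2 n) //; lia.
have now (X' Y' : C) (f g : sval X' -> sval Y') : (forall x, f x = g x) -> eq_above f g.
  by move=> H; exists 0 => n x _ _.
elim=> {X Y v w}.
- by move=> X Y w; exact: now.
- by move=> X Y v w _ [m H]; exists m => n x mn Hx; rewrite (H n).
- by move=> X Y u v w _ H1 _ H2; exact: trans H1 H2.
- move=> X Y Z v v' w w' _ [m1 H1] _ [m2 H2].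
  have [m3 H3] := lword_fun_linear w; exists (Num.max (Num.max m1 m2) m3) => n x mn Hx /=.
  have [|P3 _ _] := H3 n; first by lia.
  have e1 : lword_fun v (lword_fun w x) = lword_fun v' (lword_fun w x).
    by apply: (H1 n); [lia|exact: P3].
  by rewrite e1 (H2 n) //; lia.
- move=> X Y v v' w w' _ [m1 H1] _ [m2 H2]; exists (Num.max m1 m2) => n x mn Hx /=.
  by rewrite (H1 n) ?(H2 n) //; lia.
- by move=> X Y c w w' _ [m1 H1]; exists m1 => n x mn Hx /=; rewrite (H1 n).
- by move=> X Y f g /heq_gr fg; exact: now.
- by move=> X Y Z g f; exact: now.
- by move=> X Y f g; exact: now.
- by move=> X Y c f; exact: now.
- move=> X Y s Ws; have [m Hm] := lword_inv_spec Ws; exists m => n x mn Hx.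
  by have [H _] := Hm n mn; exact: H.
- move=> X Y s Ws; have [m Hm] := lword_inv_spec Ws; exists m => n x mn Hx.
  by have [_ H] := Hm n mn; have [] := H x Hx.
- by move=> X Y Z T u v w; exact: now.
- by move=> X Y w; exact: now.
- by move=> X Y w; exact: now.
- by move=> X Y u v w; apply: now => x; exact: addrA.
- by move=> X Y v w; apply: now => x; exact: addrC.
- by move=> X Y w; apply: now => x; exact: add0r.
- move=> X Y w; apply: now => x /=.
  by rewrite scaleN1r /ract scaleN1r; exact: subrr.
- move=> X Y a b w; apply: now => x /=; rewrite -ractM; congr (_ *^ _).
  by rewrite -scalerAl mul1r scalerA mulrC.
- by move=> X Y w; apply: now => x /=; rewrite scale1r ract1.
- by move=> X Y a v w; apply: now => x; exact: ractD.
- by move=> X Y a b w; apply: now => x /=; rewrite scalerDl ractDa.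
- by move=> X Y Z v v' w; exact: now.
- move=> X Y Z v w w'; have [m1 H1] := lword_fun_linear v.
  have [m2 H2] := lword_fun_linear w; have [m3 H3] := lword_fun_linear w'.
  exists (Num.max (Num.max m1 m2) m3) => n x mn Hx /=.
  have [|_ D1 _] := H1 n; first by lia.
  have [|P2 _ _] := H2 n; first by lia.
  have [|P3 _ _] := H3 n; first by lia.
  by apply: D1; [exact: P2|exact: P3].
- by move=> X Y Z a v w; exact: now.
- move=> X Y Z a v w; have [m1 H1] := lword_fun_linear v.
  have [m2 H2] := lword_fun_linear w.
  exists (Num.max m1 m2) => n x mn Hx /=.
  have [|_ _ S1] := H1 n; first by lia.
  have [|P2 _ _] := H2 n; first by lia.
  by apply: S1; exact: P2.
Qed.

Lemma loc_eq0 (X Y : C) (f : hom C X Y) : heq (fhom (loc W) f) (hzero _ _) ->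
  exists m0 : int, forall m, m0 <= m -> heq (comp f (ti m X)) (hzero _ _).
Proof.
move=> /lword_eq_fun [m0 H]; exists m0 => m mm; apply/heq_gr_comp0.
apply: (@generated_hom_eq0 _ _ _ _ (gcomp (gr f) (gr (ti m X)))) => n x Hx.
case: (ltP n m) => [nm|mn]; first by rewrite (tr_deg_ge nm Hx) linear0.
exact: (H n _ (le_trans mm mn) (gfunP (gr (ti m X)) Hx)).
Qed.

End Qgr.

(** * Ext groups of qgr A *)

Lemma yext_mor_head (k : fieldType) (C : klcat k) n (X K : C) (R : yext n X K) X' K'
    (R' : yext n X' K') (f : hom C X X') (c : hom C K K') :
  yext_mor R R' f c -> exists e, heq (comp e (yinj R)) (comp (yinj R') c).
Proof.
case: n R R' => [|n] R R' /=; first by case=> e [He _]; exists e.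
by case=> l [[e [He _]] _]; exists e.
Qed.

Section QuotientExt.
Variables (k : fieldType) (C Q : klcat k) (F : functor C Q).
Hypothesis EF : exact_functor F.
Variables (Dg Rs : int -> C -> Prop) (tr : int -> C -> C) (ti : forall m X, hom C (tr m X) X).
Hypothesis Dg_le : forall (m m' : int) X, m <= m' -> Dg m' X -> Dg m X.
Hypothesis tr_Dg : forall m X, Dg m (tr m X).
Hypothesis Rs_Dg : forall m X, Rs m X -> Dg m X.
Hypothesis Rs_proj : forall m X, Rs m X -> projective X.
Hypothesis ti_fact : forall m T X (f : hom C T X), Dg m T ->
  exists u, heq (comp (ti m X) u) f.
Hypothesis ti_mono : forall m T X (f g : hom C T (tr m X)),
  heq (comp (ti m X) f) (comp (ti m X) g) -> heq f g.
Hypothesis ti_iso : forall m X, exists v,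
  heq (comp v (fhom F (ti m X))) (idm _) /\ heq (comp (fhom F (ti m X)) v) (idm _).
Hypothesis res_ex : forall m n X, Dg m X ->
  exists K (R : yext n X K), yext_all (Rs m) R /\ Dg m K.
Hypothesis lift_epi : forall (M N : Q) (e : hom Q M N), epi e ->
  forall P (t : hom Q (F P) N), exists q0 : int, forall (q : int) P', q0 <= q -> Rs q P' ->
  forall c : hom C P' P, exists u, heq (comp e u) (comp t (fhom F c)).

Local Open Scope kl_scope.
Local Notation "f - g" := (hadd f (hscale (-1)%R g)) : kl_scope.
Local Notation fy := (fyext EF).

Lemma Rs_all_proj m n X K (R : yext n X K) : yext_all (Rs m) R -> yext_all (@projective k C) R.
Proof. by apply: yext_all_imp => Z; exact: Rs_proj. Qed.

Lemma tr_incl_ex (m m' : int) X : (m <= m')%R -> exists u : hom C (tr m' X) (tr m X), ti m X \o u == ti m' X.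
Proof. by move=> mm; apply: ti_fact; exact: Dg_le mm (tr_Dg _ _). Qed.

Lemma quotient_lift n X X' Y' (E : yext n X' Y') (g : hom Q (F X) X') :
  exists q0 : int, forall (q : int) K (R : yext n (tr q X) K), (q0 <= q)%R -> yext_all (Rs q) R ->
    exists h, yext_mor (fy R) E (g \o fhom F (ti q X)) h.
Proof.
elim: n Y' E => [|n IH] Y' E.
  have [q0 H0] := lift_epi (@ses_epi _ _ _ _ E) g; exists q0 => q K R qq HR.
  have [u Hu] := H0 q _ qq HR (ti q X \o prj R).
  have [|h [_ Hh]] := @ses_mor_kernel _ _ _ _ _ _ (fses EF R) E u (g \o fhom F (ti q X)).
    by rewrite Hu fhomM compA.
  by exists h.
case: E => Z' [s' E]; have [q1 H1] := IH _ E.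
have [K1 [R1 [HR1 _]]] := res_ex n (tr_Dg q1 X).
have [h1 Hh1] := H1 q1 K1 R1 (lexx _) HR1.
have [q0 H0] := lift_epi (@ses_epi _ _ _ _ s') h1.
exists (Num.max q0 q1) => q K R; rewrite ge_max => /andP[qq0 qq1].
case: R => Z [s R] [Hs HR].
have [v Hv] := tr_incl_ex X qq1.
have [c Hc] := yext_lift R1 v (Rs_all_proj HR).
have [u Hu] := H0 q _ qq0 Hs (c \o prj s).
have [|h [_ Hh]] := @ses_mor_kernel _ _ _ _ _ _ (fses EF s) s' u (h1 \o fhom F c).
  by rewrite Hu fhomM compA.
exists h, (h1 \o fhom F c); split; first exact: Hh.
apply: yext_mor_heq (yext_mor_comp (fyext_mor EF Hc) Hh1) => //.
by rewrite -compA -fhomM Hv.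
Qed.

Lemma quotient_homotopy n X p K (R : yext n (tr p X) K) X' Y' (E : yext n X' Y')
    (g : hom Q (F (tr p X)) X') h h' : yext_all (Rs p) R ->
  yext_mor (fy R) E g h -> yext_mor (fy R) E g h' ->
  exists q0 : int, (p <= q0)%R /\ forall (q : int) L (S : yext n (tr q X) L), (q0 <= q)%R ->
    yext_all (Rs q) S -> forall u : hom C (tr q X) (tr p X), ti p X \o u == ti q X ->
    exists c : hom C L K, yext_mor S R u c /\
    exists t, (h - h') \o fhom F c == t \o fhom F (yinj S).
Proof.
elim: n K R Y' E h h' => [|n IH] K R Y' E h h'.
  move=> HR H H'; have [|v Hv] := @ses_homotopy _ _ _ _ _ _ _ _ _ _ _ _ (hzero _ _) H H'.
    by rewrite comp0r haddN.
  exists p; split=> // q L S pq HS u Hu.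
  have [c Hc] := yext_lift R u (Rs_all_proj HS).
  exists c; split=> //.
  have [e He] := yext_mor_head Hc; exists (v \o fhom F e).
  by rewrite Hv -!compA -!fhomM He.
case: R => Z [s R]; case: E => Z' [s' E] [Ps HR].
move=> [hZ [H1 H2]] [hZ' [H1' H2']].
have [q1 [pq1 Hq1]] := IH _ R _ E hZ hZ' HR H2 H2'.
have [L1 [S1 [HS1 _]]] := res_ex n (tr_Dg q1 X).
have [w Hw] := tr_incl_ex X pq1.
have [c1 [Hc1 [t1 Ht1]]] := Hq1 q1 L1 S1 (lexx _) HS1 w Hw.
have [q2 H3] := lift_epi (@ses_epi _ _ _ _ s') t1.
exists (Num.max q1 q2); split; first by rewrite le_max pq1.
move=> q L S; rewrite ge_max => /andP[qq1 qq2].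
case: S => ZS [sS S] [PS HS] u Hu.
have [w2 Hw2] := tr_incl_ex X qq1.
have [c2 Hc2] := yext_lift S1 w2 (Rs_all_proj HS).
have [e2 He2] := yext_mor_head Hc2.
have [v Hv] := H3 q _ qq2 (yext_all_head HS) e2.
have [c Hc] := ses_lift s (c1 \o c2) (Rs_proj PS).
exists c; split.
  exists (c1 \o c2); split; first exact: Hc.
  apply: yext_mor_heq (yext_mor_comp Hc2 Hc1) => //.
  by apply: (@ti_mono p); rewrite compA Hw Hw2 Hu.
have M1 := ses_mor_comp (fses_mor EF Hc) H1.
have M1' := ses_mor_comp (fses_mor EF Hc) H1'.
have [|t Ht] := @ses_homotopy _ _ _ _ _ _ _ _ _ _ _ _ (v \o fhom F (yinj S)) M1 M1'.
  rewrite compA Hv -compBl fhomM compA Ht1 -!compA -!fhomM.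
  by rewrite He2.
by exists t; rewrite compBl Ht.
Qed.

Section Target.
Variables (X Y : C) (n : nat) (m0 : int).
Hypothesis FF_full : forall P (h : hom Q (F P) (F Y)), Dg m0 P -> exists f, h == fhom F f.
Hypothesis FF_faithful : forall P (f g : hom C P Y), Dg m0 P ->
  fhom F f == fhom F g -> f == g.
Hypothesis pushout_ex : forall (K Z : C) (s : ses K Z) (h : hom C K Y),
  exists s' : ses Y Z, is_pushout_ses (fses EF s) (fhom F h) (fses EF s') 1.
Hypothesis stable_inj : forall (m m' : int) K K' (R : yext n (tr m X) K) (R' : yext n (tr m' X) K')
    u c, (m0 <= m)%R -> (m <= m')%R -> yext_all (Rs m) R -> yext_all (Rs m') R' ->
  ti m X \o u == ti m' X -> yext_mor R' R u c ->
  forall h : hom C K Y, boundary R' (h \o c) -> boundary R h.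
Hypothesis stable_surj : forall (m m' : int) K K' (R : yext n (tr m X) K) (R' : yext n (tr m' X) K')
    u c, (m0 <= m)%R -> (m <= m')%R -> yext_all (Rs m) R -> yext_all (Rs m') R' ->
  ti m X \o u == ti m' X -> yext_mor R' R u c ->
  forall h' : hom C K' Y, exists h : hom C K Y, boundary R' (h' - (h \o c)).

Record resol := Resol {
  rdeg : int;
  rker : C;
  rext : yext n (tr rdeg X) rker;
  rdeg_le : (m0 <= rdeg)%R;
  rext_all : yext_all (Rs rdeg) rext;
  rker_Dg : Dg rdeg rker
}.

Lemma resol_ex (m : int) : (m0 <= m)%R -> exists i : resol, rdeg i = m.
Proof.
move=> mm; have [K [R [HR HK]]] := res_ex n (tr_Dg m X).
by exists (@Resol m K R mm HR HK).
Qed.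

Definition trans (i j : resol) (c : hom C (rker i) (rker j)) : Prop :=
  exists u, ti (rdeg j) X \o u == ti (rdeg i) X /\ yext_mor (rext i) (rext j) u c.

Lemma trans_ex (i j : resol) : (rdeg j <= rdeg i)%R -> exists c, @trans i j c.
Proof.
move=> ji; have [u Hu] := tr_incl_ex X ji.
have [c Hc] := yext_lift (rext j) u (Rs_all_proj (rext_all i)).
by exists c, u.
Qed.

Lemma trans_comp i j l (c : hom C (rker i) (rker j)) (c' : hom C (rker j) (rker l)) :
  trans c -> trans c' -> trans (c' \o c).
Proof.
move=> [u [Hu Hc]] [u' [Hu' Hc']]; exists (u' \o u); split; last exact: yext_mor_comp Hc Hc'.
by rewrite compA Hu' Hu.
Qed.

Lemma trans_id i : @trans i i 1.
Proof. by exists 1; split; [rewrite compm1|exact: yext_mor1]. Qed.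

Lemma trans_homotopy i j (c c' : hom C (rker i) (rker j)) Z (h : hom C (rker j) Z) :
  trans c -> trans c' -> boundary (rext i) ((h \o c) - (h \o c')).
Proof.
move=> [u [Hu Hc]] [u' [Hu' Hc']].
apply: (boundary_homotopy h (Rs_all_proj (rext_all i)) Hc).
apply: yext_mor_heq Hc' => //; apply: (@ti_mono (rdeg j)).
by rewrite Hu Hu'.
Qed.

Lemma trans_pull i j (c : hom C (rker i) (rker j)) Z (h : hom C (rker j) Z) :
  trans c -> boundary (rext j) h -> boundary (rext i) (h \o c).
Proof. by move=> [u [_ Hc]]; exact: boundary_pull Hc. Qed.

Lemma yhead_Dg i : Dg m0 (yhead (rext i)).
Proof.
apply: Dg_le (rdeg_le i) _; apply: (Rs_Dg (m := rdeg i)).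
exact: yext_all_head (rext_all i).
Qed.

Lemma ker_Dg i : Dg m0 (rker i).
Proof. exact: Dg_le (rdeg_le i) (rker_Dg i). Qed.

Lemma honest_boundary i (f : hom C (rker i) Y) t :
  fhom F f == t \o fhom F (yinj (rext i)) -> boundary (rext i) f.
Proof.
move=> e; have [t' Ht'] := FF_full t (yhead_Dg i).
exists t'; apply: (FF_faithful (ker_Dg i)).
by rewrite fhomM -Ht' e.
Qed.

Variables (i0 : resol) (N : nat) (th : hom C (rker i0) Y -> 'rV[k]_N).
Hypothesis i0_deg : rdeg i0 = m0.
Hypothesis Hth : lin_quot (boundary (rext i0) (Y := Y)) th.

(* v is the class in Ext^(n+1)(tr m0 X, Y) that corresponds to h. *)
Definition val_rel i (h : hom Q (F (rker i)) (F Y)) (v : 'rV[k]_N) : Prop :=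
  exists f c g, [/\ h == fhom F f, @trans i i0 c,
    boundary (rext i) (f - (g \o c)) & th g = v].

Lemma val_rel_of i (f : hom C (rker i) Y) c : @trans i i0 c -> exists g,
  boundary (rext i) (f - (g \o c)) /\ forall h, h == fhom F f -> val_rel h (th g).
Proof.
move=> Hc; have [u [Hu Hcu]] := Hc.
have [g Hg] : exists g : hom C (rker i0) Y, boundary (rext i) (f - (g \o c)).
  apply: (stable_surj _ _ (rext_all i0) (rext_all i) Hu Hcu).
    by rewrite i0_deg.
  by rewrite i0_deg rdeg_le.
by exists g; split=> // h Hh; exists f, c, g.
Qed.

Lemma val_rel_total i (h : hom Q (F (rker i)) (F Y)) : exists v, val_rel h v.
Proof.
have [f Hf] := FF_full h (ker_Dg i).
have [|c Hc] := @trans_ex i i0; first by rewrite i0_deg rdeg_le.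
by have [g [_ Hg]] := val_rel_of f Hc; exists (th g); exact: Hg.
Qed.

Lemma val_rel_uniq i i' (h : hom Q (F (rker i)) (F Y)) (h' : hom Q (F (rker i')) (F Y)) v v'
    l c c' t :
  @trans l i c -> @trans l i' c' ->
  (h \o fhom F c) - (h' \o fhom F c') == t \o fhom F (yinj (rext l)) ->
  val_rel h v -> val_rel h' v' -> v = v'.
Proof.
move=> Hc Hc' e [f [b [g [Hf Hb Bg <-]]]] [f' [b' [g' [Hf' Hb' Bg' <-]]]].
apply/(lin_quot_eq Hth).
have Bf : boundary (rext l) ((f \o c) - (f' \o c')).
  apply: (honest_boundary (t := t)).
  by rewrite fhomD fhomZ !fhomM -Hf -Hf' e.
have Hl := trans_comp Hc Hb; have [u [Hu Hlu]] := Hl.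
have mm : (m0 <= rdeg i0)%R by rewrite i0_deg.
have ml : (rdeg i0 <= rdeg l)%R by rewrite i0_deg rdeg_le.
apply: (stable_inj mm ml (rext_all i0) (rext_all l) Hu Hlu).
apply: boundary_heq (heq_sym (compBl _ _ _)) _.
have B1 := trans_pull Hc Bg; have B1' := trans_pull Hc' Bg'.
have E1 : boundary (rext l) ((f \o c) - (g \o (b \o c))).
  apply: boundary_heq B1; rewrite compBl -!compA; reflexivity.
have E1' : boundary (rext l) ((f' \o c') - (g' \o (b' \o c'))).
  apply: boundary_heq B1'; rewrite compBl -!compA; reflexivity.
apply: boundary_sub_trans (boundary_subC E1) _.
apply: boundary_sub_trans Bf _.
apply: boundary_sub_trans E1' _.
exact: trans_homotopy g' (trans_comp Hc' Hb') Hl.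
Qed.

Lemma val_rel_fun i (h h' : hom Q (F (rker i)) (F Y)) v v' : h == h' ->
  val_rel h v -> val_rel h' v' -> v = v'.
Proof.
move=> e; apply: (val_rel_uniq (t := 0) (trans_id i) (trans_id i)).
by rewrite e haddN comp0l.
Qed.

Definition resol_val i (h : hom Q (F (rker i)) (F Y)) : 'rV[k]_N := sval (cid (val_rel_total h)).

Lemma resol_valP i (h : hom Q (F (rker i)) (F Y)) : val_rel h (resol_val h).
Proof. exact: svalP. Qed.

Lemma resol_val_eq i (h : hom Q (F (rker i)) (F Y)) v : val_rel h v -> resol_val h = v.
Proof. by apply: val_rel_fun; [reflexivity|exact: resol_valP]. Qed.

Lemma resol_valE i (f : hom C (rker i) Y) c : @trans i i0 c -> exists g,
  boundary (rext i) (f - (g \o c)) /\ forall h, h == fhom F f -> resol_val h = th g.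
Proof.
move=> Hc; have [g [Bg Hg]] := val_rel_of f Hc; exists g; split=> // h Hh.
exact/resol_val_eq/Hg.
Qed.

Lemma resol_trans0 i : exists c, @trans i i0 c.
Proof. by apply: trans_ex; rewrite i0_deg rdeg_le. Qed.

Lemma resol_val_lin i a (h h' : hom Q (F (rker i)) (F Y)) :
  resol_val (h + (a *: h')) = (resol_val h + a *: resol_val h')%R.
Proof.
have [_ D Z _ _] := Hth; have [c Hc] := resol_trans0 i.
have [f Hf] := FF_full h (ker_Dg i); have [f' Hf'] := FF_full h' (ker_Dg i).
have [g [Bg Eg]] := resol_valE f Hc; have [g' [Bg' Eg']] := resol_valE f' Hc.
rewrite (Eg _ Hf) (Eg' _ Hf') -Z -D; apply: resol_val_eq.
exists (f + (a *: f')), c, (g + (a *: g')); split=> //.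
  by rewrite fhomD fhomZ Hf Hf'.
apply: boundary_heq (boundaryD Bg (boundaryZ a Bg')).
rewrite compDl compZl !hscaleDr !hscaleA mulrC.
set x := f; set y := hscale a f'; set z := hscale (-1) (comp g c); set w := hscale _ (comp g' c).
rewrite -!haddA; apply: hadd_heq => //.
by rewrite !haddA (haddC z).
Qed.

Lemma quotient_Ext_dim : Ext_dim n.+1 (F X) (F Y) N.
Proof.
have [Q1 Q2 Q3 Q4 Q5] := Hth.
have valD i (h h' : hom Q (F (rker i)) (F Y)) : resol_val (h + h') = (resol_val h + resol_val h')%R.
  rewrite -[X in _ = (_ + X)%R]scale1r -resol_val_lin; apply: resol_val_eq.
  by have := resol_valP (h + (1%R *: h')); case=> f [c [g [H1 H2 H3 H4]]];
     exists f, c, g; split=> //; rewrite -H1 hscale1.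
have val0 i : resol_val (hzero (F (rker i)) (F Y)) = 0%R.
  have e : resol_val (hzero (F (rker i)) (F Y) + 0) = resol_val (hzero (F (rker i)) (F Y)).
    apply: resol_val_eq; have := resol_valP (hzero (F (rker i)) (F Y)).
    by case=> f [c [g [H1 H2 H3 H4]]]; exists f, c, g; split=> //; rewrite hadd0.
  by move/eqP: e; rewrite valD -subr_eq0 addrK => /eqP.
apply: (@Ext_dim_criterion k Q n (F X) (F Y) N resol
  (fun P => exists m : int, forall i, (m <= rdeg i)%R -> P i)
  (fun i => F (tr (rdeg i) X)) (fun i => F (rker i)) (fun i => fy (rext i))
  (fun i => fhom F (ti (rdeg i) X)) resol_val).
- move=> P P' [m H] [m' H']; exists (Num.max m m') => i; rewrite ge_max => /andP[a b].
  by split; [exact: H|exact: H'].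
- move=> P [m H]; have [|i Hi] := @resol_ex (Num.max m m0); first by rewrite le_max lexx orbT.
  by exists i; apply: H; rewrite Hi le_max lexx.
- by move=> i h h' e; apply: val_rel_fun e (resol_valP _) (resol_valP _).
- exact: valD.
- move=> i c h; have e0 : resol_val (0 + (c *: h)) = (c *: resol_val h)%R.
    by rewrite resol_val_lin val0 add0r.
  rewrite -e0; apply: resol_val_eq.
  have := resol_valP (0 + (c *: h)); case=> f [b [g [H1 H2 H3 H4]]].
  by exists f, b, g; split=> //; rewrite -H1 hadd0.
- move=> X' Y' E g; have [q0 H0] := quotient_lift E g; exists q0 => i Hi.
  exact: H0 Hi (rext_all i).
- move=> X' Y' E g u i i' h h' H H'.
  have [|p Hp] := @resol_ex (Num.max (rdeg i) (rdeg i')); first by rewrite le_max rdeg_le.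
  have [|c Hc] := @trans_ex p i; first by rewrite Hp le_max lexx.
  have [|c' Hc'] := @trans_ex p i'; first by rewrite Hp le_max lexx orbT.
  have [w [Hw Mc]] := Hc; have [w' [Hw' Mc']] := Hc'.
  have N1 : yext_mor (fy (rext p)) E (g \o fhom F (ti (rdeg p) X)) (h \o fhom F c).
    apply: yext_mor_heq (yext_mor_comp (fyext_mor EF Mc) H) => //.
    by rewrite -compA -fhomM Hw.
  have N2 : yext_mor (fy (rext p)) E (g \o fhom F (ti (rdeg p) X)) (h' \o fhom F c').
    apply: yext_mor_heq (yext_mor_comp (fyext_mor EF Mc') H') => //.
    by rewrite -compA -fhomM Hw'.
  have [q0 [pq0 Hq0]] := quotient_homotopy (rext_all p) N1 N2.
  have [|l Hl] := @resol_ex q0; first by exact: le_trans (rdeg_le p) pq0.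
  have [v Hv] : exists v, ti (rdeg p) X \o v == ti (rdeg l) X by apply: tr_incl_ex; rewrite Hl.
  have [|c2 [Mc2 [t Ht]]] := Hq0 (rdeg l) _ (rext l) _ (rext_all l) v Hv; first by rewrite Hl.
  have Hc2 : trans c2 by exists v.
  apply: (val_rel_uniq (t := u \o t) (trans_comp Hc2 Hc) (trans_comp Hc2 Hc') _
    (resol_valP _) (resol_valP _)).
  rewrite -(compA u t) -Ht !fhomM !compBl compBr !compA; reflexivity.
- move=> E E' i i' h h' H H' e.
  have [|p Hp] := @resol_ex (Num.max (rdeg i) (rdeg i')); first by rewrite le_max rdeg_le.
  have [|c Hc] := @trans_ex p i; first by rewrite Hp le_max lexx.
  have [|c' Hc'] := @trans_ex p i'; first by rewrite Hp le_max lexx orbT.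
  have [w [Hw Mc]] := Hc; have [w' [Hw' Mc']] := Hc'.
  have [f [b [g [Hf Hb Bg vg]]]] := resol_valP h.
  have [f' [b' [g' [Hf' Hb' Bg' vg']]]] := resol_valP h'.
  have /(lin_quot_eq Hth) Bgg : th g = th g' by rewrite vg vg'.
  have Hl := trans_comp Hc Hb.
  have B : boundary (rext p) ((f' \o c') - (f \o c)).
    have B1 := trans_pull Hc Bg; have B1' := trans_pull Hc' Bg'.
    have E1 : boundary (rext p) ((f \o c) - (g \o (b \o c))).
      apply: boundary_heq B1; rewrite compBl -!compA; reflexivity.
    have E1' : boundary (rext p) ((f' \o c') - (g' \o (b' \o c'))).
      apply: boundary_heq B1'; rewrite compBl -!compA; reflexivity.
    apply: boundary_sub_trans E1' _.
    apply: boundary_sub_trans (trans_homotopy g' (trans_comp Hc' Hb') Hl) _.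
    apply: boundary_sub_trans (boundary_subC E1).
    apply: boundary_subC; apply: boundary_heq (compBl _ _ _) _.
    exact: trans_pull Hl Bgg.
  have [t Ht] := B.
  have [t' Ht'] : exists t', t' \o yinj (fy (rext p)) == fhom F ((f' \o c') - (f \o c)).
    by apply/(fyext_boundary EF (rext p)); exists (fhom F t); rewrite -fhomM Ht.
  have M1 : yext_mor (fy (rext p)) E (fhom F (ti (rdeg p) X)) (fhom F (f' \o c')).
    have := yext_mor_adjust t' (yext_mor_comp (fyext_mor EF Mc) H).
    apply: yext_mor_heq; first by rewrite -fhomM Hw.
    by rewrite Ht' Hf -fhomM -fhomD hsubK.
  have M2 : yext_mor (fy (rext p)) E' (fhom F (ti (rdeg p) X)) (fhom F (f' \o c')).
    apply: yext_mor_heq (yext_mor_comp (fyext_mor EF Mc') H'); first by rewrite -fhomM Hw'.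
    by rewrite Hf' -fhomM.
  have [v [v1 v2]] := ti_iso (rdeg p) X.
  have [G [HG UG]] : exists G : yext n (F (tr (rdeg p) X)) (F Y),
      is_pushout_yext (fy (rext p)) (fhom F (f' \o c')) G 1.
    case: (n) (rext p) (f' \o c') => [|m] R l.
      by have [s' Hs'] := pushout_ex R l; exists (fses EF s').
    case: R l => Z [s R] l; have [s' Hs'] := pushout_ex s l.
    by exists (existT _ (F Z) (fses EF s', fy R)); exact: pushout_yextS.
  have [G' [GG' G'G]] := yext_base_iso G v2 v1.
  have step E'' : yext_mor (fy (rext p)) E'' (fhom F (ti (rdeg p) X)) (fhom F (f' \o c')) ->
      yext_mor G' E'' 1 1.
    move=> M; have M' : yext_mor G E'' (fhom F (ti (rdeg p) X)) 1.
      by apply: UG; apply: yext_mor_heq M; rewrite ?compm1 ?comp1m.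
    by apply: yext_mor_heq (yext_mor_comp G'G M'); rewrite ?compm1.
  apply: (rst_trans _ _ _ G'); last exact/rst_step/step.
  exact/rst_sym/rst_step/step.
- move=> v; have [h0 Hh0] := Q4 v.
  have [w [v1 v2]] := ti_iso (rdeg i0) X.
  have [G [HG UG]] : exists G : yext n (F (tr (rdeg i0) X)) (F Y),
      is_pushout_yext (fy (rext i0)) (fhom F h0) G 1.
    case: (n) (rext i0) h0 {Hh0} => [|m] R l.
      by have [s' Hs'] := pushout_ex R l; exists (fses EF s').
    case: R l => Z [s R] l; have [s' Hs'] := pushout_ex s l.
    by exists (existT _ (F Z) (fses EF s', fy R)); exact: pushout_yextS.
  have [G' [GG' _]] := yext_base_iso G v2 v1.
  exists G', i0, (fhom F h0); split.
    by apply: yext_mor_heq (yext_mor_comp HG GG'); rewrite ?compm1 ?comp1m.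
  rewrite -Hh0; apply: resol_val_eq.
  exists h0, 1, h0; split=> //; first exact: trans_id.
  by exists 0; rewrite comp0l compm1 haddN.
Qed.

End Target.

End QuotientExt.

Section QuotientOfCoherent.
Variables (k : fieldType) (A : gralg k).
Hypothesis cohA : coherent A.
Local Notation C := (cmod A).
Local Notation tr := (tr cohA).
Local Notation ti := (ti cohA).

Section MonoSes.
Variables (X' X : C) (u : hom C X' X) (Hu : injective (gr u)).

Definition mono_coker : C := cobj (fp_coker cohA (gr u) (svalP X') (svalP X)).
Definition mono_ses : ses X' mono_coker :=
  @full_ses _ _ _ X' X mono_coker (gr u) (gquo_pi (im_sub (gr u))) (gcoker_sexact Hu).

Lemma mono_coker_deg_ge m : deg_ge (sval X) m -> deg_ge (sval mono_coker) m.
Proof. by move=> H n y nm [x [Hx <-]]; rewrite (H _ _ nm Hx) linear0. Qed.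

Lemma mono_coker_deg_lt (m : int) :
  (forall n x, m <= n -> mgr (sval X) n x -> exists y, gr u y = x) ->
  deg_lt (sval mono_coker) m.
Proof.
by move=> H n y mn [x [Hx <-]]; apply/gquo_eq0; exact: (H n x mn Hx).
Qed.

End MonoSes.

Lemma trunc_incl_inj m m' (X : C) (u : hom C (tr m' X) (tr m X)) :
  heq (comp (ti m X) u) (ti m' X) -> injective (gr u).
Proof.
move=> /heq_gr_fact Hu x y xy; apply: (@ti_inj _ _ cohA m' X).
by rewrite -!Hu xy.
Qed.

Lemma trunc_incl_surj m m' (X : C) (u : hom C (tr m' X) (tr m X)) :
  heq (comp (ti m X) u) (ti m' X) ->
  forall n x, m' <= n -> mgr (sval (tr m X)) n x -> exists y, gr u y = x.
Proof.
move=> /heq_gr_fact Hu n x mn Hx.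
have [y [_ Hy]] := ti_surj cohA mn (gfunP (gr (ti m X)) Hx).
by exists y; apply: (@ti_inj _ _ cohA m X); rewrite Hu Hy.
Qed.

Local Open Scope kl_scope.
Local Notation "f - g" := (hadd f (hscale (-1)%R g)) : kl_scope.

Definition residue_vanishing i (Y : C) (m0 : int) : Prop :=
  forall j : int, (m0 <= j)%R -> extv i (shC (- j) (kC A)) Y.

Lemma residue_vanishing_ses i (X' X Y : C) (u : hom C X' X) (Hu : injective (gr u)) m0 m :
  residue_vanishing i Y m0 -> deg_ge (sval X) m0 ->
  (forall n x, (m <= n)%R -> mgr (sval X) n x -> exists y, gr u y = x) ->
  extv i (mono_coker u) Y.
Proof.
move=> HY DX SX; apply: (extv_bounded_above cohA HY (m := m)).
  exact: mono_coker_deg_ge.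
exact: mono_coker_deg_lt.
Qed.

Lemma resp_le m m' (X : C) : (m <= m')%R -> resp m' X -> resp m X.
Proof. by move=> mm [E D]; split=> //; exact: deg_ge_le mm D. Qed.

Lemma stable_restriction_inj n (X Y : C) m0 : residue_vanishing n.+1 Y m0 ->
  forall (m m' : int) K K' (R : yext n (tr m X) K) (R' : yext n (tr m' X) K') u c,
  (m0 <= m)%R -> (m <= m')%R -> yext_all (resp m) R -> yext_all (resp m') R' ->
  ti m X \o u == ti m' X -> yext_mor R' R u c ->
  forall h : hom C K Y, boundary R' (h \o c) -> boundary R h.
Proof.
move=> HY m m' K K' R R' u c m0m mm HR HR' Hu Hc h.
have ui := trunc_incl_inj Hu.
have HQ := residue_vanishing_ses ui HY (deg_ge_le m0m (@tr_deg_ge _ _ cohA m X))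
  (trunc_incl_surj Hu).
have HR'm : yext_all (resp m) R' by apply: yext_all_imp HR' => Z; exact: resp_le.
exact: (@restriction_inj _ _ cohA _ _ Y (mono_ses ui) m n K' K R' R HR'm HR c Hc h HQ).
Qed.

Lemma stable_restriction_surj n (X Y : C) m0 : residue_vanishing n.+2 Y m0 ->
  forall (m m' : int) K K' (R : yext n (tr m X) K) (R' : yext n (tr m' X) K') u c,
  (m0 <= m)%R -> (m <= m')%R -> yext_all (resp m) R -> yext_all (resp m') R' ->
  ti m X \o u == ti m' X -> yext_mor R' R u c ->
  forall h' : hom C K' Y, exists h : hom C K Y, boundary R' (h' - (h \o c)).
Proof.
move=> HY m m' K K' R R' u c m0m mm HR HR' Hu Hc h'.
have ui := trunc_incl_inj Hu.
have HQ := residue_vanishing_ses ui HY (deg_ge_le m0m (@tr_deg_ge _ _ cohA m X))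
  (trunc_incl_surj Hu).
have HR'm : yext_all (resp m) R' by apply: yext_all_imp HR' => Z; exact: resp_le.
exact: (@restriction_surj _ _ cohA _ _ Y (mono_ses ui) m n K' K R' R HR'm HR c Hc h' HQ).
Qed.

Section Quotient.
Variables (Q : klcat k) (F : functor C Q).
Hypothesis F_fraction : forall (X Y : C) (w : hom Q (F X) (F Y)), exists m0 : int,
  forall m, (m0 <= m)%R -> exists f : hom C (tr m X) Y, w \o fhom F (ti m X) == fhom F f.
Hypothesis F_eq0 : forall (X Y : C) (f : hom C X Y), fhom F f == 0 -> exists m0 : int,
  forall m, (m0 <= m)%R -> f \o ti m X == 0.
Hypothesis F_iso : forall m (X : C), exists v,
  v \o fhom F (ti m X) == 1 /\ fhom F (ti m X) \o v == 1.
Hypothesis F_obj : forall Z : Q, exists X, F X = Z.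

Lemma F_zero (X Y : C) : fhom F (hzero X Y) == 0.
Proof. rewrite -(haddN (hzero X Y)) fhomD fhomZ; exact: haddN. Qed.

Lemma ti_cancel m (X : C) Z (w : hom Q (F X) Z) : w \o fhom F (ti m X) == 0 -> w == 0.
Proof.
move=> e; have [v [_ Hv]] := F_iso m X.
by rewrite -(compm1 w) -Hv compA e comp0l.
Qed.

Lemma F_eq0_below (X Y : C) (f : hom C X Y) : fhom F f == 0 -> exists m0 : int,
  forall m, (m0 <= m)%R -> forall T (g : hom C T X), deg_ge (sval T) m -> f \o g == 0.
Proof.
move=> /F_eq0 [m0 H]; exists m0 => m /H e T g DT.
have [u Hu] := ti_factor cohA g DT.
by rewrite -Hu compA e comp0l.
Qed.

Lemma tr_map m (X Y : C) (f : hom C X Y) : exists u : hom C (tr m X) (tr m Y),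
  ti m Y \o u == f \o ti m X.
Proof. by apply: ti_factor; exact: tr_deg_ge. Qed.

Lemma tr_map_surj m (X Y : C) (f : hom C X Y) (u : hom C (tr m X) (tr m Y)) :
  ti m Y \o u == f \o ti m X ->
  (forall n y, (m <= n)%R -> mgr (sval Y) n y -> exists x, mgr (sval X) n x /\ gr f x = y) ->
  forall y, exists x, gr u x = y.
Proof.
move=> /heq_gr_comp Hu fs; apply: ghom_surj_hom => n y Hy.
case: (ltP n m) => [nm|mn].
  by exists 0%R; rewrite linear0 (tr_deg_ge nm Hy).
have [x [Hx xy]] := fs n _ mn (gfunP (gr (ti m Y)) Hy).
have [z [_ Hz]] := ti_surj cohA mn Hx.
by exists z; apply: (@ti_inj _ _ cohA m Y); rewrite Hu Hz xy.
Qed.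

Lemma tr_ses m (X Y : C) (s : ses Y X) (i : hom C (tr m Y) (tr m (mid s)))
    (p : hom C (tr m (mid s)) (tr m X)) :
  ti m _ \o i == inj s \o ti m _ -> ti m _ \o p == prj s \o ti m _ ->
  sexact (gr i) (gr p).
Proof.
move=> /heq_gr_comp Hi /heq_gr_comp Hp.
have [ii pi ex ps] := cmod_sexact cohA s.
have pi0 x : gr p (gr i x) = 0%R.
  by apply: (@ti_inj _ _ cohA m X); rewrite Hp Hi pi linear0.
have pis n x : mgr (sval (tr m (mid s))) n x -> gr p x = 0%R -> exists y, gr i y = x.
  move=> Hx px; case: (ltP n m) => [nm|mn].
    by exists 0%R; rewrite linear0 (tr_deg_ge nm Hx).
  have [y Hy] : exists y, gr (inj s) y = gr (ti m (mid s)) x.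
    by apply: ex; rewrite -Hp px linear0.
  have Dy : mgr (sval Y) n y.
    by apply: (inj_mgr ii); rewrite Hy; exact: (gfunP (gr (ti m (mid s))) Hx).
  have [z [_ Hz]] := ti_surj cohA mn Dy.
  by exists z; apply: (@ti_inj _ _ cohA m (mid s)); rewrite Hi Hz Hy.
split=> //.
- move=> x y xy; apply: (@ti_inj _ _ cohA m Y); apply: ii.
  by rewrite -!Hi xy.
- move=> x px; have H n : exists y, gr i y = pr n x.
    by apply: pis (mgr_pr n x) _; rewrite ghom_pr px pr0.
  have [y Hy] := choice H; have [t [_ _ ->]] := pr_fin x.
  by exists (\sum_(n <- t) y n)%R; rewrite linear_sum; apply: eq_bigr => n _.
- apply: (tr_map_surj (f := prj s)); first exact/heq_gr_comp.
  by move=> n y mn Hy; exact: surj_mgr (ps y) Hy.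
Qed.

Lemma ti_cancel_eq m (X : C) Z (v w : hom Q (F X) Z) :
  v \o fhom F (ti m X) == w \o fhom F (ti m X) -> v == w.
Proof. by move=> e; apply/hsub_eq0/(@ti_cancel m); rewrite compBl e haddN. Qed.

Lemma F_ses_mono0 (X Y : C) (s : ses Y X) T (w : hom Q T (F Y)) :
  fhom F (inj s) \o w == 0 -> w == 0.
Proof.
have [T' eT] := F_obj T; subst T => sw.
have [m1 H1] := F_fraction w; have [f Hf] := H1 m1 (lexx _).
have [m2 H2] : exists m2 : int, forall m, (m2 <= m)%R -> forall T (h : hom C T _),
    deg_ge (sval T) m -> (inj s \o f) \o h == 0.
  by apply: F_eq0_below; rewrite fhomM -Hf compA sw comp0l.
pose m := Num.max m1 m2.
have [|u Hu] := @tr_incl _ _ cohA m1 m T'; first by rewrite le_max lexx.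
have e : f \o u == 0.
  apply: (ses_mono0 (s := s)); rewrite compA; apply: (H2 m).
    by rewrite le_max lexx orbT.
  exact: tr_deg_ge.
apply: (@ti_cancel m).
by rewrite -Hu fhomM compA Hf -fhomM e F_zero.
Qed.

Lemma surj_epi0 (X Y Z : C) (p : hom C X Y) (f : hom C Y Z) :
  (forall y, exists x, gr p x = y) -> f \o p == 0 -> f == 0.
Proof.
move=> ps /heq_gr_comp0 fp; apply/heq_gr_eq0 => y.
by have [x <-] := ps y.
Qed.

Section TruncatedSes.
Variables (X Y : C) (s : ses Y X) (m m1 : int) (mm : (m1 <= m)%R).

Lemma truncated_ses : exists (iY : hom C (tr m Y) (tr m1 Y))
    (iM : hom C (tr m (mid s)) (tr m1 (mid s))) (iX : hom C (tr m X) (tr m1 X))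
    (i : hom C (tr m Y) (tr m (mid s))) (p : hom C (tr m (mid s)) (tr m X))
    (i1 : hom C (tr m1 Y) (tr m1 (mid s))) (p1 : hom C (tr m1 (mid s)) (tr m1 X)),
  [/\ ti m1 Y \o iY == ti m Y, ti m1 _ \o iM == ti m _, ti m1 X \o iX == ti m X
    & [/\ ti m1 _ \o i1 == inj s \o ti m1 _, ti m1 _ \o p1 == prj s \o ti m1 _,
       ti m _ \o p == prj s \o ti m _, iM \o i == i1 \o iY & iX \o p == p1 \o iM]]
  /\ sexact (gr i) (gr p).
Proof.
have [iY HY] := tr_incl cohA Y mm; have [iM HM] := tr_incl cohA (mid s) mm.
have [iX HX] := tr_incl cohA X mm.
have [i Hi] := tr_map m (inj s); have [p Hp] := tr_map m (prj s).
have [i1 Hi1] := tr_map m1 (inj s); have [p1 Hp1] := tr_map m1 (prj s).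
exists iY, iM, iX, i, p, i1, p1; split; last exact: tr_ses Hi Hp.
split=> //; split=> //; apply: (ti_mono (cohA := cohA) (m := m1)).
  by rewrite compA HM Hi compA Hi1 -compA HY.
by rewrite compA HX Hp compA Hp1 -compA HM.
Qed.

End TruncatedSes.

Lemma F_ses_epi0 (X Y : C) (s : ses Y X) T (w : hom Q (F X) T) :
  w \o fhom F (prj s) == 0 -> w == 0.
Proof.
have [T' eT] := F_obj T; subst T => ws.
have [m1 H1] := F_fraction w; have [f Hf] := H1 m1 (lexx _).
have [p1 Hp1] := tr_map m1 (prj s).
have [m2 H2] : exists m2 : int, forall m, (m2 <= m)%R -> forall T (h : hom C T _),
    deg_ge (sval T) m -> (f \o p1) \o h == 0.
  by apply: F_eq0_below; rewrite fhomM -Hf -compA -fhomM Hp1 fhomM compA ws comp0l.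
pose m := Num.max m1 m2.
have mm : (m1 <= m)%R by rewrite le_max lexx.
have [iY [iM [iX [i [p [i1 [p1' [[_ HM HX [_ Hp1' _ _ e2]] [_ _ _ ps]]]]]]]]] := truncated_ses s mm.
have ep : p1 == p1' by apply: (ti_mono (cohA := cohA) (m := m1)); rewrite Hp1 Hp1'.
have e : f \o iX == 0.
  apply: (surj_epi0 ps); rewrite -compA e2 -ep compA; apply: (H2 m).
    by rewrite le_max lexx orbT.
  exact: tr_deg_ge.
apply: (@ti_cancel m).
by rewrite -HX fhomM compA Hf -fhomM e F_zero.
Qed.

Lemma F_exact : exact_functor F.
Proof.
move=> Y X s; split; split.
- by rewrite -fhomM ses_comp0 F_zero.
- move=> T; have [T' <-] := F_obj T => g pg.
  have [m1 H1] := F_fraction g; have [f Hf] := H1 m1 (lexx _).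
  have [m2 H2] : exists m2 : int, forall m, (m2 <= m)%R -> forall T (h : hom C T _),
      deg_ge (sval T) m -> (prj s \o f) \o h == 0.
    by apply: F_eq0_below; rewrite fhomM -Hf compA pg comp0l.
  pose m := Num.max m1 m2.
  have [|u Hu] := @tr_incl _ _ cohA m1 m T'; first by rewrite le_max lexx.
  have [|v Hv] := @ses_kerP _ _ _ _ s _ (f \o u).
    rewrite compA; apply: (H2 m); first by rewrite le_max lexx orbT.
    exact: tr_deg_ge.
  have [t [t1 t2]] := F_iso m T'.
  have e : fhom F (inj s) \o (fhom F v \o t) == g.
    rewrite compA -fhomM Hv fhomM -Hf -(compA g) -fhomM Hu -compA t2.
    exact: compm1.
  exists (fhom F v \o t); split=> // w Hw; apply/hsub_eq0/(@F_ses_mono0 _ _ s).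
  by rewrite compBr Hw e haddN.
- by rewrite -fhomM ses_comp0 F_zero.
- move=> T; have [T' <-] := F_obj T => g gi.
  have [m1 H1] := F_fraction g; have [f Hf] := H1 m1 (lexx _).
  have [i1 Hi1] := tr_map m1 (inj s).
  have [m2 H2] : exists m2 : int, forall m, (m2 <= m)%R -> forall T (h : hom C T _),
      deg_ge (sval T) m -> (f \o i1) \o h == 0.
    by apply: F_eq0_below; rewrite fhomM -Hf -compA -fhomM Hi1 fhomM compA gi comp0l.
  pose m := Num.max m1 m2.
  have mm : (m1 <= m)%R by rewrite le_max lexx.
  have [iY [iM [iX [i [p [i1' [p1 [[_ HM HX [Hi1' _ Hp e1 _]] ex]]]]]]]] := truncated_ses s mm.
  have ei : i1 == i1' by apply: (ti_mono (cohA := cohA) (m := m1)); rewrite Hi1 Hi1'.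
  pose t := @full_ses _ _ _ (tr m Y) (tr m (mid s)) (tr m X) (gr i) (gr p) ex.
  have [|v Hv] := @ses_cokerP _ _ _ _ t _ (f \o iM).
    change (inj t) with i; rewrite -compA e1 -ei compA; apply: (H2 m).
      by rewrite le_max lexx orbT.
    exact: tr_deg_ge.
  change (prj t) with p in Hv.
  have [z [z1 z2]] := F_iso m X.
  have e : (fhom F v \o z) \o fhom F (prj s) == g.
    apply: (@ti_cancel_eq m).
    rewrite -compA -fhomM -Hp fhomM -compA (compA z) z1 comp1m -fhomM Hv.
    by rewrite fhomM -Hf -compA -fhomM HM.
  exists (fhom F v \o z); split=> // w Hw; apply/hsub_eq0/(@F_ses_epi0 _ _ s).
  by rewrite compBl Hw e haddN.
Qed.

Lemma F_lift_epi (M N : Q) (e : hom Q M N) : epi e ->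
  forall P (t : hom Q (F P) N), exists q0 : int, forall (q : int) P', (q0 <= q)%R -> resp q P' ->
  forall c : hom C P' P, exists u, e \o u == t \o fhom F c.
Proof.
have [M' eM] := F_obj M; have [N' eN] := F_obj N; subst M N => He P t.
have [m1 H1] := F_fraction e; have [m2 H2] := F_fraction t.
pose m := Num.max m1 m2.
have [|e' He'] := H1 m; first by rewrite le_max lexx.
have [|t' Ht'] := H2 m; first by rewrite le_max lexx orbT.
pose E := cobj (fp_coker cohA (gr e') (svalP (tr m M')) (svalP N')).
pose p := @ungr _ _ _ N' E (gquo_pi (im_sub (gr e'))).
have pe : p \o e' == 0.
  by apply/heq_gr_comp0 => x; rewrite ungrK; apply/gquo_eq0; exists x.
have p0 : fhom F p == 0.
  apply: (epi_eq0 He); apply: (@ti_cancel m).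
  by rewrite -compA He' -fhomM pe F_zero.
have [m3 H3] := F_eq0 p0.
exists (Num.max m m3) => q P' qq [EP DP] c.
have qm : (m <= q)%R by lia.
have q3 : (m3 <= q)%R by lia.
have [e'' He''] := tr_map q e'.
have es : forall y, exists x, gr e'' x = y.
  apply: (tr_map_surj He'') => n y qn Hy.
  have [z [_ Hz]] := ti_surj cohA qn Hy.
  have /gquo_eq0 [x Hx] : gquo_pi (im_sub (gr e')) y = 0%R.
    by have /heq_gr_comp0 /(_ z) := H3 q q3; rewrite Hz.
  by apply: surj_mgr Hy; exists x.
have [c' Hc'] := ti_factor cohA c (deg_ge_le qm DP).
have [c'' Hc''] := ti_factor cohA (t' \o c') DP.
have [l Hl] := EP _ _ (gr e'') (gr c'') es.
pose l' := @ungr _ _ _ P' (tr q (tr m M')) l.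
have Hl' : e'' \o l' == c'' by apply/heq_gr_fact => x; rewrite ungrK; exact: Hl.
exists (fhom F (ti m M' \o (ti q (tr m M') \o l'))).
rewrite fhomM compA He' -fhomM compA -He'' -compA Hl' Hc'' fhomM -Ht' -compA -fhomM Hc'.
reflexivity.
Qed.

Section FullyFaithful.
Variables (Y : C) (m0 : int).
Hypothesis (HY0 : residue_vanishing 0 Y m0) (HY1 : residue_vanishing 1 Y m0).

Lemma F_full_above P (h : hom Q (F P) (F Y)) : deg_ge (sval P) m0 ->
  exists f, h == fhom F f.
Proof.
move=> DP; have [m H] := F_fraction h; have [f Hf] := H m (lexx _).
have ui := @ti_inj _ _ cohA m P.
have SP n x : (m <= n)%R -> mgr (sval P) n x -> exists y, gr (ti m P) y = x.
  by move=> mn Hx; have [y [_ Hy]] := ti_surj cohA mn Hx; exists y.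
have HQ := residue_vanishing_ses ui HY1 DP SP.
have [g Hg] := @restriction_hom_surj _ _ cohA _ _ Y (mono_ses ui) f HQ.
exists g; apply: (@ti_cancel_eq m); rewrite Hf -fhomM; apply: fhom_heq.
exact: heq_sym Hg.
Qed.

Lemma F_faithful_above P (f g : hom C P Y) : deg_ge (sval P) m0 ->
  fhom F f == fhom F g -> f == g.
Proof.
move=> DP fg; have [|m H] := F_eq0 (f := f - g).
  by rewrite fhomD fhomZ fg haddN.
have ui := @ti_inj _ _ cohA m P.
have SP n x : (m <= n)%R -> mgr (sval P) n x -> exists y, gr (ti m P) y = x.
  by move=> mn Hx; have [y [_ Hy]] := ti_surj cohA mn Hx; exists y.
have HQ := residue_vanishing_ses ui HY0 DP SP.
apply/hsub_eq0; apply: (@restriction_hom_inj _ _ _ _ Y (mono_ses ui) (f - g) HQ).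
exact: H m (lexx _).
Qed.

End FullyFaithful.

Lemma F_pushout (K Z Y : C) (s : ses K Z) (h : hom C K Y) :
  exists s' : ses Y Z, is_pushout_ses (fses F_exact s) (fhom F h) (fses F_exact s') 1.
Proof.
have exs := cmod_sexact cohA s.
have [w [wi wE [i' [p' [e [qE [E1 E2 E3 E4 E5]]]]]]] := sexact_pushout (gr h) exs.
pose D := cobj (fp_prod cohA (svalP (mid s)) (svalP Y)).
pose Qo := cobj (fp_coker cohA w (svalP K) (svalP D)).
pose s' := @full_ses _ _ _ Y Qo Z i' p' E1.
pose ws := @full_ses _ _ _ K D Qo w (gquo_pi (im_sub w)) (gcoker_sexact wi).
pose e0 := @ungr _ _ _ (mid s) Qo e.
pose fs := @ungr _ _ _ D (mid s) (gfst (sval (mid s)) (sval Y)).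
pose sn := @ungr _ _ _ D Y (gsnd (sval (mid s)) (sval Y)).
pose il := @ungr _ _ _ (mid s) D (ginl (sval (mid s)) (sval Y)).
pose ir := @ungr _ _ _ Y D (ginr (sval (mid s)) (sval Y)).
have fsw : fs \o inj ws == inj s by apply/heq_gr_fact => x; rewrite !ungrK wE.
have snw : sn \o inj ws == (-1)%R *: h.
  by apply/heq_gr_fact => x; rewrite gr_scale !ungrK wE /= scaleN1r /ract scaleN1r.
have qil : prj ws \o il == e0.
  by apply/heq_gr_fact => x; rewrite !ungrK; have := qE x 0%R; rewrite linear0 addr0.
have qir : prj ws \o ir == inj s'.
  by apply/heq_gr_fact => x; rewrite !ungrK; have := qE 0%R x; rewrite linear0 add0r.
have fil : fs \o il == 1 by apply/heq_gr_fact.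
have fir : fs \o ir == 0 by apply/heq_gr_comp0.
have sil : sn \o il == 0 by apply/heq_gr_comp0.
have sir : sn \o ir == 1 by apply/heq_gr_fact.
have pq : prj s' \o prj ws == prj s \o fs.
  apply/heq_gr_comp => -[x y]; rewrite [gr (prj ws) _](qE x y).
  by have [_ pi' _ _] := E1; rewrite linearD !ungrK [X in (X + _)%R]E3 [X in (_ + X)%R]pi' addr0.
exists s'; split.
  have : ses_mor s s' h 1.
    exists e0; split; last by apply/heq_gr_comp => x; rewrite gr1; exact: E3.
    by apply/heq_gr_comp => x; exact: E2.
  by move=> /(fses_mor F_exact); apply: ses_mor_heq => //; exact: fhom1.
move=> Y' X' s'' g f [a [a1 a2]].
pose c := (a \o fhom F fs) + (inj s'' \o g \o fhom F sn).
have [|u Hu] := @ses_cokerP _ _ _ _ (fses F_exact ws) _ c.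
  rewrite compDl -!compA -!fhomM fsw snw fhomZ !compZr.
  by rewrite [comp a _]a1 haddN.
exists u; split.
  rewrite -[inj (fses F_exact s')]/(fhom F (inj s')) -qir fhomM compA Hu compDl.
  rewrite -(compA a) -(compA (inj s'' \o g)) -!fhomM fir sir F_zero fhom1 comp0r hadd0.
  exact: compm1.
have M'w : fhom F (prj s') \o fhom F (prj ws) == fhom F (prj s) \o fhom F fs.
  by rewrite -!fhomM pq.
have a2' : prj s'' \o a == f \o fhom F (prj s).
  by rewrite a2; apply: comp_heq => //; exact: compm1.
apply/hsub_eq0/(@F_ses_epi0 _ _ ws).
change (prj (fses F_exact s')) with (fhom F (prj s')).
rewrite compBl -compA Hu -(compA f) M'w compDr !compA a2' ses_comp0 !comp0l hadd0r.
exact: haddN.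
Qed.

Theorem quotient_Ext_dim_succ n (X Y : C) (m0 : int) K (R : yext n (tr m0 X) K) N
    (th : hom C K Y -> 'rV[k]_N) :
  residue_vanishing 0 Y m0 -> residue_vanishing 1 Y m0 ->
  residue_vanishing n.+1 Y m0 -> residue_vanishing n.+2 Y m0 ->
  yext_all (resp m0) R -> deg_ge (sval K) m0 ->
  lin_quot (boundary R (Y := Y)) th -> Ext_dim n.+1 (F X) (F Y) N.
Proof.
move=> H0 H1 Hn Hn1 HR HK Hth.
pose Dg (m : int) (Z : C) := deg_ge (sval Z) m.
have Dg_le (m m' : int) (Z : C) : (m <= m')%R -> Dg m' Z -> Dg m Z by exact: deg_ge_le.
have Dg_tr (m : int) (Z : C) : Dg m (tr m Z) by exact: tr_deg_ge.
have Rs_Dg (m : int) (Z : C) : resp m Z -> Dg m Z by case.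
have Rs_proj (m : int) (Z : C) : resp m Z -> projective Z by exact: resp_projective.
have fact (m : int) (T Z : C) (f : hom C T Z) : Dg m T -> exists u, ti m Z \o u == f.
  exact: ti_factor.
have mono (m : int) (T Z : C) (f g : hom C T (tr m Z)) : ti m Z \o f == ti m Z \o g -> f == g.
  exact: ti_mono.
have res (m : int) l (Z : C) : Dg m Z -> exists K (R : yext l Z K), yext_all (resp m) R /\ Dg m K.
  exact: resolution_ex.
exact: (@quotient_Ext_dim k C Q F F_exact Dg (@resp k A) tr ti Dg_le Dg_tr Rs_Dg Rs_proj fact mono
  F_iso res F_lift_epi X Y n m0 (F_full_above H1) (F_faithful_above H0)
  (fun K Z s h => F_pushout s h) (stable_restriction_inj Hn) (stable_restriction_surj Hn1)
  (@Resol k C Dg (@resp k A) tr X n m0 m0 K R (lexx _) HR HK) N th erefl Hth).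
Qed.

Theorem quotient_Ext_dim_hom (X Y : C) (m0 : int) N (th : hom C (tr m0 X) Y -> 'rV[k]_N) :
  residue_vanishing 0 Y m0 -> residue_vanishing 1 Y m0 ->
  lin_quot (fun h => h == 0) th -> Ext_dim 0 (F X) (F Y) N.
Proof.
move=> H0 H1 [Q1 Q2 Q3 Q4 Q5].
have full (w : hom Q (F X) (F Y)) : exists f, w \o fhom F (ti m0 X) == fhom F f.
  by apply: (F_full_above H1); exact: tr_deg_ge.
have faithful (f g : hom C (tr m0 X) Y) : fhom F f == fhom F g -> f == g.
  by apply: (F_faithful_above H0); exact: tr_deg_ge.
have [phi Hphi] := choice full.
have phi_eq w f : w \o fhom F (ti m0 X) == fhom F f -> th (phi w) = th f.
  by move=> e; apply/Q1/faithful; rewrite -Hphi.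
apply: (@Ext_dim_hom _ _ _ _ _ (th \o phi)%FUN); split=> /=.
- by move=> w w' e; apply: phi_eq; rewrite e.
- move=> w w'; rewrite -Q2; apply: phi_eq.
  by rewrite compDl !Hphi fhomD.
- move=> c w; rewrite -Q3; apply: phi_eq.
  by rewrite compZl Hphi fhomZ.
- move=> v; have [f Hf] := Q4 v; have [t [t1 _]] := F_iso m0 X.
  exists (fhom F f \o t); rewrite -Hf; apply: phi_eq.
  by rewrite -compA t1 compm1.
- move=> w; rewrite Q5; split=> [e|e].
    by apply: (@ti_cancel m0); rewrite Hphi e F_zero.
  by apply: faithful; rewrite -Hphi e comp0l F_zero.
Qed.

End Quotient.
End QuotientOfCoherent.

(** * Minimal resolutions and vanishing of Ext^d *)

Section MinimalCovers.
Variables (k : fieldType) (A : gralg k).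
Implicit Types (M : grmod A).

Lemma agrz_aug n (a : A) : agrz n a -> n != 0 -> aug a = 0.
Proof.
case: n => [[|n]|n] //= Ha _; first exact: aug_pos Ha.
by rewrite Ha; apply: aug_eq; rewrite scale0r subr0; exact: Aplus0.
Qed.

Lemma agrz_scalar (a : A) : agrz 0 a -> a = (aug a)%:A.
Proof.
move=> /agr_conn [c ->]; congr (_ *: _); apply/esym/aug_eq.
by rewrite subrr; exact: Aplus0.
Qed.

Lemma aug_homog_coef (a : A) : aug (homog_coef 0 a) = aug a.
Proof.
elim/(@mgr_ind _ _ (regmod A)): a => [|n x y Hx IH].
  by rewrite /homog_coef pr0.
rewrite /homog_coef prD [LHS]augD [RHS]augD; congr (_ + _); last exact: IH.
have [e|n0] := eqVneq n 0; first by rewrite -e (pr_id Hx).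
rewrite (pr_other Hx) 1?eq_sym // [RHS](agrz_aug Hx n0).
by apply: aug_eq; rewrite scale0r subr0; exact: Aplus0.
Qed.

Lemma generates_lift M n (e : 'I_n.+1 -> int) (g : 'I_n.+1 -> M) (x : 'I_n.+1 -> A) j :
  homog e g -> generates g -> \sum_i g i *^ x i = 0 -> aug (x j) != 0 ->
  generates (fun i => g (lift j i)).
Proof.
move=> Hg Gg gx xj; pose g' i := g (lift j i).
pose y i := homog_coef (e j - e i) (x i).
have gy : \sum_i g i *^ y i = 0.
  have := congr1 (pr (e j)) gx; rewrite pr0 pr_sum => {2}<-; apply: eq_bigr => i _.
  exact/esym/pr_homog_act.
have Hyj : y j = (aug (x j))%:A.
  rewrite /y subrr -aug_homog_coef; apply: agrz_scalar; exact: homog_coefP.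
have Gj : gspan g' (g j).
  have -> : g j = (\sum_i g' i *^ y (lift j i)) *^ ((- (aug (x j))^-1)%:A : A).
    have e1 : \sum_i g' i *^ y (lift j i) = - (g j *^ ((aug (x j))%:A : A)).
      by move/eqP: gy; rewrite (bigD1_ord j) //= Hyj addrC addr_eq0 => /eqP.
    rewrite e1 ractN -ractM -scalerAl mul1r scalerA mulrN divff // scaleN1r.
    by rewrite -[- 1]sub0r ractBa ractx0 ract1 sub0r opprK.
  by apply: gspanM; exists (fun i => y (lift j i)).
move=> z; have [a ->] := Gg z; apply: gspan_sum => i _; apply: gspanM.
by case: (unliftP j i) => [i' ->|->] //; exact: (gspan_in g').
Qed.

Lemma minimal_cover M : fin_gen M -> exists n (e : 'I_n -> int) (p : grhom (free A e) M),
  (forall y, exists x, p x = y) /\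
  forall x, p x = 0 -> forall j, aug ((x : free_type A _) j) = 0.
Proof.
move=> FM; pose P n := `[< exists (e : 'I_n -> int) (g : 'I_n -> M), homog e g /\ generates g >].
have [|n /asboolP [e [g [Hg Gg]]] Hmin] := @ex_minnP P.
  have [m Hm] := fin_gen_deg_ge FM; have [n [e [g [Hg Gg _]]]] := deg_ge_generators FM Hm.
  by exists n; apply/asboolP; exists e, g.
have [p Hp] := free_hom Hg; exists n, e, p; split=> [y|x px j].
  have [a ->] := Gg y; exists ([ffun i => a i] : free_type A _); rewrite Hp.
  by apply: eq_bigr => i _; rewrite ffunE.
apply/eqP/negPn/negP => xj.
case: n e g Hg Gg Hmin p Hp x px j xj => [|n] e g Hg Gg Hmin p Hp x px j xj; first by case: j xj.
have := Hmin n; rewrite ltnn => H; apply: notF; apply: H; apply/asboolP.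
exists (fun i => e (lift j i)), (fun i => g (lift j i)); split=> [i|]; first exact: Hg.
by apply: (generates_lift Hg Gg _ xj); rewrite -Hp.
Qed.

(* r maps F to ker p, inside F A_+; so ker p = r (ker p) lies in (ker p) A_+, and *)
(* is zero by induction on the degree.                                          *)
Lemma minimal_cover_inj M n (e : 'I_n -> int) (p : grhom (free A e) M)
    (r : grhom (free A e) (free A e)) :
  (forall x, p x = 0 -> forall j, aug ((x : free_type A _) j) = 0) ->
  (forall x, p (r x) = 0) -> (forall x, p x = 0 -> r x = x) -> injective p.
Proof.
move=> pm pr rp; have [m Hm] := fin_gen_deg_ge (free_fin_gen A e).
have K0 N : forall (l : int) x, l < m + N%:Z -> mgr (free A e) l x -> p x = 0 -> x = 0.
  elim: N => [|N IH] l x lm Hx px; first by apply: Hm Hx; lia.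
  rewrite -(rp x px) [X in r X]free_genE linear_sum big1 // => i _; rewrite ghomM.
  have Hi := Hx i; have Hr := gfunP r (free_gen_homog A e i).
  case: (ltgtP l (e i)) => li.
  - by rewrite (agrz_neg _ Hi) ?ractx0 //; lia.
  - have lN : e i < m + N%:Z by move: lm li; lia.
    by rewrite (IH _ _ lN Hr (pr _)) ract0.
  - have xi0 : ((x : free_type A _) i : A) = 0.
      move: Hi; rewrite li subrr => /agrz_scalar; have := pm x px i => /= a0 ->.
      by apply: etrans (scale0r (1 : A)); congr (_ *: _); exact: a0.
    exact: etrans (congr1 (ract _) xi0) (ractx0 _).
apply: ghom_inj => x px; apply/pr_eq0 => l.
apply: (@K0 (absz (l - m)%R).+1 l); first by lia.
  exact: mgr_pr.
by rewrite ghom_pr px pr0.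
Qed.

Lemma free_entry (I : finType) (e : I -> int) l j :
  exists f : grhom (shift_mod (regmod A) (l - e j)) (shift_mod (free A e) l),
    forall x, (f x : free_type A I) j = x.
Proof.
have H j' : exists f : grhom (shift_mod (regmod A) (l - e j)) (shift_mod (regmod A) (l - e j')),
    j' = j -> forall x, f x = x :> A.
  have [->|ne] := eqVneq j' j; first by exists (gid _).
  by exists (gzero _ _) => ej; rewrite ej eqxx in ne.
have [f Hf] := dep_choice H; have [g Hg] := hom_to_free f.
by exists g => x; rewrite Hg; exact: Hf.
Qed.

End MinimalCovers.

Section Depth.
Variables (k : fieldType) (A : gralg k).
Hypothesis cohA : coherent A.
Local Notation C := (cmod A).
Local Notation FC e := (cobj (fp_free cohA e)).
Local Notation kC := (kC A).
Local Notation AC := (AC A).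

Lemma extv_free_inv i n (e : 'I_n -> int) l j (X : C) :
  extv i X (shC l (FC e)) -> extv i X (AC (l - e j)).
Proof.
have [p Hp] := coord_hom A e l j; have [q Hq] := free_entry A e l j.
pose F := shC l (FC e); pose p' := @ungr _ _ _ F (AC (l - e j)) p.
pose q' := @ungr _ _ _ (AC (l - e j)) F q.
have pq : heq (comp p' q') (idm _).
  by apply/heq_gr_fact => x; rewrite gr1 !ungrK Hp; exact: Hq.
exact: extv_iso pq.
Qed.

Lemma free_boundary i n (e : 'I_n -> int) l (X K : C) (R : yext i X K)
    (h : hom C K (shC l (FC e))) :
  (forall j, exists t : hom C (yhead R) (AC (l - e j)), forall x,
    gr t (gr (yinj R) x) = (gr h x : free_type A _) j) -> boundary R h.
Proof.
move=> H; have [t Ht] := dep_choice H.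
have [g Hg] := @hom_to_free _ _ _ _ e l (fun j => gr (t j)).
exists (@ungr _ _ _ (yhead R) (shC l (FC e)) g); apply/heq_gr_fact => x; apply/ffunP => j.
by rewrite ungrK Hg Ht.
Qed.

Variable d : nat.
Hypothesis regA : regular A d.

(* Ext^d(k, A[l]) is not zero for one l only, while the entries of i have        *)
(* positive degrees.                                                            *)
Lemma minimal_entry_boundary n (e : 'I_n -> int) n' (e' : 'I_n' -> int)
    (i : hom C (FC e') (FC e)) l m (K : C) (R : yext m kC K) (h : hom C K (shC l (FC e'))) :
  m.+1 = d -> yext_all (@projective k C) R ->
  (forall x j, aug ((gr i x : free_type A _) j) = 0) ->
  boundary R (comp (fhom (cmod_shift A l) i) h).
Proof.
move=> md PR im; apply: free_boundary => j.
have [l0 [Hl0 _]] := extv_residue_eq cohA regA; rewrite -md in Hl0.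
have [p Hp] := coord_hom A e l j.
have [lj|lj] := eqVneq (l - e j) l0; last first.
  have [t Ht] := Hl0 _ (elimN eqP lj) K R PR
    (comp (@ungr _ _ _ (shC l (FC e)) (AC (l - e j)) p) (comp (fhom (cmod_shift A l) i) h)).
  exists t => x; have /heq_gr_comp /(_ x) -> := Ht.
  by rewrite gr_comp ungrK Hp.
have Hu j' : exists u : grhom (sval (yhead R)) (shift_mod (regmod A) (l - e' j')),
    e' j' != e j -> forall x, u (gr (yinj R) x) = (gr h x : free_type A _) j'.
  have [ej|ne] := eqVneq (e' j') (e j); first by exists (gzero _ _).
  have [p' Hp'] := coord_hom A e' l j'.
  have [|t Ht] := Hl0 (l - e' j') _ K R PR
      (comp (@ungr _ _ _ (shC l (FC e')) (AC (l - e' j')) p') h).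
    by move=> lj'; case/eqP: ne; lia.
  by exists (gr t) => _ x; have /heq_gr_comp /(_ x) := Ht; rewrite ungrK Hp'.
have [u {}Hu] := dep_choice Hu; have [t Ht] := hom_to_free u.
pose t' := @ungr _ _ _ (yhead R) (shC l (FC e')) t.
pose P' := @ungr _ _ _ (shC l (FC e)) (AC (l - e j)) p.
exists (comp P' (comp (fhom (cmod_shift A l) i) t')).
have Pt v : gr (comp P' (comp (fhom (cmod_shift A l) i) t')) v =
    (gr i (gr t' v : free A e') : free_type A _) j.
  by apply: etrans (Hp _) _; rewrite gr_comp gr_shift.
move=> x; apply: etrans (Pt _) _.
rewrite [X in _ = (X : free_type A _) j]gr_comp.
pose y : free A e' := gr t' (gr (yinj R) x); pose z : free A e' := gr h x.
have yz j' : e' j' != e j -> (y : free_type A _) j' = (z : free_type A _) j'.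
  by move=> ne; rewrite -[RHS](Hu j' ne) -Ht.
have ix (v : free A e') : (gr i v : free_type A _) j =
    \sum_j' ((gr i (free_gen A e' j') : free_type A _) j : A) * ((v : free_type A _) j' : A).
  rewrite {1}(free_genE v) linear_sum free_sumE; apply: eq_bigr => j' _.
  by rewrite ghomM free_actE.
apply: etrans (ix y) _; apply: etrans _ (esym (ix z)); apply: eq_bigr => j' _.
have [ej|ne] := eqVneq (e' j') (e j); last by rewrite yz.
have a0 : ((gr i (free_gen A e' j') : free_type A _) j : A) = 0.
  have := gfunP (gr i) (free_gen_homog A e' j') => /(_ j); rewrite ej subrr => /agrz_scalar ->.
  by apply: etrans (scale0r (1 : A)); congr (_ *: _); exact: im.
by rewrite a0 !mul0r.
Qed.

Lemma minimal_resolution_step (X : C) : exists n (e : 'I_n -> int) (L : C)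
    (i : hom C L (FC e)) (p : hom C (FC e) X),
  sexact (gr i) (gr p) /\ forall x j, aug ((gr i x : free_type A _) j) = 0.
Proof.
have [n [e [p [ps pm]]]] := minimal_cover (fin_pres_fin_gen (svalP X)).
exists n, e, (cobj (fp_ker cohA p (svalP (FC e)) (svalP X))).
exists (@ungr _ _ _ (cobj (fp_ker cohA p (svalP (FC e)) (svalP X))) (FC e) (gsub_inc (ker_sub p))).
exists (@ungr _ _ _ (FC e) X p); rewrite !ungrK; split; first exact: gker_sexact.
by move=> x j; apply: pm; exact: (gsub_inc_in (S := ker_sub p)).
Qed.

Lemma FC_projective n (e : 'I_n -> int) : projective (FC e : C).
Proof. exact/cmod_projective/eproj_free. Qed.

Lemma projective_free (X : C) : (forall Y, extv 1 X Y) ->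
  exists n (e : 'I_n -> int) (p : hom C (FC e) X) (q : hom C X (FC e)),
  heq (comp q p) (idm _) /\ heq (comp p q) (idm _).
Proof.
move=> HX; have [n [e [L [i [p [ex im]]]]]] := minimal_resolution_step X.
pose s := @full_ses _ _ _ L (FC e) X (gr i) (gr p) ex.
have [t /heq_gr_fact Ht] := HX L L (s : yext 0 X L) (@FC_projective _ e) (idm L).
have [ii pi pex ps] := ex; exists n, e, p.
have pinj : injective (gr p).
  apply: (@minimal_cover_inj _ _ _ _ _ _ (gcomp (gr i) (gr t))) => [x px j|x|x px] /=.
  - by have [y <-] := pex x px; exact: im.
  - exact: pi.
  - by have [y <-] := pex x px; rewrite [gr t _]Ht gr1.
have [q Hq] := lift_through_inj (g := gid (sval X)) pinj ps.
exists (@ungr _ _ _ X (FC e) q); split; apply/heq_gr_fact => x; rewrite gr1 ungrK.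
  by apply: pinj; exact: Hq.
exact: Hq.
Qed.

Lemma free_zero n (e : 'I_n -> int) : (forall l, extv d kC (shC l (FC e))) ->
  forall x : free A e, x = 0.
Proof.
move=> H x; have [l0 [_ Hl0]] := extv_residue_eq cohA regA.
case: n e H x => [|n] e H x; first by apply/ffunP => -[].
by case: Hl0; rewrite -(addrK (e ord0) l0); exact: extv_free_inv (H _).
Qed.

Lemma depth_syzygy (X : C) (HX : forall l, extv 0 kC (shC l X)) i : (i < d)%N ->
  exists K : C, (forall n Y, extv n.+1 K Y <-> extv (n + i).+1 X Y) /\
    forall l, extv i kC (shC l K).
Proof.
elim: i => [|i IH] di; first by exists X; split=> // n Y; rewrite addn0.
have [K [H1 H2]] := IH (ltnW di).
have [n [e [L [i' [p [ex _]]]]]] := minimal_resolution_step K.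
pose s := @full_ses _ _ _ L (FC e) K (gr i') (gr p) ex.
exists L; split=> [n' Y|l].
  rewrite addnS -addSn -H1; split=> [H|].
    have [m Hm] := cmod_deg_ge L; have [K' [R [HR _]]] := resolution_ex cohA n' Hm.
    exact: (@extv_shift _ _ _ _ _ _ s _ R (@FC_projective _ e) (res_projective cohA HR) H).
  exact: (@extv_unshift _ _ _ _ _ _ s (@FC_projective _ e)).
pose t : ses (shC l L) (shC l K) := fses (cmod_shift_exact l) s.
have HF : extv i.+1 kC (shC l (FC e)).
  apply: extv_free => j; apply: (extv_residue_ne cohA regA); lia.
have [m Hm] := cmod_deg_ge kC; have [K' [R [HR _]]] := resolution_ex cohA i Hm.
exact: (@extv_mid_sub _ _ _ _ t i kC K' R (res_projective cohA HR) HF (H2 l)).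
Qed.

Lemma projective_zero (X : C) : (forall Y, extv 1 X Y) ->
  (forall l, extv d kC (shC l X)) -> forall x : sval X, x = 0.
Proof.
move=> HX Hd x; have [n [e [p [q [qp pq]]]]] := projective_free HX.
have F0 : forall y : free A e, y = 0.
  apply: free_zero => l.
  have e1 : heq (comp (fhom (cmod_shift A l) q) (fhom (cmod_shift A l) p)) (idm _).
    by rewrite -fhomM qp fhom1.
  exact: extv_iso e1 (Hd l).
have /heq_gr_fact /(_ x) := pq; rewrite gr1 => <-.
by rewrite [gr q x]F0 linear0.
Qed.

Theorem depth_vanishing (X Y : C) : (forall l, extv 0 kC (shC l X)) -> extv d X Y.
Proof.
move=> HX; have [d0|dpos] := posnP d.
  have X0 : forall x : sval X, x = 0.
    apply: projective_zero => [Z|l]; last by rewrite d0.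
    by apply: (extv_gt cohA regA); rewrite d0.
  by rewrite d0 => f; apply/heq_gr_eq0 => x; rewrite (X0 x) linear0.
have [d' dd] : exists d', d'.+1 = d by exists d.-1; lia.
have [|K [HK K0]] := depth_syzygy HX (i := d'); first by lia.
have [n [e [L [i [p [ex im]]]]]] := minimal_resolution_step K.
pose s := @full_ses _ _ _ L (FC e) K (gr i) (gr p) ex.
have HL Z : extv 1 L Z.
  apply: (@extv_unshift _ _ _ _ _ _ s (@FC_projective _ e)).
  by apply/HK; apply: (extv_gt cohA regA); lia.
have [n' [e' [p' [q' [_ pq]]]]] := projective_free HL.
have L0 : forall x : sval L, x = 0.
  apply: (projective_zero HL) => l; rewrite -dd.
  have [m Hm] := cmod_deg_ge kC; have [S [R [HR _]]] := resolution_ex cohA d' Hm.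
  have PR := res_projective cohA HR; apply: (extv_res PR) => h.
  pose t : ses (shC l L) (shC l K) := fses (cmod_shift_exact l) s.
  have [|u Hu] := @minimal_entry_boundary _ e _ e' (comp i p') l d' S R
      (comp (fhom (cmod_shift A l) q') h) dd PR.
    by move=> x j; rewrite gr_comp; exact: im.
  apply: (@extv_connecting _ _ _ _ t d' kC S R PR (K0 l) h u).
  rewrite Hu fhomM -(compA (fhom (cmod_shift A l) i)) (compA (fhom (cmod_shift A l) p')).
  by rewrite -fhomM pq fhom1 comp1m.
rewrite -dd -[d']add0n; apply/HK.
apply: (@extv_res _ _ _ _ _ _ (s : yext 0 K L)); first exact: FC_projective.
by move=> h; exists (hzero _ _); apply/heq_gr => x; rewrite (L0 x) !linear0.
Qed.

End Depth.

(** * Finiteness and cohomological dimension *)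

Lemma shift_cast (k : fieldType) (A : gralg k) (Y : cmod A) (a b c : int) : c = (a + b) ->
  (exists u : hom (cmod A) (shC c Y) (shC b (shC a Y)), forall x, gr u x = x) /\
  (exists u : hom (cmod A) (shC b (shC a Y)) (shC c Y), forall x, gr u x = x).
Proof.
move=> ->.
have Hf n x : mgr (sval (shC (a + b) Y)) n x -> mgr (sval (shC b (shC a Y))) n x.
  by rewrite /= (addrC a) addrA.
have Hg n x : mgr (sval (shC b (shC a Y))) n x -> mgr (sval (shC (a + b) Y)) n x.
  by rewrite /= (addrC a) addrA.
split.
  by exists (@ungr _ _ _ (shC (a + b) Y) (shC b (shC a Y))
    (@GrHom k A (sval (shC (a + b) Y)) (sval (shC b (shC a Y))) idfun Hf)).
by exists (@ungr _ _ _ (shC b (shC a Y)) (shC (a + b) Y)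
  (@GrHom k A (sval (shC b (shC a Y))) (sval (shC (a + b) Y)) idfun Hg)).
Qed.

Section RegularAlgebra.
Variables (k : fieldType) (A : gralg k).
Hypothesis cohA : coherent A.
Variable d : nat.
Hypothesis regA : regular A d.
Local Notation C := (cmod A).
Local Notation tr := (tr cohA).
Local Notation ti := (ti cohA).
Local Notation kC := (kC A).
Local Notation AC := (AC A).
Local Notation A1 := (cobj (fin_pres_regmod A)).
Local Notation FC e := (cobj (fp_free cohA e)).

Lemma seq_int_bound (s : seq int) : exists m : int, forall x, x \in s -> x < m.
Proof.
elim: s => [|y s [m Hm]]; first by exists 0.
exists (Num.max m (y + 1)) => x; rewrite inE => /orP[/eqP ->|/Hm].
  by rewrite lt_max ltrDl ltr01 orbT.
by rewrite lt_max => ->.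
Qed.

Lemma residue_vanishing_ex (Y : C) N : exists m0 : int, forall i (m : int), (i <= N)%N -> m0 <= m ->
  residue_vanishing i Y m.
Proof.
have one i : exists m0 : int, forall m : int, m0 <= m -> residue_vanishing i Y m.
  have [s Hs] := extv_residue_bounded cohA regA i Y; have [m0 Hm0] := seq_int_bound s.
  exists m0 => m mm j mj; apply: (extv_shift_adjunct cohA); apply: Hs.
  by apply/negP => /Hm0; lia.
elim: N => [|N [m0 H0]].
  have [m0 H0] := one 0%N; exists m0 => i m; rewrite leqn0 => /eqP ->; exact: H0.
have [m1 H1] := one N.+1; exists (Num.max m0 m1) => i m iN.
rewrite ge_max => /andP[mm0 mm1]; have [->|ne] := eqVneq i N.+1; first exact: H1.
by apply: H0 => //; lia.
Qed.

Lemma trunc_residue_vanishing (X : C) : exists m0 : int, forall m, m0 <= m ->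
  forall l, extv 0 kC (shC l (tr m X)).
Proof.
have [s Hs] := extv_residue_bounded cohA regA 0 X; have [m0 Hm0] := seq_int_bound s.
exists m0 => m mm l f; apply/heq_gr_eq0 => x.
have [ls|ls] := boolP (l \in s).
  have Hx : mgr (resmod A) 0 x by left.
  apply: (@tr_deg_ge _ _ cohA m X (0 + l)); last exact: (gfunP (gr f) Hx).
  by have := Hm0 l ls; lia.
apply: (@ti_inj _ _ cohA m X); rewrite linear0.
have /heq_gr_comp0 := Hs l ls (comp (fhom (cmod_shift A l) (ti m X)) f).
exact.
Qed.

Lemma trunc_extv_depth (X : C) : exists m0 : int, forall m, m0 <= m -> forall Y,
  extv d (tr m X) Y.
Proof.
have [m0 H] := trunc_residue_vanishing X; exists m0 => m mm Y.
by apply: (depth_vanishing cohA regA); exact: H.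
Qed.

Lemma extv_AC_shift i l j (X : C) : extv i X (AC (l + j)) -> extv i X (shC j (AC l)).
Proof.
have [[u Hu] [v Hv]] := @shift_cast k A A1 l j _ erefl.
apply: (@extv_iso _ _ _ _ _ _ u v); apply/heq_gr_fact => x.
by rewrite Hu Hv.
Qed.

Lemma residue_vanishing_AC i l (m : int) :
  (forall j, m <= j -> extv i kC (AC (l + j))) -> residue_vanishing i (AC l) m.
Proof.
move=> H j mj; apply: (extv_shift_adjunct cohA); apply: extv_AC_shift; exact: H.
Qed.

Lemma aug_hom : exists f : grhom (regmod A) (resmod A), forall x, f x = aug x.
Proof.
have Lf : linear (fun x : regmod A => (aug x : resmod A)).
  move=> a x y; rewrite [aug _]augD; congr (_ + _).
  by rewrite [aug _]augM mulrC.
have Gf n x : mgr (regmod A) n x -> mgr (resmod A) n (aug x).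
  by move=> Hx; have [->|n0] := eqVneq n 0; [left|right; exact: agrz_aug n0].
by exists (mkhom Lf Gf).
Qed.

Lemma residue_sexact : exists f : grhom (regmod A) (resmod A), sexact (gr (ti 1 A1)) f.
Proof.
have [f Hf] := aug_hom; have aug0 : aug (0 : A) = 0.
  by apply: aug_eq; rewrite scale0r subr0; exact: Aplus0.
exists f; split.
- exact: ti_inj.
- move=> x; rewrite Hf -aug_homog_coef.
  have e := gsub_inc_in (S := trunc_sub (regmod A) 1) x 0 ltr01.
  exact: etrans (congr1 (@aug k A) e) aug0.
- move=> x; rewrite Hf => x0; apply: (gsub_inc_ex (S := trunc_sub (regmod A) 1)) => n n1.
  have [n0|n0] := ltP n 0; first exact: (agrz_neg n0 (homog_coefP n x)).
  have -> : n = 0 by lia.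
  apply: etrans (agrz_scalar (homog_coefP 0 x)) _.
  by rewrite aug_homog_coef x0 scale0r.
- by move=> c; exists (c%:A : A); rewrite Hf; apply: aug_eq; rewrite subrr; exact: Aplus0.
Qed.

Lemma eproj_regmod : eproj (regmod A).
Proof.
move=> M N p f ps.
have [x [Hx px]] := surj_mgr (ps (f (1 : A))) (gfunP f (agr1 A : mgr (regmod A) 0 (1 : A))).
have Lg : linear (fun a : regmod A => x *^ (a : A)).
  move=> a u v; rewrite ractDa; congr (_ + _); exact: ractM.
have Gg n (a : regmod A) : mgr (regmod A) n a -> mgr M n (x *^ (a : A)).
  by move=> Ha; rewrite -[n]add0r; exact: mgr_actz.
exists (mkhom Lg Gg) => a /=; rewrite ghomM px -ghomM; by congr (f _); rewrite -[RHS](mul1r (a : A)).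
Qed.

Lemma A1_projective : projective (A1 : C).
Proof. exact/cmod_projective/eproj_regmod. Qed.

Lemma extv_residue_trunc n (Y : C) : extv n.+1 (tr 1 A1) Y -> extv n.+2 kC Y.
Proof.
have [f ex] := residue_sexact; pose s := @full_ses _ _ _ (tr 1 A1) A1 kC (gr (ti 1 A1)) f ex.
have [K [R [HR _]]] := resolution_ex cohA n (@tr_deg_ge _ _ cohA 1 A1).
exact: (@extv_shift _ _ _ _ _ _ s _ R A1_projective (res_projective cohA HR)).
Qed.

Lemma extv_residue_trunc0 (Y : C) :
  (forall h : hom C (tr 1 A1) Y, exists t, heq (comp t (ti 1 A1)) h) -> extv 1 kC Y.
Proof.
have [f ex] := residue_sexact; pose s := @full_ses _ _ _ (tr 1 A1) A1 kC (gr (ti 1 A1)) f ex.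
exact: (@extv_res _ _ 0 kC Y _ s A1_projective).
Qed.

Lemma extv_residue_trunc_ex (Y : C) : extv 1 kC Y ->
  forall h : hom C (tr 1 A1) Y, exists t, heq (comp t (ti 1 A1)) h.
Proof.
have [f ex] := residue_sexact; pose s := @full_ses _ _ _ (tr 1 A1) A1 kC (gr (ti 1 A1)) f ex.
by move=> H; exact: (H _ s A1_projective).
Qed.

Lemma trunc_extv1 : (d <= 1)%N -> forall Y, extv 1 (tr 1 A1) Y.
Proof.
have [f ex] := residue_sexact; pose s := @full_ses _ _ _ (tr 1 A1) A1 kC (gr (ti 1 A1)) f ex.
move=> d1 Y; apply: (@extv_unshift _ _ _ _ _ _ s A1_projective).
by apply: (extv_gt cohA regA).
Qed.

(* For d = 1 the ideal A_+ is free on generators of positive degree, and the   *)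
(* projection to a summand A[-a] does not extend to A; so Ext^1(k, A[-a]) <> 0. *)
Lemma extv_residue_nonneg i l : (0 < d)%N -> (i <= 1)%N -> 0 <= l -> extv i kC (AC l).
Proof.
move=> dpos i1 l0; have [e|ne] := eqVneq i d; last exact/(extv_residue_ne cohA regA)/eqP.
have d1 : d = 1%N by lia.
have [m [Hm nHm]] := extv_residue_eq cohA regA.
suff m0 : m < 0 by rewrite e; apply: Hm; lia.
rewrite ltNge; apply/negP => m0; case: nHm; rewrite d1.
have [n [e' [p [q [qp pq]]]]] := projective_free cohA (trunc_extv1 (eq_leq d1)).
case: n e' p q qp pq => [|n] e' p q qp pq.
  apply: extv_residue_trunc0 => h; exists (hzero _ _); apply/heq_gr_fact => x.
  have /heq_gr_fact /(_ x) := pq; rewrite gr1 => <-.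
  have -> : gr q x = 0 by apply/ffunP => -[].
  by rewrite !linear0.
have pos : 0 < e' ord0.
  rewrite ltNge; apply/negP => e0; have Hg := free_gen_homog A e' ord0.
  have pg : gr p (free_gen A e' ord0) = 0.
    by apply: (@tr_deg_ge _ _ cohA 1 A1 (e' ord0)); [lia|exact: (gfunP (gr p) Hg)].
  have /heq_gr_fact /(_ (free_gen A e' ord0)) := qp; rewrite gr1 pg linear0.
  move=> /(congr1 (fun x : free_type A _ => (x ord0 : A))); rewrite !ffunE eqxx.
  by move/esym/eqP; rewrite oner_eq0.
have [f Hf] : exists f : grhom (free A e') (shift_mod (regmod A) (- e' ord0)),
    f (free_gen A e' ord0) = 1 :> A.
  have [|f Hf] := @free_hom_gen _ _ _ e' (shift_mod (regmod A) (- e' ord0))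
      (fun j => if j == ord0 then 1 : A else 0).
    move=> j; case: eqP => [->|_]; last exact: mgr0.
    by rewrite /= subrr; exact: agr1.
  by exists f; rewrite Hf.
have [|t /heq_gr_fact Ht] := @extv_residue_trunc_ex (AC (- e' ord0)) _
    (comp (@ungr _ _ _ (FC e') (AC (- e' ord0)) f) q).
  by rewrite -d1; apply: Hm; lia.
have t1 : gr t (1 : A) = 0.
  have := gfunP (gr t) (agr1 A : mgr (regmod A) 0 (1 : A)).
  by apply: agrz_neg; lia.
have t0 (a : A) : gr t a = 0.
  have := ghomM (gr t) (1 : A) a; rewrite t1 ract0 => <-; congr (gr t _).
  by rewrite -[LHS](mul1r a).
have := Ht (gr p (free_gen A e' ord0)); rewrite [LHS]t0 gr_comp ungrK.
have /heq_gr_fact /(_ (free_gen A e' ord0)) -> := qp; rewrite gr1 Hf.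
by move/esym/eqP; rewrite oner_eq0.
Qed.

Section Quotient.
Variables (Q : klcat k) (F : functor C Q).
Hypothesis F_fraction : forall (X Y : C) (w : hom Q (F X) (F Y)), exists m0 : int,
  forall m, m0 <= m -> exists f : hom C (tr m X) Y,
  heq (comp w (fhom F (ti m X))) (fhom F f).
Hypothesis F_eq0 : forall (X Y : C) (f : hom C X Y), heq (fhom F f) (hzero _ _) ->
  exists m0 : int, forall m, m0 <= m -> heq (comp f (ti m X)) (hzero _ _).
Hypothesis F_iso : forall m (X : C), exists v, heq (comp v (fhom F (ti m X))) (idm _) /\
  heq (comp (fhom F (ti m X)) v) (idm _).
Hypothesis F_obj : forall Z : Q, exists X, F X = Z.

Theorem quotient_Ext_finite : Ext_finite Q.
Proof.
move=> n X' Y'; have [X eX] := F_obj X'; have [Y eY] := F_obj Y'; subst X' Y'.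
have [m0 H] := residue_vanishing_ex Y n.+1; case: n H => [|n] H.
  have [N [th Hth]] := hom_lin_quot (tr m0 X) Y; exists N.
  by apply: (quotient_Ext_dim_hom F_fraction F_eq0 F_iso _ _ Hth); apply: H.
have [K [R [HR HK]]] := resolution_ex cohA n (@tr_deg_ge _ _ cohA m0 X).
have [N [th Hth]] := boundary_lin_quot Y R; exists N.
by apply: (quotient_Ext_dim_succ F_fraction F_eq0 F_iso F_obj _ _ _ _ HR HK Hth); apply: H.
Qed.

Theorem quotient_Ext_vanishing n (X' Y' : Q) : (d <= n)%N -> Ext_dim n X' Y' 0.
Proof.
move=> dn; have [X eX] := F_obj X'; have [Y eY] := F_obj Y'; subst X' Y'.
have [m0 H] := residue_vanishing_ex Y n.+1; have [m1 H1] := trunc_extv_depth X.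
pose m := Num.max m0 m1; have mm0 : m0 <= m by rewrite le_max lexx.
have HX : extv n (tr m X) Y.
  have [->|nd] := eqVneq n d; last by apply: (extv_gt cohA regA); lia.
  by apply: H1; rewrite le_max lexx orbT.
case: n H HX {dn} => [|n] H HX.
  by apply: (quotient_Ext_dim_hom F_fraction F_eq0 F_iso _ _ (lin_quot_zero HX)); apply: H.
have [K [R [HR HK]]] := resolution_ex cohA n (@tr_deg_ge _ _ cohA m X).
have Hth := lin_quot_zero (HX K R (res_projective cohA HR)).
by apply: (quotient_Ext_dim_succ F_fraction F_eq0 F_iso F_obj _ _ _ _ HR HK Hth); apply: H.
Qed.

Theorem quotient_Ext_nonvanishing n : n.+1 = d -> exists X Y : Q, ~ Ext_dim n X Y 0.
Proof.
move=> nd; have [l0 [Hl0 nHl0]] := extv_residue_eq cohA regA.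
exists (F A1), (F (AC l0)) => E0; apply: nHl0; rewrite -nd.
have H i : residue_vanishing i (AC l0) 1.
  apply: residue_vanishing_AC => j j1; have [->|ne] := pselect (i = d).
    by apply: Hl0; lia.
  exact: (extv_residue_ne cohA regA).
case: n nd E0 => [|n] nd E0.
  have [N [th Hth]] := hom_lin_quot (tr 1 A1) (AC l0).
  have EN := quotient_Ext_dim_hom F_fraction F_eq0 F_iso (H 0%N) (H 1%N) Hth.
  have N0 := Ext_dim_unique0 EN E0; subst N.
  apply: extv_residue_trunc0 => h; exists (hzero _ _); rewrite comp0l.
  have [_ _ _ _ Q5] := Hth; apply/heq_sym/Q5; exact: thinmx0.
have [K [R [HR HK]]] := resolution_ex cohA n (@tr_deg_ge _ _ cohA 1 A1).
have [N [th Hth]] := boundary_lin_quot (AC l0) R.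
have EN := quotient_Ext_dim_succ F_fraction F_eq0 F_iso F_obj (H 0%N) (H 1%N) (H n.+1) (H n.+2)
  HR HK Hth.
have N0 := Ext_dim_unique0 EN E0; subst N.
apply: extv_residue_trunc; apply: (extv_res (res_projective cohA HR)) => h.
by have [_ _ _ _ Q5] := Hth; apply/Q5; exact: thinmx0.
Qed.

End Quotient.
End RegularAlgebra.

(** * The algebra Gamma *)

Section Powers.
Variables (k : fieldType) (X : triple k).
Local Notation Q := (tcat X).
Local Open Scope kl_scope.

Lemma spow_hom_heq n (Y Z : Q) (f g : hom Q Y Z) : f == g ->
  spow_hom (X := X) n f == spow_hom n g.
Proof. by elim: n Y Z f g => [|n IH] Y Z f g fg //=; apply/IH/fhom_heq. Qed.

Lemma spow_hom1 n (Y : Q) : spow_hom (X := X) n (idm Y) == 1.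
Proof.
elim: n Y => [|n IH] Y /=; first reflexivity.
by rewrite (spow_hom_heq n (fhom1 (tshift X) Y)) IH.
Qed.

Lemma spow_homM n (Y Z T : Q) (g : hom Q Z T) (f : hom Q Y Z) :
  spow_hom (X := X) n (g \o f) == spow_hom n g \o spow_hom n f.
Proof.
elim: n Y Z T g f => [|n IH] Y Z T g f /=; first reflexivity.
by rewrite (spow_hom_heq n (fhomM (tshift X) g f)) IH.
Qed.

Lemma spow_add_nat i j (Y Z : Q) (f : hom Q Y Z) :
  spow_add (X := X) i j Z \o spow_hom j (spow_hom i f) == spow_hom (i + j)%N f \o spow_add i j Y.
Proof.
elim: i Y Z f => [|i IH] Y Z f /=; last exact: IH.
rewrite comp1m compm1; reflexivity.
Qed.

End Powers.

Section GammaOfRegular.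
Variables (k : fieldType) (A : gralg k).
Local Notation C := (cmod A).
Local Notation A1 := (cobj (fin_pres_regmod A)).
Local Open Scope kl_scope.

Lemma shift_cast0 (Y : C) :
  (exists u : hom C (shC 0 Y) Y, forall x, gr u x = x) /\
  (exists u : hom C Y (shC 0 Y), forall x, gr u x = x).
Proof.
have Hf n x : mgr (sval (shC 0 Y)) n x -> mgr (sval Y) n x by rewrite /= addr0.
have Hg n x : mgr (sval Y) n x -> mgr (sval (shC 0 Y)) n x by rewrite /= addr0.
split.
  by exists (@ungr _ _ _ (shC 0 Y) Y (@GrHom k A (sval (shC 0 Y)) (sval Y) idfun Hf)).
by exists (@ungr _ _ _ Y (shC 0 Y) (@GrHom k A (sval Y) (sval (shC 0 Y)) idfun Hg)).
Qed.

Section Triple.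
Variables (Q : klcat k) (F : functor C Q) (s : functor Q Q) (se : autoequivalence s).
Local Notation X := (Triple (F A1) se).
Hypothesis F_shift : exists (eps : forall Y, hom Q (F (shC 1 Y)) (s (F Y)))
  (eps' : forall Y, hom Q (s (F Y)) (F (shC 1 Y))),
  [/\ forall Y, eps Y \o eps' Y == 1, forall Y, eps' Y \o eps Y == 1 &
   forall Y Z (f : hom C Y Z), fhom s (fhom F f) \o eps Y == eps Z \o fhom F (fhom (cmod_shift A 1) f)].

Local Notation sM := (@spow_homM k X).
Local Notation sE := (@spow_hom_heq k X).
Local Notation s1 := (@spow_hom1 k X).

Lemma F_spow : exists (th : forall n Y, hom Q (F (shC n%:Z Y)) (spow (X := X) n (F Y)))
  (th' : forall n Y, hom Q (spow (X := X) n (F Y)) (F (shC n%:Z Y))),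
  [/\ forall n Y, th n Y \o th' n Y == 1, forall n Y, th' n Y \o th n Y == 1,
   forall n Y Z (f : hom C Y Z),
     spow_hom (X := X) n (fhom F f) \o th n Y == th n Z \o fhom F (fhom (cmod_shift A n%:Z) f),
   forall i j Y (c : hom C (shC j%:Z (shC i%:Z Y)) (shC (i + j)%N%:Z Y)), (forall x, gr c x = x) ->
     spow_add (X := X) i j (F Y) \o spow_hom (X := X) j (th i Y) \o th j (shC i%:Z Y) ==
     th (i + j)%N Y \o fhom F c
   & forall Y (c : hom C Y (shC 0 Y)), (forall x, gr c x = x) -> th 0%N Y \o fhom F c == 1].
Proof.
have [eps [eps' [ee' e'e en]]] := F_shift.
have /dep_choice [u Hu] := fun Y => (shift_cast0 Y).1.
have /dep_choice [u' Hu'] := fun Y => (shift_cast0 Y).2.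
have sc n Y := @shift_cast k A Y 1%R n%:Z n.+1%:Z (PoszD 1%N n).
have /dep_choice [v Hv] := fun n => dep_choice (fun Y => (sc n Y).1).
have /dep_choice [v' Hv'] := fun n => dep_choice (fun Y => (sc n Y).2).
have uu' Y : u Y \o u' Y == 1 by apply/heq_gr_fact => x; rewrite Hu Hu'.
have u'u Y : u' Y \o u Y == 1 by apply/heq_gr_fact => x; rewrite Hu' Hu.
have vv' n Y : v n Y \o v' n Y == 1 by apply/heq_gr_fact => x; rewrite Hv Hv'.
have v'v n Y : v' n Y \o v n Y == 1 by apply/heq_gr_fact => x; rewrite Hv' Hv.
pose th := fix th n Y {struct n} : hom Q (F (shC n%:Z Y)) (spow (X := X) n (F Y)) :=
  match n return hom Q (F (shC n%:Z Y)) (spow (X := X) n (F Y)) with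
  | 0%N => fhom F (u Y)
  | m.+1 => spow_hom (X := X) m (eps Y) \o th m (shC 1 Y) \o fhom F (v m Y)
  end.
pose th' := fix th' n Y {struct n} : hom Q (spow (X := X) n (F Y)) (F (shC n%:Z Y)) :=
  match n return hom Q (spow (X := X) n (F Y)) (F (shC n%:Z Y)) with
  | 0%N => fhom F (u' Y)
  | m.+1 => fhom F (v' m Y) \o (th' m (shC 1 Y) \o spow_hom (X := X) m (eps' Y))
  end.
have thn n Y Z (f : hom C Y Z) :
    spow_hom (X := X) n (fhom F f) \o th n Y == th n Z \o fhom F (fhom (cmod_shift A n%:Z) f).
  elim: n Y Z f => [|n IH] Y Z f /=.
    rewrite -!fhomM; apply/fhom_heq/heq_gr_comp => x; rewrite !Hu; reflexivity.
  rewrite !compA -sM (sE n (en _ _ f)) sM -(compA (spow_hom (X := X) n (eps Z))) IH.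
  rewrite -!compA -!fhomM.
  do 2!(apply: comp_heq; first reflexivity).
  by apply/fhom_heq/heq_gr_comp => x; rewrite !Hv.
exists th, th'; split=> //.
- elim=> [|n IH] Y /=; first by rewrite -fhomM uu' fhom1.
  rewrite -!compA (compA (fhom F (v n Y))) -fhomM vv' fhom1 comp1m (compA (th n _)) IH comp1m.
  by rewrite -sM (sE n (ee' _)) s1.
- elim=> [|n IH] Y /=; first by rewrite -fhomM u'u fhom1.
  rewrite -!compA (compA (spow_hom (X := X) n (eps' Y))) -sM (sE n (e'e _)) s1 comp1m.
  by rewrite (compA (th' n _)) IH comp1m -fhomM v'v fhom1.
- elim=> [|i IH] j Y c Hc /=.
    rewrite comp1m thn; apply: comp_heq; first reflexivity.
    by apply/fhom_heq/heq_gr => x; rewrite Hc; exact: (Hu Y x).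
  have [_ [c' Hc']] := @shift_cast k A (shC 1 Y) i%:Z j%:Z (i + j)%N%:Z (PoszD i j).
  have e := IH j (shC 1 Y) c' Hc'.
  have e' := spow_add_nat (X := X) i j (eps Y).
  rewrite (sM j) (sM j) !compA e'.
  rewrite -!compA thn (compA _ (th j _)) (compA (spow_add (X := X) _ _ _)).
  rewrite (compA (spow_add (X := X) _ _ _)) e.
  rewrite -!compA -!fhomM.
  do 2!(apply: comp_heq; first reflexivity).
  by apply/fhom_heq/heq_gr_comp => x; rewrite Hc' gr_shift !Hv Hc.
- by move=> Y c Hc /=; rewrite -fhomM -[idm (F Y)]fhom1; apply/fhom_heq/heq_gr_fact => x; rewrite Hu Hc.
Qed.

Hypothesis F_full : forall i (h : hom Q (F A1) (F (shC (Posz i) A1))), exists f, h == fhom F f.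
Hypothesis F_faithful : forall i (f g : hom C A1 (shC (Posz i) A1)), fhom F f == fhom F g -> f == g.

Lemma left_mul_ex i (a : A) : exists g : hom C A1 (shC (Posz i) A1),
  agr A i a -> forall x : A, gr g x = (a * x)%R :> A.
Proof.
have [Ha|nHa] := pselect (agr A i a); last by exists (hzero _ _) => /nHa.
pose g (x : regmod A) : shift_mod (regmod A) i%:Z := (a * x)%R.
have Lg : linear g by move=> b x y; rewrite /g [LHS]mulrDr; congr (_ + _)%R; exact: (mulrA a (x : A) (b : A)).
have Gg n x : mgr (regmod A) n x -> mgr (shift_mod (regmod A) i%:Z) n (g x).
  by move=> Hx; rewrite /= addrC; exact: (@agrzM _ _ i%:Z n a x Ha Hx).
by exists (@ungr _ _ _ A1 (shC (Posz i) A1) (mkhom Lg Gg)).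
Qed.

Theorem iso_Gamma_triple : iso_Gamma X A.
Proof.
have [th [th' [tt' t't thn tha th1]]] := F_spow.
have /dep_choice [g Hg] := fun i => dep_choice (left_mul_ex i).
have hom_eq (Y : C) (f h : hom C A1 Y) : gr f (1%R : A) = gr h (1%R : A) -> f == h.
  move=> e; apply/heq_gr => x; have -> : x = ((1%R : sval A1) *^ (x : A)).
    by rewrite -[LHS](mul1r (x : A)).
  by rewrite !ghomM e.
have gE i a : agr A i a -> gr (g i a) (1%R : A) = a by move=> Ha; rewrite Hg // mulr1.
exists (fun i a => th i A1 \o fhom F (g i a)); split.
- move=> i c a b Ha Hb; rewrite -compZr -fhomZ -compDr -fhomD.
  apply: comp_heq; first reflexivity.
  apply/fhom_heq/hom_eq; rewrite gE; last by apply: agrD => //; exact: agrZ.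
  rewrite gr_add gr_scale !gE //; congr (_ + _)%R.
  by rewrite -[RHS]scalerAr mulr1.
- move=> i a b Ha Hb e; rewrite -(gE i a) // -(gE i b) //.
  have /heq_gr -> // : g i a == g i b.
  apply: F_faithful; rewrite -(comp1m (fhom F (g i a))) -t't -compA e compA t't.
  exact: comp1m.
- move=> i f; have [h Hh] := F_full (th' i A1 \o f).
  have Ha : agr A i (gr h (1%R : A)).
    by have := gfunP (gr h) (agr1 A : mgr (regmod A) 0 (1%R : A)).
  exists (gr h (1%R : A)); split=> //.
  have -> : g i (gr h (1%R : A)) == h by apply: hom_eq; rewrite gE.
  by rewrite -Hh compA tt' comp1m.
- move=> i j a b Ha Hb; rewrite /Gamma_mul.
  have [_ [c Hc]] := @shift_cast k A A1 i%:Z j%:Z (i + j)%N%:Z (PoszD i j).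
  rewrite sM -!compA (compA (spow_hom (X := X) j (fhom F _))) thn -!compA.
  rewrite (compA (spow_hom (X := X) j _)) (compA (spow_add (X := X) _ _ _)).
  have e := tha i j A1 c Hc; rewrite -compA in e.
  rewrite e -compA -!fhomM; apply: comp_heq; first reflexivity.
  apply/fhom_heq/hom_eq; rewrite gE; last exact: agrM.
  by rewrite !gr_comp gr_shift Hc (gE j) // Hg.
- have [_ [c Hc]] := shift_cast0 A1.
  rewrite -(th1 A1 c Hc); apply: comp_heq; first reflexivity.
  by apply/fhom_heq/hom_eq; rewrite gE ?Hc //; exact: agr1.
Qed.

End Triple.
End GammaOfRegular.

Section Main.
Variables (k : fieldType) (A : gralg k) (d : nat).
Hypothesis cohA : coherent A.
Hypothesis regA : regular A d.
Local Notation C := (cmod A).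
Local Notation W := (@serre_iso k C (@tors k A)).

Definition to_qgr : functor C (qgr A) := loc W.

Lemma to_qgr_fraction (X Y : C) (w : hom (qgr A) (to_qgr X) (to_qgr Y)) : exists m0 : int,
  forall m, m0 <= m -> exists f : hom C (tr cohA m X) Y,
  heq (comp w (fhom to_qgr (ti cohA m X))) (fhom to_qgr f).
Proof.
apply: (@hom_fraction k C W (tr cohA) (ti cohA)) => [m m' X' Y' f mm|X' Y' s Ws].
  by apply: ti_factor; apply: deg_ge_le mm _; exact: tr_deg_ge.
exact: serre_iso_section.
Qed.

Lemma to_qgr_eq0 (X Y : C) (f : hom C X Y) : heq (fhom to_qgr f) (hzero _ _) ->
  exists m0 : int, forall m, m0 <= m -> heq (comp f (ti cohA m X)) (hzero _ _).
Proof. exact: loc_eq0. Qed.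

Lemma to_qgr_iso m (X : C) : exists v, heq (comp v (fhom to_qgr (ti cohA m X))) (idm _) /\
  heq (comp (fhom to_qgr (ti cohA m X)) v) (idm _).
Proof. exact: (loc_inv (@ti_serre_iso _ _ cohA m X)). Qed.

Lemma to_qgr_obj (Z : qgr A) : exists X, to_qgr X = Z.
Proof. by exists Z. Qed.

Lemma to_qgr_shift : exists
  (eps : forall Y, hom (qgr A) (to_qgr (shC 1 Y)) (qgr_shift A 1 (to_qgr Y)))
  (eps' : forall Y, hom (qgr A) (qgr_shift A 1 (to_qgr Y)) (to_qgr (shC 1 Y))),
  [/\ forall Y, heq (comp (eps Y) (eps' Y)) (idm _),
   forall Y, heq (comp (eps' Y) (eps Y)) (idm _) &
   forall Y Z (f : hom C Y Z), heq (comp (fhom (qgr_shift A 1) (fhom to_qgr f)) (eps Y))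
     (comp (eps Z) (fhom to_qgr (fhom (cmod_shift A 1) f)))].
Proof.
exists (fun Y => idm (to_qgr (shC 1 Y))), (fun Y => idm (to_qgr (shC 1 Y))).
split=> [Y|Y|Y Z f]; [exact: comp1m|exact: comp1m|].
exact: heq_trans (compm1 _) (heq_sym (comp1m _)).
Qed.

Theorem iso_Gamma_proj : (0 < d)%N -> iso_Gamma (proj A) A.
Proof.
move=> dpos.
have DA : deg_ge (regmod A) 0 by move=> n x; exact: agrz_neg.
have H r i : (r <= 1)%N -> residue_vanishing r (AC A i%:Z) 0.
  move=> r1; apply: (residue_vanishing_AC cohA) => j j0.
  by apply: (extv_residue_nonneg cohA regA) => //; lia.
apply: (@iso_Gamma_triple k A (qgr A) to_qgr (qgr_shift A 1) (qgr_shift_autoequivalence A 1)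
  to_qgr_shift) => i.
- by move=> h; apply: (F_full_above to_qgr_fraction to_qgr_iso (H 1%N i _) h DA).
- by move=> f g; apply: (F_faithful_above to_qgr_eq0 (H 0%N i _) (P := cobj (fin_pres_regmod A)) DA).
Qed.

End Main.

Theorem proposition5p1 (k : fieldType) (A : gralg k) (d : nat)
    (cohA : coherent A) (regA : regular A d) :
  chi A /\
  ((0 < d)%N -> iso_Gamma (proj A) A) /\
  (Ext_finite (qgr A) /\ cohdim_eq (qgr A) (d%:Z - 1)).
Proof.
have FF := @to_qgr_fraction k A cohA; have F0 := @to_qgr_eq0 k A cohA.
have FI := @to_qgr_iso k A cohA; have FO := @to_qgr_obj k A.
split; first exact: chi_holds regA.
split; first exact: iso_Gamma_proj.
split; first exact: (quotient_Ext_finite regA FF F0 FI FO).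
split=> [i X Y di|].
  by apply: (quotient_Ext_vanishing regA FF F0 FI FO); lia.
case: d regA => [|n] regA'; [left|right]; first by [].
have [X [Y H]] := quotient_Ext_nonvanishing regA' FF F0 FI FO erefl.
by exists n, X, Y; split=> //; lia.
Qed.
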